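(* Let $(X_t)_{t\ge0}$ be a time-homogeneous continuous-time Markov process with countable state space $S$ (transition rates not assumed symmetric), let $i\in S$, and suppose $p_t(i,i)\sim ct^{-\alpha}$ as $t\to\infty$ for some $c,\alpha>0$. Let $L_t=\int_0^t\mathbf 1_{\{X_s=i\}}\,ds$ for the process started in $i$, and for $\kappa>0$ let $r(\kappa)=\lim_{t\to\infty}\frac1t\log\mathbb{E}[e^{\kappa L_t}]$. Then with $\kappa_{cr}:=\frac1{G_\infty}$ the following hold: i) $r(\kappa)\ge0$, and $r(\kappa)>0$ if and only if $\kappa>\kappa_{cr}$. ii) The function $\kappa\mapsto r(\kappa)$ is strictly convex for $\kappa>\kappa_{cr}$. iii) $r(\kappa)\le\kappa$ for all $\kappa$, and $\frac{r(\kappa)}\kappa\to1$ as $\kappa\to\infty$. iv) If $\alpha\le1$, then $\kappa_{cr}=0$ and, as $\kappa\searrow0$: if $0<\alpha<1$, $r(\kappa)\sim\kappa^{\frac1{1-\alpha}}(c\,\Gamma(1-\alpha))^{\frac1{1-\alpha}}$; if $\alpha=1$, $r(\kappa)=\exp\big(-(c\kappa)^{-1}+o(\kappa^{-1})\big)$. v) If $\alpha>1$, then $\kappa_{cr}>0$ and, as $\kappa\searrow\kappa_{cr}$, $$r(\kappa)\sim\begin{cases}(\kappa-\kappa_{cr})^{\frac1{\alpha-1}}\Big(\frac{G_\infty^2(\alpha-1)}{c\,\Gamma(2-\alpha)}\Big)^{\frac1{\alpha-1}}&:1<\alpha<2,\\[1ex] \frac{\kappa-\kappa_{cr}}{\log\big(\frac1{\kappa-\kappa_{cr}}\big)}\,\frac{G_\infty^2}{c}&:\alpha=2,\\[1ex]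 (\kappa-\kappa_{cr})\frac{G_\infty^2}{H_\infty}&:\alpha>2.\end{cases}$$
   Context: $p_t(i,j)=\mathbb{P}[X_t=j\mid X_0=i]$; the process is a (conservative) continuous-time Markov chain with right-continuous paths. $G_\infty=\int_0^\infty p_t(i,i)\,dt\in(0,\infty]$ (with $1/\infty=0$), $H_\infty=\int_0^\infty t\,p_t(i,i)\,dt$. $h_1\sim h_2$ means $\lim h_1/h_2=1$; $\Gamma$ is the Gamma function. *)

(* Defs.v *)
From HB Require Import structures.
From mathcomp Require Import all_boot all_order all_algebra.
From mathcomp Require Import all_classical all_reals all_analysis.

Set Implicit Arguments.
Unset Strict Implicit.
Unset Printing Implicit Defensive.

Import Order.TTheory GRing.Theory Num.Theory.
Import numFieldNormedType.Exports.

Local Open Scope classical_set_scope.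
Local Open Scope ring_scope.

(* The sigma-algebra on Omega generated by (X_u)_(0 <= u <= s). *)
Definition past (R : realType) (Omega : Type) (S : Type)
    (X : R -> Omega -> S) (s : R) : set (set Omega) :=
  <<s [set B | exists u x, 0 <= u <= s /\ B = [set w | X u w = x]] >>.

(* A continuous-time Markov chain on the countable state space S is given by
   its paths t |-> X t w for t >= 0 (the values of X at negative times are
   irrelevant) and by the family of laws Pr, where Pr j is the law of the chain
   started in j, that is P[ _ | X_0 = j].
   The chain is conservative: X t w is in S for all t, hence
   sum_k Pr j [X t = k] = 1. *)
Record markov_chain (R : realType) (d : measure_display)
    (Omega : measurableType d) (S : countType)
    (Pr : S -> probability Omega R) (X : R -> Omega -> S) : Prop :=
  MarkovChain {
    chain_measurable : forall (t : R) (k : S),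
      0 <= t -> measurable [set w | X t w = k];
    chain_start : forall j : S, Pr j [set w | X 0 w = j] = 1%E;
    (* right-continuity for the discrete topology on S *)
    chain_right_continuous : forall (w : Omega) (t : R),
      0 <= t -> \forall s \near t^'+, X s w = X t w;
    (* P[X_(s+t) = k | A, X_s = j] = P[X_t = k | X_0 = j] for A in the past of s,
       multiplied out so that null events are allowed *)
    chain_markov : forall (i j k : S) (s t : R) (A : set Omega),
      0 <= s -> 0 <= t -> past X s A ->
      (Pr i (A `&` [set w | X s w = j] `&` [set w | X (s + t)%R w = k])
       = Pr i (A `&` [set w | X s w = j]) * Pr j [set w | X t w = k])%E
  }.

Section LocalTime.
Context {R : realType} {d : measure_display} {Omega : measurableType d}.
Context {S : countType}.
Variables (Pr : S -> probability Omega R) (X : R -> Omega -> S).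

Definition trans_prob (t : R) (i j : S) : R :=
  fine (Pr i [set w | X t w = j]).

Definition Green (i : S) : \bar R :=
  (\int[lebesgue_measure]_(t in `[0%R, +oo[) (trans_prob t i i)%:E)%E.

Definition Hinfty (i : S) : \bar R :=
  (\int[lebesgue_measure]_(t in `[0%R, +oo[) (t * trans_prob t i i)%:E)%E.

(* The inverse is that of the extended reals, so that 1/oo = 0; G_oo > 0 by
   right-continuity of the paths, so that the inverse is finite. *)
Definition kappa_cr (i : S) : R := fine (Green i)^-1%E.

Definition local_time (i : S) (t : R) (w : Omega) : R :=
  \int[lebesgue_measure]_(s in `[0, t]) (X s w == i)%:R.

Definition log_moment (i : S) (kappa t : R) : R :=
  t^-1 * ln (fine 'E_(Pr i)[fun w => expR (kappa * local_time i t w)]).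

Definition growth_rate (i : S) (kappa : R) : R :=
  lim (log_moment i kappa t @[t --> +oo]).

End LocalTime.

(* h1 ~ h2 along the filter F *)
Definition asymp (R : realType) (F : set_system R) (h1 h2 : R -> R) : Prop :=
  h1 x / h2 x @[x --> F] --> (1 : R).

Definition Gamma (R : realType) (x : R) : R :=
  \int[lebesgue_measure]_(t in `]0, +oo[) (t `^ (x - 1) * expR (- t)).

Definition strictly_convex_on (R : realType) (D : set R) (f : R -> R) : Prop :=
  forall (x y t : R), D x -> D y -> x != y -> 0 < t < 1 ->
    f (t * x + (1 - t) * y) < t * f x + (1 - t) * f y.

(* Main.v *)
(* The returns to [i] of the chain weighted by e^(k L_t), that is
   w(t) = E[e^(k L_t); X_t = i], solve the renewal equation w = p + k (w * p) with
   p(t) = p_t(i,i), and E[e^(k L_t)] = 1 + k \int_0^t w. Tilting by e^(-s t) shows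
   that E[e^(k L_t)] is at most of order e^(s t) when k P(s) < 1 and at least of
   order e^(s t) when 1 < k P(s), where P is the Laplace transform of p. Hence
   r(k) = 0 for k <= 1 / P(0), and k P(r(k)) = 1 for k > 1 / P(0).
   The asymptotics of r at the critical point are those of P(s), or of P(0) - P(s),
   as s tends to 0, given by Abelian theorems; P' has to be used for alpha > 1.
   Convexity of r comes from that of exp. If it were not strict, r would be
   affine on an interval, so that P(s) = B / (s - A) on an interval; expanding in
   power series with nonnegative coefficients this would hold for all s > max(A, 0),
   which is incompatible with the power decay of p. *)

Require Import Defs.
From HB Require Import structures.
From mathcomp Require Import all_boot all_order all_algebra.
From mathcomp Require Import all_classical all_reals all_analysis measurable_realfun.
From mathcomp Require Import ring lra.

Set Implicit Arguments.
Unset Strict Implicit.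
Unset Printing Implicit Defensive.

Import Order.TTheory GRing.Theory Num.Theory.
Import numFieldNormedType.Exports.

Local Open Scope classical_set_scope.
Local Open Scope ring_scope.

(** * Occupation times *)

(** Neither a renewal theorem nor a Tauberian theorem enters. The renewal equation comes from the
    pathwise identity e^(k L_t) = 1 + k \int_0^t 1[X_s = i] e^(k L_s) ds: multiply by 1[X_t = i] and
    apply the Markov property at time s. The obstacle in both moment bounds is that the tilted
    integral of w over the half-line is not known to be finite. From above, it is cut at T, where it
    is finite, and absorbed in an inequality W <= Q + k Q W whose constants are free of T. From
    below, k P(s) > 1 already holds for the part of P(s) over a compact [a, b] with a > 0, and a
    bound c e^(s t) <= w(t) advances by steps of length a. Since P is strictly decreasing, at most
    one s escapes both bounds, which is why the limit r(k) exists. The continuation behind strict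
    convexity stays real: P(rho - h) is a series in h with nonnegative coefficients, and Tonelli
    gives this for all h >= 0, infinite values included. *)

Section affine_change_of_variable.
Context {R : realType}.
Local Notation mu := (@lebesgue_measure R).

Lemma ge0_integral_opp (f : R -> \bar R) :
  measurable_fun [set: R] f -> (forall x, 0 <= f x)%E ->
  (\int[mu]_x f (- x)%R = \int[mu]_x f x)%E.
Proof.
move=> mf f0.
transitivity (\int[pushforward mu (-%R : _ -> measurableTypeR R)]_x f x)%E.
  by rewrite ge0_integral_pushforward//=.
by apply: eq_measure_integral => //= A mA AS; exact: lebesgue_measureN.
Qed.

(** The pushforward of Lebesgue measure by x -> c x + a, multiplied by c, gives each half-open
    interval its length, so it is Lebesgue measure by uniqueness. *)
Lemma ge0_integral_affine (f : R -> \bar R) (c a : R) : 0 < c ->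
  measurable_fun [set: R] f -> (forall x, 0 <= f x)%E ->
  (\int[mu]_x f (c * x + a)%R = (c^-1)%:E * \int[mu]_x f x)%E.
Proof.
move=> c0 mf f0.
pose phi : measurableTypeR R -> measurableTypeR R := fun x => c * x + a.
have mphi : measurable_fun setT phi.
  by apply: measurable_funD => //; apply: measurable_funM.
have c0' : 0 <= c^-1 by rewrite invr_ge0 ltW.
transitivity (\int[pushforward mu phi]_x f x)%E.
  by rewrite ge0_integral_pushforward.
rewrite -[X in (X%:E * _)%E]/((NngNum c0')%:num) -ge0_integral_mscale//.
pose nu := mscale (NngNum (ltW c0))
  (measure_function_pushforward__canonical__measure_function_Measure mu mphi).
have key (A : set (measurableTypeR R)) : measurable A -> mu A = nu A.
  move: A; apply: (@lebesgue_measure_unique R nu) => X [[x y]] _ <- /=.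
  rewrite /nu /mscale/= /pushforward.
  have -> : phi @^-1` `]x, y] = `](x - a) / c, (y - a)/c]%classic.
    apply/seteqP; split => z /=; rewrite /phi !in_itv/= => /andP[h1 h2];
      apply/andP; split.
    - by rewrite ltr_pdivrMr// ltrBlDr mulrC.
    - by rewrite ler_pdivlMr// lerBrDr mulrC.
    - by move: h1; rewrite ltr_pdivrMr// ltrBlDr mulrC.
    - by move: h2; rewrite ler_pdivlMr// lerBrDr mulrC.
  rewrite !lebesgue_measure_itv/= !lte_fin ltr_pM2r ?invr_gt0// ltrD2r.
  case: ifPn => xy; last by rewrite mule0.
  by rewrite -!EFinB -EFinM; congr EFin; field; rewrite gt_eqF.
apply: eq_measure_integral => //= A mA AS.
by rewrite /mscale/= key// /nu /mscale/= muleA -EFinM mulVf ?gt_eqF// mul1e.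
Qed.

Lemma ge0_integral_shift (f : R -> \bar R) (a : R) :
  measurable_fun [set: R] f -> (forall x, 0 <= f x)%E ->
  (\int[mu]_x f (x - a)%R = \int[mu]_x f x)%E.
Proof.
move=> mf f0; rewrite -[RHS]mul1e -[X in (X%:E * _)%E]invr1.
by rewrite -(@ge0_integral_affine _ 1 (- a))//; under [in RHS]eq_integral do rewrite mul1r.
Qed.

End affine_change_of_variable.

Lemma integrable_itvcc_bounded (R : realType) (f : R -> R) (a b M : R) :
  measurable_fun [set: R] f -> (forall x, a <= x <= b -> 0 <= f x <= M) ->
  (@lebesgue_measure R).-integrable `[a, b] (EFin \o f).
Proof.
move=> mf fM; apply: measurable_bounded_integrable => //.
- by rewrite /= lebesgue_measure_itv/=; case: ifP => _; rewrite ?ltry.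
- exact: measurable_funTS.
- exists M; split; first exact: num_real.
  move=> N MN x /=; rewrite in_itv/= => /fM /andP[f0 fx].
  by rewrite ger0_norm// (le_trans fx)// ltW.
Qed.

(** Over n equal pieces the increments add up to at most C T^2 / n. This stands in for the
    fundamental theorem of calculus for e^(k l(t)), where l is the integral of a merely measurable
    indicator and need not be differentiable everywhere. *)
Lemma quadratic_increment_cst (R : realType) (psi : R -> R) (C T : R) :
  0 <= T ->
  (forall a b, 0 <= a -> a <= b -> b <= T ->
    `|psi b - psi a| <= C * (b - a) ^+ 2) ->
  psi T = psi 0.
Proof.
move=> T0 H; apply/eqP; rewrite -subr_eq0 -normr_le0.
have C0 : 0 <= `|C * T ^+ 2| by [].
apply/ler_addgt0Pr => e e0; rewrite add0r.
have [n ne] : exists n, `|C * T ^+ 2| / e < n.+1%:R.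
  by exists (Num.trunc (`|C * T ^+ 2| / e)); rewrite truncnS_gt.
pose t k : R := T * (k%:R / n.+1%:R).
have -> : psi T - psi 0 = \sum_(0 <= k < n.+1) (psi (t k.+1) - psi (t k)).
  by rewrite telescope_sumr// /t mul0r mulr0 divff// mulr1.
apply: (le_trans (ler_norm_sum _ _ _)).
have tH k : (k < n.+1)%N -> `|psi (t k.+1) - psi (t k)| <= C * (T / n.+1%:R) ^+ 2.
  move=> kn; have -> : T / n.+1%:R = t k.+1 - t k.
    by rewrite /t -mulrBr -mulrBl -natrB// subSnn mul1r.
  apply: H; rewrite /t.
  - by rewrite mulr_ge0.
  - by rewrite ler_wpM2l// ler_pM2r// ler_nat.
  - by rewrite -[leRHS]mulr1 ler_wpM2l// ler_pdivrMr// mul1r ler_nat.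
rewrite big_mkord; apply: (@le_trans _ _ (\sum_(k < n.+1) C * (T / n.+1%:R) ^+ 2)).
  by apply: ler_sum => k _; exact: tH.
rewrite sumr_const card_ord -[leLHS]mulr_natr exprMn exprVn.
have -> : C * (T ^+ 2 / n.+1%:R ^+ 2) * n.+1%:R = C * T ^+ 2 / n.+1%:R.
  have : n.+1%:R != 0 :> R by rewrite pnatr_eq0.
  by move: (n.+1%:R) => m m0; field.
rewrite ler_pdivrMr// (le_trans (ler_norm _))// ltW// [ltRHS]mulrC.
by rewrite -ltr_pdivrMr.
Qed.

Section exponential_of_occupation.
Context {R : realType}.
Local Notation mu := (@lebesgue_measure R).
Variable z : R -> bool.
Hypothesis mz : measurable_fun [set: R] (fun s => (z s)%:R : R).

Definition occupation (t : R) : R := \int[mu]_(s in `[0, t]) (z s)%:R.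
Local Notation l := occupation.

Lemma occupation_increment a b : 0 <= a -> a <= b -> 0 <= l b - l a <= b - a.
Proof.
move=> a0 ab.
have iz : mu.-integrable `[0, b] (EFin \o (fun s => (z s)%:R)).
  by apply: (@integrable_itvcc_bounded _ _ _ _ 1) => // x _; rewrite ler0n lern1 leq_b1.
rewrite Rintegral_itvB ?bnd_simp//.
apply/andP; split; first by apply: Rintegral_ge0.
apply: (@le_trans _ _ (\int[mu]_(x in `]a, b]) 1)).
  apply: le_Rintegral => //.
  - by apply: integrableS iz => //; apply: subset_itvr; rewrite bnd_simp.
  - have i1 : mu.-integrable `[a, b] (EFin \o (fun=> 1)).
      by apply: (@integrable_itvcc_bounded _ _ _ _ 1) => // x _; rewrite ler01 lexx.
    by apply: integrableS i1 => //; apply: subset_itvr; rewrite bnd_simp.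
  - by move=> x _; rewrite lern1 leq_b1.
rewrite Rintegral_cst// mul1r /= lebesgue_measure_itv/= lte_fin.
by case: ltP => // ba; rewrite subr_ge0.
Qed.

Lemma occupation0 : l 0 = 0.
Proof. by rewrite /l set_itv1 Rintegral_set1. Qed.

Lemma occupation_ge0 t : 0 <= l t.
Proof. exact: Rintegral_ge0. Qed.

Lemma occupation_le t : 0 <= t -> l t <= t.
Proof.
by move=> t0; have := occupation_increment (lexx 0) t0; rewrite occupation0 !subr0 => /andP[].
Qed.

Lemma occupation_nondecreasing : {homo l : a b / a <= b}.
Proof.
move=> a b ab; have [a0|a0] := leP 0 a.
  by have /andP[] := occupation_increment a0 ab; rewrite subr_ge0.
by rewrite {1}/l set_itv_ge ?Rintegral_set0 ?occupation_ge0// bnd_simp -ltNge.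
Qed.

Lemma measurable_expR_occupation k : measurable_fun [set: R] (fun s => expR (k * l s)).
Proof.
apply: measurableT_comp => //; apply: measurable_funM => //.
exact: nondecreasing_measurable occupation_nondecreasing.
Qed.

(** With D = l b - l a, both E b - E a and k times the integral lie between k D E a and k D E b. The
    gap k D (E b - E a) is at most (k D)^2 E b, and D <= b - a. *)
Lemma expR_occupation_increment (E : R -> R) (k a b : R) :
  (forall s, E s = expR (k * l s)) -> 0 <= k -> 0 <= a -> a <= b ->
  `|E b - E a - k * \int[mu]_(s in `]a, b]) ((z s)%:R * E s)|
    <= k ^+ 2 * E b * (b - a) ^+ 2.
Proof.
move=> EE k0 a0 ab.
have Ege0 s : 0 <= E s by rewrite EE expR_ge0.
have Ehomo x y : x <= y -> E x <= E y.
  by move=> xy; rewrite !EE ler_expR ler_wpM2l// occupation_nondecreasing.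
have mE : measurable_fun [set: R] E.
  by rewrite (_ : E = fun s => expR (k * l s)) ?funeqE//; exact: measurable_expR_occupation.
have mzE : measurable_fun [set: R] (fun u => (z u)%:R * E u) by exact: measurable_funM.
have izE : mu.-integrable `[0, b] (EFin \o (fun u => (z u)%:R * E u)).
  apply: (@integrable_itvcc_bounded _ _ _ _ (E b)) => // x /andP[x0 xb].
  by case: (z x); rewrite ?mul1r ?mul0r ?Ege0 ?lexx ?Ehomo.
have iz : mu.-integrable `[0, b] (EFin \o (fun s => (z s)%:R)).
  by apply: (@integrable_itvcc_bounded _ _ _ _ 1) => // x _; rewrite ler0n lern1 leq_b1.
have subI : `]a, b]%classic `<=` `[0, b]%classic.
  by apply: subset_itvr; rewrite bnd_simp.
have izab : mu.-integrable `]a, b] (EFin \o (fun s => (z s)%:R)).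
  exact: integrableS iz.
have izEab : mu.-integrable `]a, b] (EFin \o (fun s => (z s)%:R * E s)).
  exact: integrableS izE.
have JE c : mu.-integrable `]a, b] (EFin \o (fun s => c * (z s)%:R)).
  by have := integrableZl _ c izab; apply.
have DE : l b - l a = \int[mu]_(s in `]a, b]) (z s)%:R.
  by rewrite Rintegral_itvB ?bnd_simp.
have := occupation_increment a0 ab.
have Eab : E b = E a * expR (k * (l b - l a)).
  by rewrite !EE mulrBr -expRD addrC subrK.
have Eba : E a = E b * expR (- (k * (l b - l a))).
  by rewrite Eab -mulrA -expRD subrr expR0 mulr1.
move: (l b - l a) DE Eab Eba => D DE Eab Eba /andP[D0 Dab].
have J1 : E a * D <= \int[mu]_(s in `]a, b]) ((z s)%:R * E s).
  rewrite DE -RintegralZl//; apply: le_Rintegral => // s /=.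
  rewrite in_itv/= => /andP[/ltW as_ _].
  by case: (z s); rewrite ?mul1r ?mul0r ?mulr1 ?mulr0 ?Ehomo.
have J2 : \int[mu]_(s in `]a, b]) ((z s)%:R * E s) <= E b * D.
  rewrite DE -RintegralZl//; apply: le_Rintegral => // s /=.
  rewrite in_itv/= => /andP[_ sb].
  by case: (z s); rewrite ?mul1r ?mul0r ?mulr1 ?mulr0 ?Ehomo.
move: (\int[mu]_(s in `]a, b]) _) J1 J2 => J J1 J2.
have kD0 : 0 <= k * D by rewrite mulr_ge0.
have E1 : E a * (k * D) <= E b - E a.
  have -> : E b - E a = E a * (expR (k * D) - 1) by rewrite Eab mulrBr mulr1.
  by rewrite ler_wpM2l// lerBrDl expR_ge1Dx.
have E2 : E b - E a <= E b * (k * D).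
  have -> : E b - E a = E b * (1 - expR (- (k * D))) by rewrite Eba mulrBr mulr1.
  by rewrite ler_wpM2l// lerBlDr -lerBlDl expR_ge1Dx.
have kJ1 : k * (E a * D) <= k * J by rewrite ler_wpM2l.
have kJ2 : k * J <= k * (E b * D) by rewrite ler_wpM2l.
have bnd : E b * (k * D) - E a * (k * D) <= k ^+ 2 * E b * (b - a) ^+ 2.
  have -> : E b * (k * D) - E a * (k * D) = (k * D) * (E b - E a) by ring.
  apply: (@le_trans _ _ (k * D * (E b * (k * D)))); first by rewrite ler_wpM2l.
  have D2 : D ^+ 2 <= (b - a) ^+ 2 by rewrite ler_pXn2r// nnegrE// subr_ge0.
  have -> : k * D * (E b * (k * D)) = k ^+ 2 * E b * D ^+ 2 by ring.
  by rewrite ler_wpM2l// mulr_ge0 ?sqr_ge0.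
apply: le_trans bnd; rewrite ler_norml; apply/andP; split; lra.
Qed.

Lemma expR_occupation (k t : R) : 0 <= k -> 0 <= t ->
  expR (k * l t) = 1 + k * \int[mu]_(s in `[0, t]) ((z s)%:R * expR (k * l s)).
Proof.
move=> k0 t0.
have [E EE] : exists E : R -> R, forall s, E s = expR (k * l s).
  by exists (fun s => expR (k * l s)).
rewrite -EE; under eq_Rintegral do rewrite -EE.
have Ehomo x y : x <= y -> E x <= E y.
  by move=> xy; rewrite !EE ler_expR ler_wpM2l// occupation_nondecreasing.
have izE b : mu.-integrable `[0, b] (EFin \o (fun u => (z u)%:R * E u)).
  apply: (@integrable_itvcc_bounded _ _ _ _ (E b)).
    apply: measurable_funM => //.
    rewrite (_ : E = fun s => expR (k * l s)) ?funeqE//.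
    exact: measurable_expR_occupation.
  move=> x /andP[x0 xb].
  by case: (z x); rewrite ?mul1r ?mul0r ?EE ?expR_ge0 ?lexx// -!EE Ehomo.
have [J JE] : exists J, forall b, J b = \int[mu]_(u in `[0, b]) ((z u)%:R * E u).
  by exists (fun b => \int[mu]_(u in `[0, b]) ((z u)%:R * E u)).
pose psi s := E s - k * J s.
have : psi t = psi 0.
  apply: (@quadratic_increment_cst _ _ (k ^+ 2 * E t)) => // a b a0 ab bt.
  have := expR_occupation_increment EE k0 a0 ab.
  rewrite -(Rintegral_itvB (izE b)) ?bnd_simp// -!JE => H.
  have -> : psi b - psi a = E b - E a - k * (J b - J a) by rewrite /psi; ring.
  apply: (le_trans H); rewrite ler_wpM2r ?sqr_ge0// ler_wpM2l ?sqr_ge0//.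
  exact: Ehomo.
have -> : psi 0 = 1.
  by rewrite /psi JE set_itv1 Rintegral_set1 mulr0 subr0 EE occupation0 mulr0 expR0.
by rewrite /psi => /eqP; rewrite subr_eq JE => /eqP.
Qed.

End exponential_of_occupation.

Section right_continuous_process.
Context {R : realType} d (T : measurableType d).
Local Notation mu := (@lebesgue_measure R).
Variable Z : R -> T -> bool.
Hypothesis mZ : forall s, measurable [set w | Z s w].
Hypothesis rcZ : forall w t, \forall s \near t^'+, Z s w = Z t w.

(* [Z] is the pointwise limit of its discretizations, which read [Z] at the
   point of the grid [Z / (n + 1)] that comes just after the current time. *)
Lemma measurable_right_continuous :
  measurable [set sw : R * T | Z sw.1 sw.2].
Proof.
pose rho n (s : R) : R := (Num.floor (s * n.+1%:R) + 1)%:~R / n.+1%:R.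
pose A n := [set sw : R * T | Z (rho n sw.1) sw.2].
have mA n : measurable (A n).
  have -> : A n = \bigcup_(k in [set: int])
     ([set s : R | Num.floor (s * n.+1%:R) = k] `*`
      [set w | Z ((k + 1)%:~R / n.+1%:R) w]).
    apply/seteqP; split => -[s w] /=.
      by rewrite /A/= => sw; exists (Num.floor (s * n.+1%:R)).
    by move=> [k _ [/= <-]].
  apply: countable_bigcupT_measurable => // k; apply: measurableX => //.
  rewrite (_ : [set s | _] = `[k%:~R / n.+1%:R, (k + 1)%:~R / n.+1%:R[%classic).
    exact: measurable_itv.
  apply/seteqP; split => s /=; rewrite in_itv/= ler_pdivrMr// ltr_pdivlMr//.
    by move=> <-; exact: floor_itv.
  by rewrite -floor_eq => /eqP.
have rhoZ s w : \forall n \near \oo, Z (rho n s) w = Z s w.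
  have [e /= e0 he] := rcZ w s.
  near=> n.
  have n0 : 0 < n.+1%:R :> R by [].
  have h1 : s < rho n s by rewrite /rho ltr_pdivlMr// floorD1_gt.
  apply: he => //=.
  rewrite distrC ger0_norm ?subr_ge0 ?ltW// ltrBlDr.
  rewrite /rho ltr_pdivrMr// mulrDl intrD [ltRHS]addrC.
  apply: ler_ltD; first by have /andP[] := floor_itv (s * n.+1%:R).
  by rewrite -ltr_pdivrMr// mul1r; near: n; exact: near_infty_natSinv_lt (PosNum e0).
(* By [rhoZ] membership in [A n] is eventually constant in n, so the set is the lower limit of the
   [A n]. *)
rewrite (_ : [set _ | _] = \bigcup_N \bigcap_(n in [set n | (N <= n)%N]) A n).
  apply: bigcupT_measurable => N; apply: bigcap_measurableType => // n _.
apply/seteqP; split => -[s w] /=.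
  move=> Zsw; have [N _ hN] := rhoZ s w.
  by exists N => // n /= Nn; rewrite /A/= hN.
move=> [N _ h]; have [M _ hM] := rhoZ s w.
by have := h (maxn N M) (leq_maxl _ _); rewrite /A/= hM//= leq_maxr.
Unshelve. all: by end_near. Qed.

(** The condition 0 <= s <= t is moved into the integrand as a measurable set of triples; Tonelli
    then gives measurability jointly in time and path. *)
Lemma measurable_occupation :
  measurable_fun [set: R * T]
    (fun tw => \int[mu]_(s in `[0%R, tw.1]) (Z s tw.2)%:R%:E)%E.
Proof.
pose f (x : (R * T) * R) : \bar R :=
  (\1_[set x : (R * T) * R | 0 <= x.2 <= x.1.1 /\ Z x.2 x.1.2] x)%:E.
have mf : measurable_fun setT f.
  apply/measurable_EFinP/measurable_indic.
  rewrite (_ : [set _ | _] = ([set x | 0 <= x.2] `&` [set x | 0 <= x.1.1 - x.2])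
    `&` [set x | Z x.2 x.1.2]); last first.
    apply/seteqP; split => -[[t w] s] /=; rewrite subr_ge0.
      by move=> [/andP[]].
    by move=> [[-> ->]].
  have h1 : measurable_fun setT (fun x : (R * T) * R => x.2) by exact: measurable_snd.
  have h2 : measurable_fun setT (fun x : (R * T) * R => x.1.1 - x.2).
    by apply: measurable_funB => //; exact: (measurableT_comp measurable_fst measurable_fst).
  apply: measurableI; first apply: measurableI.
  - rewrite -[X in measurable X]setTI (_ : [set _ | _] = snd @^-1` `[0, +oo[%classic).
      exact: h1.
    by apply/seteqP; split => x /=; rewrite in_itv/= andbT.
  - rewrite -[X in measurable X]setTI (_ : [set _ | _] = (fun x : (R * T) * R => x.1.1 - x.2) @^-1` `[0, +oo[%classic).
      exact: h2.
    by apply/seteqP; split => x /=; rewrite in_itv/= andbT.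
  - have h : measurable_fun setT (fun x : (R * T) * R => (x.2, x.1.2)).
      apply/measurable_fun_pairP; split => //.
      exact: (measurableT_comp measurable_snd measurable_fst).
    rewrite -[X in measurable X]setTI.
    exact: (h _ _ measurable_right_continuous).
rewrite [X in measurable_fun _ X](_ : _ = fubini_F mu f).
  by apply: measurable_fun_fubini_tonelli_F => // x; rewrite lee_fin.
apply/funext => -[t w]; rewrite /fubini_F [LHS]integral_mkcond.
apply: eq_integral => s _; rewrite /f/= indicE patchE mem_setE in_itv/=.
case: ifPn => h1.
  by congr ((nat_of_bool _)%:R%:E); apply/idP/idP; rewrite inE/=; tauto.
by rewrite memNset//=; move=> [h2]; rewrite h2 in h1.
Qed.

End right_continuous_process.

(** * The renewal equation of a Markov chain *)

Section restricted_measure.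
Context d (T : measurableType d) (R : realType).
Variables (m : {measure set T -> \bar R}) (D : set T) (mD : measurable D).

Lemma ge0_integral_mrestr (f : T -> \bar R) :
  measurable_fun setT f -> (forall x, 0 <= f x)%E ->
  (\int[mrestr m mD]_x f x = \int[m]_(x in D) f x)%E.
Proof.
move=> mf f0.
transitivity (\int[mrestr m mD]_(x in setT `\` ~` D) f x)%E.
  apply: ge0_negligible_integral => //; first exact: measurableC.
  by rewrite /= /mrestr setICl measure0.
rewrite setTD setCK; apply: eq_measure_integral => A mA AD.
by rewrite /= /mrestr setIidl.
Qed.

End restricted_measure.

Section markov_property.
Context {R : realType} {d : measure_display} {Omega : measurableType d}.
Context {S : countType}.
Variables (Pr : S -> probability Omega R) (X : R -> Omega -> S).
Hypothesis chain : markov_chain Pr X.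

Definition past_generator (s : R) : set (set Omega) :=
  [set B | exists u x, 0 <= u <= s /\ B = [set w | X u w = x]].

Lemma past_measurable (s : R) (A : set Omega) : past X s A -> measurable A.
Proof.
apply: smallest_sub; first exact: sigma_algebra_measurable.
by move=> _ [u [x [/andP[u0 _] ->]]]; exact: (chain_measurable chain).
Qed.

(** On the past of s, the restriction of [Pr i] to X_s = j, X_(s+t) = k is a constant multiple of
    its restriction to X_s = j. This equality of measures holds on the sigma-algebra of the past
    only, so the integrals are first transported there by the pushforward along the identity. *)
Lemma markov_integral (i j k : S) (s t : R)
    (f : g_sigma_algebraType (past_generator s) -> \bar R) :
  0 <= s -> 0 <= t -> measurable_fun setT f -> (forall w, 0 <= f w)%E ->
  (\int[Pr i]_(w in [set w | X s w = j] `&` [set w | X (s + t)%R w = k]) f w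
   = (\int[Pr i]_(w in [set w | X s w = j]) f w) * Pr j [set w | X t w = k])%E.
Proof.
move=> s0 t0 mf f0.
have mj : measurable [set w | X s w = j] by exact: (chain_measurable chain).
have mk : measurable [set w | X (s + t) w = k].
  by apply: (chain_measurable chain); exact: addr_ge0.
have mjk := measurableI _ _ mj mk.
pose T' := g_sigma_algebraType (past_generator s).
have mid : measurable_fun setT (id : Omega -> T').
  by move=> _ A mA; rewrite setTI; exact: (@past_measurable s).
have mf' : measurable_fun setT (f : Omega -> \bar R).
  exact: (measurableT_comp mf mid).
have c0 : 0 <= fine (Pr j [set w | X t w = k]) by apply: fine_ge0.
rewrite -(ge0_integral_mrestr _ mjk mf')// -(ge0_integral_mrestr _ mj mf')//.
have E D (mD : measurable D) : (\int[mrestr (Pr i) mD]_w f w =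
  \int[pushforward (mrestr (Pr i) mD) (id : Omega -> T')]_w f w)%E.
  by rewrite ge0_integral_pushforward.
rewrite !E muleC -(@fineK _ (Pr j _)) ?fin_num_measure//; last first.
  exact: (chain_measurable chain).
rewrite -[X in (X%:E * _)%E]/((NngNum c0)%:num) -ge0_integral_mscale//.
apply: eq_measure_integral => A mA _.
rewrite /= /mscale/= /pushforward /mrestr fineK ?fin_num_measure//; last first.
  exact: (chain_measurable chain).
by rewrite preimage_id setIA (chain_markov chain)// muleC.
Qed.

End markov_property.

Section exchange_integral_itv.
Context {R : realType} d (T : measurableType d) (P : probability T R).
Local Notation mu := (@lebesgue_measure R).
Variables (F : R * T -> R) (t : R).
Hypotheses (mF : measurable_fun setT F) (F0 : forall x, 0 <= F x).

Let g (x : R * T) : \bar R := (\1_(`[0, t]%classic : set R) x.1 * F x)%:E.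

Let mg : measurable_fun setT g.
Proof.
apply/measurable_EFinP/measurable_funM => //.
exact: measurableT_comp.
Qed.

Let g0 x : (0 <= g x)%E. Proof. by rewrite lee_fin mulr_ge0. Qed.

Let gE w : (\int[mu]_(s in `[0%R, t]) (F (s, w))%:E = \int[mu]_s g (s, w))%E.
Proof.
rewrite [LHS]integral_mkcond; apply: eq_integral => s _; rewrite /g/= patchE indicE.
by case: ifPn => _; rewrite ?mul1r ?mul0r.
Qed.

Lemma measurable_integral_itv :
  measurable_fun setT (fun w => \int[mu]_(s in `[0%R, t]) (F (s, w))%:E)%E.
Proof.
rewrite [X in measurable_fun _ X](_ : _ = fubini_G mu g); last exact/funext.
exact: measurable_fun_fubini_tonelli_G.
Qed.

Lemma ge0_integral_exchange_itv :
  (\int[P]_w \int[mu]_(s in `[0%R, t]) (F (s, w))%:E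
   = \int[mu]_(s in `[0%R, t]) \int[P]_w (F (s, w))%:E)%E.
Proof.
under eq_integral do rewrite gE.
transitivity (\int[mu]_s \int[P]_w g (s, w))%E.
  by apply/esym/(@fubini_tonelli _ _ _ _ _ mu P g).
rewrite [RHS]integral_mkcond.
apply: eq_integral => s _; rewrite /g/= patchE indicE.
case: ifPn => _; first by apply: eq_integral => w _; rewrite mul1r.
by under eq_integral do rewrite mul0r; rewrite integral0.
Qed.

End exchange_integral_itv.

Section renewal_equation.
Context {R : realType} {d : measure_display} {Omega : measurableType d}.
Context {S : countType}.
Variables (Pr : S -> probability Omega R) (X : R -> Omega -> S).
Hypothesis chain : markov_chain Pr X.
Variable i : S.
Local Notation mu := (@lebesgue_measure R).

(** Negative times are frozen at 0: there [X] is arbitrary, whereas measurability and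
    right-continuity are wanted on the whole line. *)
Let Y (s : R) (w : Omega) : bool := X (Num.max s 0) w == i.
Let L := local_time X i.
Let p := trans_prob Pr X.

Let YE s w : 0 <= s -> Y s w = (X s w == i).
Proof. by move=> s0; rewrite /Y max_l. Qed.

Let mX s j : 0 <= s -> measurable [set w | X s w = j].
Proof. exact: (chain_measurable chain). Qed.

Let YsetE s : [set w | Y s w] = [set w | X (Num.max s 0) w = i].
Proof. by apply/seteqP; split => w /= /eqP. Qed.

Let mY s : measurable [set w | Y s w].
Proof. by rewrite YsetE; apply: mX; rewrite le_max lexx orbT. Qed.

Let rcY w t : \forall s \near t^'+, Y s w = Y t w.
Proof.
have [t0|t0] := ltP t 0.
  near=> s; rewrite /Y !max_r//; first exact: ltW.
  by near: s; apply: nbhs_right_le.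
have := chain_right_continuous chain w t0.
apply: filterS2 (nbhs_right_gt t) => s ts Xst.
by rewrite !YE ?Xst// (le_trans t0)// ltW.
Unshelve. all: by end_near. Qed.

Let LE t w : L t w = occupation (Y^~ w) t.
Proof.
apply: eq_Rintegral => s; rewrite inE/= in_itv/= => /andP[s0 _].
by rewrite YE.
Qed.

Let mYJ : measurable_fun [set: R * Omega] (fun x => (Y x.1 x.2)%:R : R).
Proof.
rewrite [X in measurable_fun _ X](_ : _ = \1_[set x : R * Omega | Y x.1 x.2]).
  by apply: measurable_indic; exact: (measurable_right_continuous mY rcY).
by apply/funext => x; rewrite indicE; congr (nat_of_bool _)%:R; apply/idP/idP; rewrite inE.
Qed.

Let mYw w : measurable_fun [set: R] (fun s => (Y s w)%:R : R).
Proof. exact: (measurableT_comp mYJ (measurable_pair2 w)). Qed.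

Let mLJ : measurable_fun [set: R * Omega] (fun x => L x.1 x.2).
Proof.
rewrite [X in measurable_fun _ X](_ : _ = fun x => fine
    (\int[mu]_(s in `[0%R, x.1]) (Y s x.2)%:R%:E)%E).
  apply: measurableT_comp => //.
  exact: (measurable_occupation mY rcY).
by apply/funext => x; rewrite LE.
Qed.

Lemma measurable_local_time t : measurable_fun [set: Omega] (L t).
Proof. exact: (measurableT_comp mLJ (measurable_pair1 t)). Qed.

Lemma local_time_ge0 t w : 0 <= L t w.
Proof. by rewrite LE occupation_ge0. Qed.

Lemma local_time_le t w : 0 <= t -> L t w <= t.
Proof. by move=> t0; rewrite LE occupation_le. Qed.

(** The path stopped at s reads [X] at times in [0, s] only, and has the same local time up to s.
    The joint measurability argument therefore runs with the past of s as the sigma-algebra on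
    paths. *)
Lemma past_measurable_local_time s : 0 <= s ->
  measurable_fun [set: g_sigma_algebraType (past_generator X s)] (L s).
Proof.
move=> s0.
pose Z (u : R) (w : g_sigma_algebraType (past_generator X s)) : bool :=
  X (Num.min (Num.max u 0) s) w == i.
have mZ u : measurable [set w | Z u w].
  apply: sub_sigma_algebra; exists (Num.min (Num.max u 0) s), i.
  split; first by rewrite le_min le_max lexx orbT s0 ge_min lexx orbT.
  by apply/seteqP; split => w /= /eqP.
have rcZ w t : \forall u \near t^'+, Z u w = Z t w.
  have [t0|t0] := ltP t 0.
    near=> u; rewrite /Z !(max_r (ltW t0)) max_r//.
    by near: u; apply: nbhs_right_le.
  have [st|st] := leP s t.
    near=> u; have tu : t < u by near: u; exact: nbhs_right_gt.
    by rewrite /Z !min_r ?le_max ?st ?(le_trans st (ltW tu)).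
  have := chain_right_continuous chain w t0.
  apply: filterS3 (nbhs_right_gt t) (nbhs_right_lt st) => u tu us Xu.
  by rewrite /Z !max_l ?(le_trans t0 (ltW tu))// !min_l ?Xu ?ltW.
rewrite [X in measurable_fun _ X](_ : _ = fun w => fine
    (\int[mu]_(u in `[0%R, s]) (Z u w)%:R%:E)%E).
  apply: measurableT_comp => //.
  exact: (measurableT_comp (measurable_occupation mZ rcZ) (measurable_pair1 s)).
apply/funext => w; apply: eq_Rintegral => u; rewrite inE/= in_itv/= => /andP[u0 us].
by rewrite /Z max_l// min_l.
Unshelve. all: by end_near. Qed.

(** This function and [weighted_return] are extended by 0 to negative times, so that the convolution
    in the renewal equation is an integral over the whole line. *)
Definition return_prob (t : R) : R := if 0 <= t then p t i i else 0.

Definition weighted_return (k t : R) : R :=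
  if 0 <= t then \int[Pr i]_w (expR (k * L t w) * (X t w == i)%:R) else 0.

Lemma return_probE t : 0 <= t ->
  (return_prob t)%:E = (\int[Pr i]_w (Y t w)%:R%:E)%E.
Proof.
move=> t0; rewrite /return_prob t0 /p /trans_prob fineK ?fin_num_measure//; last exact: mX.
transitivity (\int[Pr i]_w (\1_[set w | Y t w] w)%:E)%E.
  rewrite integral_indic// setIT; congr (Pr i _).
  by apply/seteqP; split => w /=; rewrite YE// => /eqP.
apply: eq_integral => w _; rewrite indicE; congr (nat_of_bool _)%:R%:E.
by apply/idP/idP; rewrite inE.
Qed.

Lemma return_prob_lt0 t : t < 0 -> return_prob t = 0.
Proof. by rewrite /return_prob ltNge => /negbTE ->. Qed.

Lemma return_prob_ge0 t : 0 <= return_prob t.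
Proof. by rewrite /return_prob; case: ifP => // t0; exact: fine_ge0. Qed.

Lemma return_prob_le1 t : return_prob t <= 1.
Proof.
rewrite /return_prob; case: ifP => // t0.
rewrite -lee_fin fineK ?fin_num_measure//; last exact: mX.
by apply: probability_le1; exact: mX.
Qed.

Lemma measurable_return_prob : measurable_fun [set: R] return_prob.
Proof.
rewrite (_ : return_prob = fun t => if 0 <= t then
    fine (\int[Pr i]_w (Y t w)%:R%:E)%E else 0); last first.
  apply/funext => t; case: ifPn => t0; first by rewrite -return_probE.
  by rewrite return_prob_lt0// ltNge.
apply: measurable_fun_ifT => //; first exact: measurable_fun_ler.
apply: measurableT_comp => //.
apply: (measurable_fun_fubini_tonelli_F (fun x : R * Omega => (Y x.1 x.2)%:R%:E)).
  exact/measurable_EFinP.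
by move=> x; rewrite lee_fin.
Qed.

Lemma return_prob0 : return_prob 0 = 1.
Proof. by rewrite /return_prob lexx /p /trans_prob (chain_start chain). Qed.

Lemma return_prob_cvg1 : return_prob t @[t --> 0^'+] --> (1 : R).
Proof.
apply/cvg_at_rightP => u [u0 ucvg].
have cvgY w : (Y (u n) w)%:R%:E @[n --> \oo] --> ((Y 0 w)%:R%:E : \bar R).
  apply: cvg_near_cst.
  have [e /= e0 he] := rcY w 0.
  move/cvgrPdist_lt : ucvg => /(_ _ e0); apply: filterS => n un.
  by rewrite (he (u n)).
have mYt t : measurable_fun [set: Omega] (fun w => (Y t w)%:R%:E : \bar R).
  exact/measurable_EFinP/(measurableT_comp mYJ (measurable_pair1 t)).
pose I t : \bar R := (\int[Pr i]_w (Y t w)%:R%:E)%E.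
have H : I (u n) @[n --> \oo] --> I 0.
  have h1 n : measurable_fun setT (fun w => (Y (u n) w)%:R%:E : \bar R) by [].
  have h2 : {ae Pr i, forall w, setT w ->
      (Y (u n) w)%:R%:E @[n --> \oo] --> ((Y 0 w)%:R%:E : \bar R)}.
    by apply: aeW => w _.
  have h3 : (Pr i).-integrable setT (cst (1%E : \bar R)).
    exact: finite_measure_integrable_cst.
  have [|//] := dominated_convergence measurableT h1 (mYt 0) h2 h3.
  by apply: aeW => w n _; rewrite /= normr_nat lee_fin lern1 leq_b1.
have -> : (fun n => return_prob (u n)) = fine \o (fun n => I (u n)).
  by apply/funext => n; rewrite /I/= -return_probE// ltW.
by rewrite -return_prob0; apply: fine_cvg; rewrite return_probE.
Qed.

(** The left side is the probability of being in [i] at both times s and s + t. *)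
Lemma return_prob_supermul s t : 0 <= s -> 0 <= t ->
  return_prob s * return_prob t <= return_prob (s + t).
Proof.
move=> s0 t0; rewrite /return_prob s0 t0 addr_ge0//.
rewrite -lee_fin EFinM !fineK ?fin_num_measure//; try exact: mX.
have := chain_markov chain i i i s0 t0 (A := setT).
  rewrite !setTI => <-.
    by apply: le_measure; rewrite ?inE//; [apply: measurableI|]; apply: mX => //; exact: addr_ge0.
  exact: (@measurableT _ (g_sigma_algebraType (past_generator X s))).
by apply: mX; exact: addr_ge0.
Qed.

Section fixed_weight.
Variable k : R.
Hypothesis k0 : 0 <= k.

Let F (x : R * Omega) : R := (Y x.1 x.2)%:R * expR (k * L x.1 x.2).

Let mEx : measurable_fun [set: R * Omega] (fun x => expR (k * L x.1 x.2)).
Proof. by apply: measurableT_comp => //; exact: measurable_funM. Qed.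

Let mF : measurable_fun [set: R * Omega] F.
Proof. exact: measurable_funM. Qed.

Let F0 x : 0 <= F x.
Proof. by rewrite mulr_ge0 ?expR_ge0. Qed.

Let mFw w : measurable_fun [set: R] (fun s => F (s, w)).
Proof. exact: (measurableT_comp mF (measurable_pair2 w)). Qed.

Let mFt t : measurable_fun [set: Omega] (fun w => F (t, w)).
Proof. exact: (measurableT_comp mF (measurable_pair1 t)). Qed.

Let expRL_le t w : 0 <= t -> expR (k * L t w) <= expR (k * t).
Proof. by move=> t0; rewrite ler_expR ler_wpM2l// LE occupation_le. Qed.

Let F_le t w : 0 <= t -> F (t, w) <= expR (k * t).
Proof.
move=> t0; rewrite /F/=; case: (Y t w); rewrite ?mul0r ?expR_ge0// mul1r.
exact: expRL_le.
Qed.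

Let pathwise t w : 0 <= t -> ((expR (k * L t w))%:E =
  1 + k%:E * \int[mu]_(s in `[0%R, t]) (F (s, w))%:E)%E.
Proof.
move=> t0; rewrite LE (expR_occupation (mYw w))// EFinD EFinM; congr (_ + _ * _)%E.
rewrite /Rintegral fineK; last first.
  apply: integrable_fin_num => //.
  apply: (@integrable_itvcc_bounded _ _ _ _ (expR (k * t))) => //.
    apply: measurable_funM => //.
    exact: (measurable_expR_occupation (mYw w)).
  move=> s /andP[s0 st]; rewrite -LE mulr_ge0 ?expR_ge0//=.
  apply: (le_trans (F_le w s0)).
  by rewrite ler_expR ler_wpM2l.
by apply: eq_integral => s _; rewrite -LE.
Qed.

Lemma weighted_returnE t : 0 <= t ->
  (weighted_return k t)%:E = (\int[Pr i]_w (F (t, w))%:E)%E.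
Proof.
move=> t0; rewrite /weighted_return t0.
rewrite (_ : \int[Pr i]_w _ = \int[Pr i]_w F (t, w)); last first.
  by apply: eq_Rintegral => w _; rewrite /F/= YE// mulrC.
rewrite fineK// ge0_fin_numE ?integral_ge0//; last by move=> w _; rewrite lee_fin.
apply: (@le_lt_trans _ _ (\int[Pr i]_w (expR (k * t))%:E)%E).
  apply: ge0_le_integral => //.
  - by move=> w _; rewrite lee_fin.
  - exact/measurable_EFinP.
  - by move=> w _; rewrite lee_fin F_le.
by rewrite integral_cst//= probability_setT mule1 ltry.
Qed.

Lemma weighted_return_ge0 t : 0 <= weighted_return k t.
Proof.
rewrite /weighted_return; case: ifP => // _.
by apply: Rintegral_ge0 => w _; rewrite mulr_ge0 ?expR_ge0.
Qed.

Lemma weighted_return_lt0 t : t < 0 -> weighted_return k t = 0.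
Proof. by rewrite /weighted_return ltNge => /negbTE ->. Qed.

Lemma weighted_return_le t : 0 <= t -> weighted_return k t <= expR (k * t).
Proof.
move=> t0; rewrite -lee_fin weighted_returnE//.
apply: (@le_trans _ _ (\int[Pr i]_w (expR (k * t))%:E)%E).
  apply: ge0_le_integral => //.
  - by move=> w _; rewrite lee_fin.
  - exact/measurable_EFinP.
  - by move=> w _; rewrite lee_fin F_le.
by rewrite integral_cst//= probability_setT mule1.
Qed.

Lemma measurable_weighted_return : measurable_fun [set: R] (weighted_return k).
Proof.
rewrite (_ : weighted_return k = fun t => if 0 <= t then
    fine (\int[Pr i]_w (F (t, w))%:E)%E else 0); last first.
  apply/funext => t; case: ifPn => t0; first by rewrite -weighted_returnE.
  by rewrite weighted_return_lt0// ltNge.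
apply: measurable_fun_ifT => //; first exact: measurable_fun_ler.
apply: measurableT_comp => //.
apply: (measurable_fun_fubini_tonelli_F (fun x : R * Omega => (F x)%:E)).
  exact/measurable_EFinP.
by move=> x; rewrite lee_fin.
Qed.

Lemma exp_momentE t : 0 <= t -> ((\int[Pr i]_w (expR (k * L t w))%:E) =
  1 + k%:E * \int[mu]_(s in `[0%R, t]) (weighted_return k s)%:E)%E.
Proof.
move=> t0; under eq_integral do rewrite pathwise//.
have mI : measurable_fun [set: Omega] (fun w => \int[mu]_(s in `[0%R, t]) (F (s, w))%:E)%E.
  exact: measurable_integral_itv.
rewrite ge0_integralD//; last 2 first.
- by move=> w _; rewrite mule_ge0 ?lee_fin ?integral_ge0// => s _; rewrite lee_fin.
- exact: measurable_funeM.
rewrite integral_cst//= probability_setT mule1 ge0_integralZl//; last first.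
  by move=> w _; rewrite integral_ge0// => s _; rewrite lee_fin.
rewrite ge0_integral_exchange_itv//; congr (_ + _ * _)%E.
by apply: eq_integral => s; rewrite inE/= in_itv/= => /andP[s0 _]; rewrite weighted_returnE.
Qed.

(** The weight e^(k L_s) is measurable with respect to the past of s, so the Markov property splits
    E[e^(k L_s); X_s = i, X_t = i] into w(s) p(t - s). Times s outside [0, t] contribute 0 by the
    extension of both factors. *)
Lemma weighted_return_renewal t : 0 <= t -> ((weighted_return k t)%:E =
  (return_prob t)%:E + k%:E *
    \int[mu]_s (weighted_return k s * return_prob (t - s))%:E)%E.
Proof.
move=> t0; rewrite weighted_returnE// return_probE//.
transitivity (\int[Pr i]_w ((Y t w)%:R%:E +
    k%:E * \int[mu]_(s in `[0%R, t]) ((Y t w)%:R * F (s, w))%:E))%E.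
  apply: eq_integral => w _; rewrite {1}/F/= EFinM pathwise//.
  rewrite ge0_muleDr//; last first.
    by rewrite mule_ge0 ?lee_fin ?integral_ge0// => s _; rewrite lee_fin.
  congr (_ + _)%E; first exact: mule1.
  rewrite muleCA; congr (_ * _)%E; rewrite -ge0_integralZl//.
  - by apply: measurable_funTS; apply/measurable_EFinP; exact: (mFw w).
  - by move=> s _; rewrite lee_fin.
pose H (x : R * Omega) := (Y t x.2)%:R * F x.
have mYt s : measurable_fun [set: Omega] (fun w => (Y s w)%:R : R).
  exact: (measurableT_comp mYJ (measurable_pair1 s)).
have mH : measurable_fun setT H.
  by apply: measurable_funM => //; exact: (measurableT_comp (mYt t) measurable_snd).
have H0 x : 0 <= H x by rewrite mulr_ge0.
have mI : measurable_fun [set: Omega] (fun w => \int[mu]_(s in `[0%R, t]) (H (s, w))%:E)%E.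
  exact: measurable_integral_itv.
rewrite ge0_integralD//; last 3 first.
- exact/measurable_EFinP.
- by move=> w _; rewrite mule_ge0 ?lee_fin ?integral_ge0// => s _; rewrite lee_fin (H0 (s, w)).
- exact: measurable_funeM.
congr (_ + _)%E; rewrite ge0_integralZl//; last first.
  by move=> w _; rewrite integral_ge0// => s _; rewrite lee_fin (H0 (s, w)).
congr (_ * _)%E; rewrite (@ge0_integral_exchange_itv _ _ _ (Pr i) H t mH H0).
rewrite integral_mkcond; apply: eq_integral => s _.
rewrite patchE mem_setE in_itv/=; case: ifPn => [/andP[s0 st]|]; last first.
  rewrite negb_and -!ltNge => /orP[s0|st].
    by rewrite weighted_return_lt0// mul0r.
  by rewrite return_prob_lt0 ?mulr0// subr_lt0.
have ts0 : 0 <= t - s by rewrite subr_ge0.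
have mE : measurable_fun [set: g_sigma_algebraType (past_generator X s)]
    (fun w => (expR (k * L s w))%:E).
  apply/measurable_EFinP; apply: measurableT_comp => //.
  by apply: measurable_funM => //; exact: past_measurable_local_time.
have := @markov_integral _ _ _ _ _ _ chain i i i s (t - s) _ s0 ts0 mE.
rewrite subrKC => markov.
transitivity (\int[Pr i]_(w in [set w | X s w = i] `&` [set w | X t w = i])
   (expR (k * L s w))%:E)%E.
  rewrite [RHS]integral_mkcond; apply: eq_integral => w _.
  rewrite /H /F/= !YE// patchE in_setI; case: ifPn.
    by move=> /andP[]; rewrite !inE/= => -> ->; rewrite eqxx !mul1r.
  move=> /nandP[]; rewrite notin_setE/= => /eqP/negbTE ->.
    by rewrite mul0r mulr0.
  by rewrite mul0r.
rewrite markov; last by move=> w; rewrite lee_fin expR_ge0.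
rewrite EFinM weighted_returnE//; congr (_ * _)%E.
  rewrite [LHS]integral_mkcond; apply: eq_integral => w _.
  rewrite /F/= YE// patchE; case: ifPn; rewrite ?inE ?notin_setE/=.
    by move=> ->; rewrite eqxx mul1r.
  by move=> /eqP/negbTE ->; rewrite mul0r.
by rewrite /return_prob ts0 /p /trans_prob fineK ?fin_num_measure//; exact: mX.
Qed.

End fixed_weight.
End renewal_equation.

(** * Growth of solutions of the renewal equation *)

(** Monotone convergence along the intervals [1/(n+1), n+1]. The end [a] is kept positive because it
    becomes the length of a time step in [weighted_lower_bound]. *)
Lemma ge0_lt_integral_compact (R : realType) (f : R -> \bar R) (c : \bar R) :
  measurable_fun [set: R] f -> (forall x, 0 <= f x)%E ->
  (c < \int[@lebesgue_measure R]_(x in `[0%R, +oo[) f x)%E ->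
  exists a b : R, [/\ 0 < a, a <= b &
    (c < \int[@lebesgue_measure R]_(x in `[a, b]) f x)%E].
Proof.
move=> mf f0 cf.
have [//|H] := pselect (exists a b : R, [/\ 0 < a, a <= b &
    (c < \int[@lebesgue_measure R]_(x in `[a, b]) f x)%E]).
pose F n : set (measurableTypeR R) := `[n.+1%:R^-1, n.+1%:R]%classic.
have := @ge0_nondecreasing_set_cvg_integral _ _ R F f (@lebesgue_measure R).
have -> : \bigcup_n F n = `]0, +oo[%classic.
  apply/seteqP; split=> x /=.
    by move=> [n _]; rewrite /F/= !in_itv/= andbT => /andP[+ _]; apply: lt_le_trans.
  rewrite in_itv/= andbT => x0.
  exists (maxn (Num.trunc x^-1) (Num.trunc x)) => //; rewrite /F/= in_itv/=.
  apply/andP; split.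
    rewrite -[leRHS]invrK lef_pV2 ?posrE ?invr_gt0//.
    apply: (le_trans (ltW (truncnS_gt _))).
    by rewrite ler_nat ltnS leq_maxl.
  apply: (le_trans (ltW (truncnS_gt _))).
  by rewrite ler_nat ltnS leq_maxr.
rewrite integral_itv_obnd_cbnd; last exact: measurable_funTS.
have ndF : nondecreasing_seq F.
  move=> m n mn; apply/subsetPset; apply: subset_itv; rewrite bnd_simp.
    by rewrite lef_pV2 ?posrE// ler_nat ltnS.
  by rewrite ler_nat ltnS.
have mF n : measurable (F n) by exact: measurable_itv.
have mfF n : measurable_fun (F n) f by exact: measurable_funTS.
move=> /(_ ndF mF mfF (fun _ x _ => f0 x)) cvgF; exfalso.
move: cf; apply/negP; rewrite -leNgt.
apply: (cvge_le _ cvgF).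
near=> n; rewrite leNgt; apply/negP => cn; apply: H.
exists n.+1%:R^-1, n.+1%:R; split => //.
by rewrite (@le_trans _ _ 1)// ?invf_le1// ler1n.
Unshelve. all: by end_near. Qed.

(** The values are extended reals: at 0 the transform of the return probability is the Green
    function, possibly infinite, and the value +oo at negative arguments is used for strict
    convexity. *)
Definition laplace (R : realType) (f : R -> R) (s : R) : \bar R :=
  (\int[@lebesgue_measure R]_(t in `[0%R, +oo[) (expR (- s * t) * f t)%:E)%E.

Lemma ge0_integral_reflect (R : realType) (f : R -> \bar R) (t : R) :
  measurable_fun [set: R] f -> (forall x, 0 <= f x)%E ->
  (\int[@lebesgue_measure R]_s f (t - s)%R = \int[@lebesgue_measure R]_s f s)%E.
Proof.
move=> mf f0; rewrite -(@ge0_integral_shift _ f (- t))//.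
rewrite -(@ge0_integral_opp _ (fun s => f (s - - t))) => [|| //].
  by apply: eq_integral => s _; rewrite opprK addrC.
by apply: measurableT_comp => //; exact: measurable_funB.
Qed.

Section convolution.
Context {R : realType}.
Local Notation mu := (@lebesgue_measure R).
Variables (h q : R -> R).
Hypotheses (mh : measurable_fun [set: R] h) (mq : measurable_fun [set: R] q).
Hypotheses (h0 : forall x, 0 <= h x) (q0 : forall x, 0 <= q x).

Let mhq : measurable_fun [set: R * R] (fun x => (h x.2 * q (x.1 - x.2))%:E).
Proof.
apply/measurable_EFinP; apply: measurable_funM.
  exact: (measurableT_comp mh measurable_snd).
by apply: measurableT_comp => //; exact: measurable_funB.
Qed.

Lemma measurable_convolution :
  measurable_fun [set: R] (fun t => \int[mu]_s (h s * q (t - s))%:E)%E.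
Proof.
apply: (@measurable_fun_fubini_tonelli_F _ _ _ _ R mu
  (fun x : R * R => (h x.2 * q (x.1 - x.2))%:E) mhq).
by move=> x; rewrite lee_fin mulr_ge0.
Qed.

Lemma integral_convolution :
  (\int[mu]_t \int[mu]_s (h s * q (t - s))%:E =
   (\int[mu]_s (h s)%:E) * \int[mu]_t (q t)%:E)%E.
Proof.
rewrite (@fubini_tonelli _ _ _ _ _ mu mu (fun x : R * R => (h x.2 * q (x.1 - x.2))%:E))//; last first.
  by move=> x; rewrite lee_fin mulr_ge0.
have mqE : measurable_fun [set: R] (fun x => (q x)%:E) by exact/measurable_EFinP.
have q0E x : (0 <= (q x)%:E)%E by rewrite lee_fin.
transitivity (\int[mu]_s ((h s)%:E * \int[mu]_t (q t)%:E))%E.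
  apply: eq_integral => s _ /=; under eq_integral do rewrite EFinM.
  rewrite ge0_integralZl//; last 2 first.
  - apply/measurable_EFinP; apply: measurableT_comp => //.
    exact: measurable_funB.
  - by rewrite lee_fin.
  by rewrite (@ge0_integral_shift _ (fun x => (q x)%:E)).
rewrite ge0_integralZr//.
- exact/measurable_EFinP.
- by move=> s _; rewrite lee_fin.
- exact: integral_ge0.
Qed.

End convolution.

Section renewal_bounds.
Context {R : realType}.
Local Notation mu := (@lebesgue_measure R).
Variables (p w : R -> R) (k : R).
Hypotheses (mp : measurable_fun [set: R] p) (p0 : forall t, 0 <= p t).
Hypotheses (plt0 : forall t, t < 0 -> p t = 0).
Hypotheses (pcvg1 : p t @[t --> 0^'+] --> (1 : R)) (p01 : p 0 = 1).
Hypothesis psup : forall s t, 0 <= s -> 0 <= t -> p s * p t <= p (s + t).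
Hypotheses (mw : measurable_fun [set: R] w) (w0 : forall t, 0 <= w t).
Hypotheses (wlt0 : forall t, t < 0 -> w t = 0).
Hypothesis (wle : forall t, 0 <= t -> w t <= expR (k * t)).
Hypothesis k0 : 0 < k.
Hypothesis renewal : forall t, 0 <= t ->
  ((w t)%:E = (p t)%:E + k%:E * \int[mu]_s (w s * p (t - s))%:E)%E.

Lemma laplaceTE (s : R) : laplace p s = (\int[mu]_t (expR (- s * t) * p t)%:E)%E.
Proof.
rewrite /laplace integral_mkcond; apply: eq_integral => t _.
rewrite patchE mem_setE in_itv/= andbT; case: ifPn => //.
by rewrite -ltNge => /plt0 ->; rewrite mulr0.
Qed.

Let mexp (s : R) : measurable_fun [set: R] (fun t => expR (- s * t)).
Proof. by apply: measurableT_comp => //; exact: measurable_funM. Qed.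

(** For t <= T the convolution reads [w] on [0, T] only, since [p] vanishes at negative times. So
    the truncated, tilted [w] satisfies the renewal equation as an inequality, and the mass of a
    convolution is the product of the masses. *)
Lemma tilted_renewal_le (s T : R) : 0 <= T ->
  ((\int[mu]_(t in `[0%R, T]) (expR (- s * t) * w t)%:E) <=
   laplace p s + k%:E * ((\int[mu]_(t in `[0%R, T]) (expR (- s * t) * w t)%:E) * laplace p s))%E.
Proof.
move=> T0.
pose h u := \1_(`[0, T]%classic : set R) u * (expR (- s * u) * w u).
pose q u := expR (- s * u) * p u.
have mh : measurable_fun [set: R] h.
  by apply: measurable_funM => //; exact: measurable_funM.
have mq : measurable_fun [set: R] q by exact: measurable_funM.
have h0 u : 0 <= h u by rewrite !mulr_ge0 ?expR_ge0.
have q0 u : 0 <= q u by rewrite mulr_ge0 ?expR_ge0.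
have hE : (\int[mu]_(t in `[0%R, T]) (expR (- s * t) * w t)%:E = \int[mu]_t (h t)%:E)%E.
  rewrite integral_mkcond; apply: eq_integral => t _; rewrite patchE /h indicE.
  by case: ifPn => _; rewrite ?mul1r ?mul0r.
have -> : (laplace p s = \int[mu]_t (q t)%:E)%E by exact: laplaceTE.
have mqE : measurable_fun [set: R] (fun x => (q x)%:E) by exact/measurable_EFinP.
have mC := measurable_convolution mh mq h0 q0.
have C0 t : (0 <= \int[mu]_s (h s * q (t - s))%:E)%E.
  by apply: integral_ge0 => u _; rewrite lee_fin mulr_ge0.
rewrite hE -integral_convolution// -ge0_integralZl//; last by rewrite lee_fin ltW.
rewrite -ge0_integralD//; last 3 first.
- by move=> t _; rewrite lee_fin.
- by move=> t _; rewrite mule_ge0// lee_fin ltW.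
- exact: measurable_funeM.
apply: ge0_le_integral => //.
- by move=> t _; rewrite lee_fin.
- exact/measurable_EFinP.
- by apply: emeasurable_funD => //; exact: measurable_funeM.
move=> t _; rewrite /h indicE; case: (boolP (t \in _)); last first.
  by move=> _; rewrite mul0r adde_ge0 ?lee_fin// mule_ge0// lee_fin ltW.
rewrite inE/= in_itv/= => /andP[t0 tT]; rewrite mul1r.
rewrite EFinM renewal// ge0_muleDr ?lee_fin//; last first.
  apply: mule_ge0; first by rewrite lee_fin ltW.
  by apply: integral_ge0 => u _; rewrite lee_fin mulr_ge0.
rewrite -EFinM; apply: leeD => //.
rewrite muleCA; apply: lee_wpmul2l; first by rewrite lee_fin ltW.
rewrite -ge0_integralZl//; last 2 first.
- apply/measurable_EFinP; apply: measurable_funM => //.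
  by apply: measurableT_comp => //; exact: measurable_funB.
- by move=> u _; rewrite lee_fin mulr_ge0.
apply: ge0_le_integral => //.
- by move=> u _; rewrite -EFinM lee_fin !mulr_ge0 ?expR_ge0.
- apply: measurable_funeM; apply/measurable_EFinP; apply: measurable_funM => //.
  by apply: measurableT_comp => //; exact: measurable_funB.
- apply/measurable_EFinP; apply: measurable_funM => //.
  by apply: measurableT_comp => //; exact: measurable_funB.
move=> u _; rewrite -EFinM lee_fin /h /q indicE.
have [u0|u0] := ltP u 0; first by rewrite wlt0// mul0r mulr0 !mulr0 mul0r.
have [tu|ut] := ltP t u; first by rewrite plt0 ?subr_lt0// !mulr0.
rewrite mem_set/= ?in_itv/= ?u0 ?(le_trans ut)// mul1r.
rewrite le_eqVlt; apply/orP; left; apply/eqP.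
have -> : expR (- s * t) = expR (- s * u) * expR (- s * (t - u)).
  by rewrite -expRD; congr expR; ring.
ring.
Qed.

(** The crude bound [wle] makes the truncated integral W finite, so W <= Q + k Q W can be solved to
    W <= Q / (1 - k Q), uniformly in T. Removing the tilt on [0, T] costs a factor e^(s T). *)
Lemma moment_upper_bound (s : R) : 0 <= s -> (k%:E * laplace p s < 1)%E ->
  exists2 C, 0 < C & forall T, 0 <= T ->
   (1 + k%:E * \int[mu]_(t in `[0%R, T]) (w t)%:E <= (C * expR (s * T))%:E)%E.
Proof.
move=> s0 kQ.
have Q0 : (0 <= laplace p s)%E.
  by apply: integral_ge0 => t _; rewrite lee_fin mulr_ge0 ?expR_ge0.
have [Q QE] : exists Q, laplace p s = Q%:E.
  case: (laplace p s) kQ Q0 => [Q| |] //; first by exists Q.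
  by rewrite gt0_muley ?lte_fin.
rewrite QE -EFinM lte_fin in kQ; rewrite QE lee_fin in Q0.
have mew : measurable_fun [set: R] (fun t => expR (- s * t) * w t).
  exact: measurable_funM.
exists (1 + k * (Q / (1 - k * Q))) => [|T T0].
  rewrite ltr_pwDl// mulr_ge0//; first exact: ltW.
  by rewrite divr_ge0// subr_ge0 ltW.
have := tilted_renewal_le s T0.
have W0 : (0 <= \int[mu]_(t in `[0%R, T]) (expR (- s * t) * w t)%:E)%E.
  by apply: integral_ge0 => t _; rewrite lee_fin mulr_ge0 ?expR_ge0.
have : (\int[mu]_(t in `[0%R, T]) (expR (- s * t) * w t)%:E)%E \is a fin_num.
  apply: integrable_fin_num => //.
  apply: (@integrable_itvcc_bounded _ _ _ _ (expR (k * T))).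
    exact: measurable_funM.
  move=> t /andP[t0 tT]; rewrite mulr_ge0 ?expR_ge0//= -[leRHS]mul1r.
  apply: ler_pM; rewrite ?expR_ge0//.
    by rewrite -expR0 ler_expR mulNr oppr_le0 mulr_ge0.
  by apply: (le_trans (wle t0)); rewrite ler_expR ler_wpM2l// ltW.
set W := (\int[mu]_(t in _) _)%E => Wfin; rewrite QE -(fineK Wfin) => WQ.
have {}WQ : fine W <= Q / (1 - k * Q).
  rewrite ler_pdivlMr ?subr_gt0//; move: WQ.
  by rewrite -!EFinM -EFinD lee_fin; lra.
apply: (@le_trans _ _ (1 + k%:E * ((expR (s * T))%:E * W))%E).
  apply: leeD => //; apply: lee_wpmul2l; first by rewrite lee_fin ltW.
  rewrite -ge0_integralZl//; last 2 first.
  - by apply: measurable_funTS; apply/measurable_EFinP; exact: mew.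
  - by move=> t _; rewrite lee_fin mulr_ge0 ?expR_ge0.
  apply: ge0_le_integral => //.
  - by move=> t _; rewrite lee_fin.
  - by apply: measurable_funTS; apply/measurable_EFinP; exact: mw.
  - apply: measurable_funTS; apply: measurable_funeM; apply/measurable_EFinP.
    exact: mew.
  move=> t /=; rewrite in_itv/= => /andP[t0 tT].
  rewrite -EFinM lee_fin mulrA -expRD -[leLHS]mul1r ler_wpM2r//.
  by rewrite -expR0 ler_expR mulNr subr_ge0 ler_wpM2l.
rewrite -(fineK Wfin) -!EFinM -EFinD lee_fin mulrDl mul1r lerD//.
  by rewrite -expR0 ler_expR mulr_ge0.
have -> : k * (expR (s * T) * fine W) = k * fine W * expR (s * T) by ring.
by rewrite ler_wpM2r ?expR_ge0// ler_wpM2l// ltW.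
Qed.

(** Near 0 the function is at least 1/2. Any t <= T is cut into a fixed number n + 1 of equal pieces
    shorter than [e], and supermultiplicativity gives 2^-(n+1). *)
Lemma return_lower_bound (T : R) :
  exists2 c1, 0 < c1 & forall t, 0 <= t -> t <= T -> c1 <= p t.
Proof.
have [e /= e0 he] : \forall t \near 0^'+, 2^-1 < p t.
  move/cvgrPdist_lt : pcvg1 => /(_ 2^-1); rewrite invr_gt0 ltr0n => /(_ isT).
  apply: filterS => t; rewrite ltr_distl => /andP[_ +]; lra.
have pe t : 0 <= t -> t < e -> 2^-1 <= p t.
  rewrite le_eqVlt => /predU1P[<- _|t0 te]; first by rewrite p01 invf_le1// ler1n.
  by apply/ltW/he => //=; rewrite sub0r normrN gtr0_norm.
pose n := Num.trunc (T / e).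
have pow m t : 0 <= t -> t < e -> 2^-1 ^+ m <= p (m%:R * t).
  move=> t0 te; elim: m => [|m IH]; first by rewrite mul0r p01.
  rewrite exprS -[m.+1%:R]natr1 mulrDl mul1r addrC.
  apply: (le_trans _ (psup _ _)) => //; last by rewrite mulr_ge0.
  by apply: ler_pM => //; rewrite ?exprn_ge0// ?invr_ge0// pe.
exists (2^-1 ^+ n.+1) => [|t t0 tT]; first by rewrite exprn_gt0 ?invr_gt0.
have -> : t = n.+1%:R * (t / n.+1%:R) by rewrite mulrCA divff// mulr1.
apply: pow; first by rewrite divr_ge0.
rewrite ltr_pdivrMr// -ltr_pdivrMl// mulrC.
apply: le_lt_trans (truncnS_gt _).
by rewrite ler_pM2r// invr_gt0.
Qed.

(** Induction over [0, b + n a]. On [0, b] the bound follows from w >= p >= c1, which fixes c0 = c1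
    e^(-s b). For t > b the renewal equation, restricted to lags t - u in [a, b], reads [w] at times
    at least [a] earlier, and the factor k \int_a^b e^(-s v) p(v) dv > 1 restores the constant
    c0. *)
Lemma weighted_lower_bound (s : R) : 0 <= s -> (1 < k%:E * laplace p s)%E ->
  exists2 c0, 0 < c0 & forall t, 0 <= t -> c0 * expR (s * t) <= w t.
Proof.
move=> s0 kQ.
pose q u := expR (- s * u) * p u.
have mq : measurable_fun [set: R] q by exact: measurable_funM.
have q0 u : 0 <= q u by rewrite mulr_ge0 ?expR_ge0.
have [a [b [a0 ab kab]]] : exists a b : R, [/\ 0 < a, a <= b &
    ((k^-1)%:E < \int[mu]_(x in `[a, b]) (q x)%:E)%E].
  apply: ge0_lt_integral_compact => //; first exact/measurable_EFinP.
  rewrite -[ltRHS]mul1e -[X in (X%:E * _)%E](@mulVf _ k) ?gt_eqF// EFinM -muleA.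
  by rewrite -[ltLHS]mule1 lte_pmul2l ?lte_fin ?invr_gt0.
have b0 : 0 <= b by rewrite (le_trans _ ab)// ltW.
have [c1 c10 pc1] := return_lower_bound b.
have w_ge_p t : 0 <= t -> p t <= w t.
  move=> t0; rewrite -lee_fin renewal// leeDl//; apply: mule_ge0.
    by rewrite lee_fin ltW.
  by apply: integral_ge0 => u _; rewrite lee_fin mulr_ge0.
exists (c1 * expR (- s * b)) => [|t t0]; first by rewrite mulr_gt0 ?expR_gt0.
set c0 := c1 * _; have c00 : 0 <= c0 by rewrite mulr_ge0 ?expR_ge0// ltW.
suff main n : forall t, 0 <= t -> t <= b + n%:R * a -> c0 * expR (s * t) <= w t.
  apply: (main (Num.trunc (t / a)).+1) => //.
  rewrite -[leLHS]add0r lerD// -ler_pdivrMr//.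
  exact/ltW/truncnS_gt.
elim: n => {t t0} [|n IH] t t0.
  rewrite mul0r addr0 => tb; apply: le_trans (w_ge_p _ t0).
  apply: le_trans (pc1 _ t0 tb); rewrite /c0 -mulrA -expRD.
  rewrite -[leRHS]mulr1 ler_wpM2l ?(ltW c10)//.
  by rewrite -expR0 ler_expR mulNr addrC subr_le0 ler_wpM2l.
move=> tn; have [tb|bt] := leP t b.
  by apply: IH => //; rewrite (le_trans tb)// lerDl mulr_ge0// ltW.
rewrite -lee_fin renewal//.
have mwp : measurable_fun [set: R] (fun u => (w u * p (t - u))%:E).
  apply/measurable_EFinP; apply: measurable_funM => //.
  by apply: (measurableT_comp mp); exact: measurable_funB.
pose g u := \1_(`[a, b]%classic : set R) u * q u.
have mg : measurable_fun [set: R] g by exact: measurable_funM.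
have g0 u : 0 <= g u by rewrite mulr_ge0.
have mgt : measurable_fun [set: R] (fun u => (g (t - u))%:E).
  apply/measurable_EFinP; apply: (measurableT_comp mg).
  exact: measurable_funB.
apply: (@le_trans _ _ (k%:E * \int[mu]_u ((c0 * expR (s * t))%:E * (g (t - u))%:E))%E); last first.
  apply: (@le_trans _ _ (k%:E * \int[mu]_u (w u * p (t - u))%:E)%E); last first.
    by rewrite leeDr// lee_fin.
  apply: lee_wpmul2l; first by rewrite lee_fin ltW.
  apply: ge0_le_integral => //.
  - move=> u _; rewrite -EFinM lee_fin; apply: mulr_ge0 => //.
    exact: (mulr_ge0 c00 (expR_ge0 _)).
  - exact: measurable_funeM.
  move=> u _; rewrite -EFinM lee_fin /g indicE.
  case: (boolP (t - u \in _)); last by rewrite mul0r mulr0 mulr_ge0.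
  rewrite inE/= in_itv/= => /andP[h1 h2]; rewrite mul1r /q.
  have -> : c0 * expR (s * t) * (expR (- s * (t - u)) * p (t - u)) =
      (c0 * expR (s * u)) * p (t - u).
    have -> : expR (s * u) = expR (s * t) * expR (- s * (t - u)).
      by rewrite -expRD; congr expR; ring.
    by ring.
  rewrite ler_wpM2r//; apply: IH; first by lra.
  by move: tn; rewrite -natr1 mulrDl mul1r; lra.
rewrite ge0_integralZl//; last 2 first.
- by move=> u _; rewrite lee_fin.
- by rewrite lee_fin mulr_ge0 ?expR_ge0.
rewrite (@ge0_integral_reflect _ (fun u => (g u)%:E))//; last exact/measurable_EFinP.
have -> : (\int[mu]_u (g u)%:E = \int[mu]_(u in `[a, b]) (q u)%:E)%E.
  rewrite [RHS]integral_mkcond; apply: eq_integral => u _; rewrite patchE /g indicE.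
  by case: ifPn => _; rewrite ?mul1r ?mul0r.
rewrite muleCA -[leLHS]mule1; apply: lee_wpmul2l.
  by rewrite lee_fin mulr_ge0 ?expR_ge0.
have -> : 1%E = (k%:E * (k^-1)%:E)%E by rewrite -EFinM divff ?gt_eqF.
by apply: lee_wpmul2l; [rewrite lee_fin ltW|exact: ltW].
Qed.

(** Only the integral over the last unit of time is kept, whence T >= 1 and the factor e^(-s). *)
Lemma moment_lower_bound (s : R) : 0 <= s -> (1 < k%:E * laplace p s)%E ->
  exists2 C, 0 < C & forall T, 1 <= T ->
   ((C * expR (s * T))%:E <= 1 + k%:E * \int[mu]_(t in `[0%R, T]) (w t)%:E)%E.
Proof.
move=> s0 /(weighted_lower_bound s0)[c0 c00 wc0].
exists (k * c0 * expR (- s)) => [|T T1]; first by rewrite !mulr_gt0 ?expR_gt0.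
have mwE : measurable_fun [set: R] (fun t => (w t)%:E) by exact/measurable_EFinP.
apply: (@le_trans _ _ (k%:E * \int[mu]_(t in `[0%R, T]) (w t)%:E)%E); last first.
  by rewrite leeDr.
have -> : k * c0 * expR (- s) * expR (s * T) = k * (c0 * expR (s * (T - 1))).
  have -> : expR (s * (T - 1)) = expR (- s) * expR (s * T).
    by rewrite -expRD; congr expR; ring.
  by ring.
rewrite EFinM; apply: lee_wpmul2l; first by rewrite lee_fin ltW.
apply: (@le_trans _ _ (\int[mu]_(t in `[(T - 1)%R, T]) (w t)%:E)%E); last first.
  apply: ge0_subset_integral => //.
  - exact: measurable_funTS.
  - by move=> t _; rewrite lee_fin.
  - by apply: subset_itvr; rewrite bnd_simp subr_ge0.
apply: (@le_trans _ _ (\int[mu]_(t in `[(T - 1)%R, T]) (c0 * expR (s * (T - 1)%R))%:E)%E).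
  rewrite integral_cst//= lebesgue_measure_itv/= lte_fin ifT; last by lra.
  rewrite -EFinB.
  have -> : T - (T - 1) = 1 by ring.
  by rewrite mule1.
apply: ge0_le_integral => //.
- by move=> t _; rewrite lee_fin mulr_ge0 ?expR_ge0// ltW.
- exact: measurable_funTS.
move=> t /=; rewrite in_itv/= => /andP[Tt tT]; rewrite lee_fin.
apply: le_trans (wc0 t _); last by lra.
by rewrite ler_wpM2l ?(ltW c00)// ler_expR ler_wpM2l.
Qed.

End renewal_bounds.

(** * Laplace transforms *)

Section laplace_transform.
Context {R : realType}.
Local Notation mu := (@lebesgue_measure R).
Implicit Types (f : R -> R) (s t : R).

Lemma measurable_expRM s : measurable_fun [set: R] (fun t => expR (s * t)).
Proof. by apply: measurableT_comp => //; exact: measurable_funM. Qed.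

Lemma measurable_laplace f s : measurable_fun [set: R] f ->
  measurable_fun [set: R] (fun t => (expR (- s * t) * f t)%:E).
Proof.
by move=> mf; apply/measurable_EFinP/measurable_funM => //; exact: measurable_expRM.
Qed.

(** Read off from the total mass 1 of the exponential density. *)
Lemma laplace_cst s C : 0 < s -> 0 <= C -> laplace (fun=> C) s = (C / s)%:E.
Proof.
move=> s0 C0.
have : (\int[mu]_t (exponential_pdf s t)%:E = 1)%E by exact: integral_exponential_pdf.
have -> : (\int[mu]_t (exponential_pdf s t)%:E =
    s%:E * \int[mu]_(t in `[0%R, +oo[) (expR (- s * t))%:E)%E.
  rewrite -ge0_integralZl//; last 2 first.
  - by apply: measurable_funTS; apply/measurable_EFinP; exact: measurable_expRM.
  - by rewrite lee_fin ltW.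
  rewrite [RHS]integral_mkcond; apply: eq_integral => t _.
  by rewrite /exponential_pdf !patchE; case: ifP.
move=> E; rewrite /laplace.
transitivity (C%:E * \int[mu]_(t in `[0%R, +oo[) (expR (- s * t))%:E)%E.
  rewrite -ge0_integralZl//; last first.
    by apply: measurable_funTS; apply/measurable_EFinP; exact: measurable_expRM.
  by apply: eq_integral => t _; rewrite EFinM muleC.
rewrite EFinM; congr (_ * _)%E.
rewrite -[LHS]mul1e -[X in (X%:E * _)%E](@mulVf _ s) ?gt_eqF// EFinM -muleA E.
by rewrite mule1.
Qed.

Lemma laplace_ge0 f s : (forall t, 0 <= t -> 0 <= f t) -> (0 <= laplace f s)%E.
Proof.
move=> f0; apply: integral_ge0 => t /=; rewrite in_itv/= andbT => t0.
by rewrite lee_fin mulr_ge0 ?expR_ge0 ?f0.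
Qed.

Lemma le_laplace f g s : measurable_fun [set: R] f -> measurable_fun [set: R] g ->
  (forall t, 0 <= t -> 0 <= f t) -> (forall t, 0 <= t -> f t <= g t) ->
  (laplace f s <= laplace g s)%E.
Proof.
move=> mf mg f0 fg; apply: ge0_le_integral => //.
- move=> t /=; rewrite in_itv/= andbT => t0.
  by rewrite lee_fin mulr_ge0 ?expR_ge0 ?f0.
- by apply: measurable_funTS; exact: measurable_laplace.
- by apply: measurable_funTS; exact: measurable_laplace.
- move=> t /=; rewrite in_itv/= andbT => t0.
  by rewrite lee_fin ler_wpM2l ?expR_ge0 ?fg.
Qed.

Lemma le_laplace2 f s s' : measurable_fun [set: R] f ->
  (forall t, 0 <= t -> 0 <= f t) -> s <= s' -> (laplace f s' <= laplace f s)%E.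
Proof.
move=> mf f0 ss'; apply: ge0_le_integral => //.
- move=> t /=; rewrite in_itv/= andbT => t0.
  by rewrite lee_fin mulr_ge0 ?expR_ge0 ?f0.
- by apply: measurable_funTS; exact: measurable_laplace.
- by apply: measurable_funTS; exact: measurable_laplace.
- move=> t /=; rewrite in_itv/= andbT => t0.
  by rewrite lee_fin ler_wpM2r ?f0// ler_expR ler_wpM2r// lerN2.
Qed.

Lemma laplace_lty f C a s : measurable_fun [set: R] f ->
  (forall t, 0 <= t -> 0 <= f t) ->
  (forall t, 0 <= t -> f t <= C * expR (a * t)) -> a < s -> (laplace f s < +oo)%E.
Proof.
move=> mf f0 fC as0.
have C0 : 0 <= C.
  by have := le_trans (f0 _ (lexx 0)) (fC _ (lexx 0)); rewrite mulr0 expR0 mulr1.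
apply: (@le_lt_trans _ _ (laplace (fun=> C) (s - a))); last first.
  by rewrite laplace_cst ?subr_gt0// ltry.
apply: ge0_le_integral => //.
- move=> t /=; rewrite in_itv/= andbT => t0.
  by rewrite lee_fin mulr_ge0 ?expR_ge0 ?f0.
- by apply: measurable_funTS; exact: measurable_laplace.
- by apply: measurable_funTS; exact: measurable_laplace.
move=> t /=; rewrite in_itv/= andbT => t0; rewrite lee_fin.
apply: (@le_trans _ _ (expR (- s * t) * (C * expR (a * t)))).
  by rewrite ler_wpM2l ?expR_ge0 ?fC.
rewrite mulrCA -expRD mulrC ler_wpM2r// ler_expR.
by rewrite le_eqVlt; apply/orP; left; apply/eqP; ring.
Qed.

Lemma laplace_integrable f C a s : measurable_fun [set: R] f ->
  (forall t, 0 <= t -> 0 <= f t) ->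
  (forall t, 0 <= t -> f t <= C * expR (a * t)) -> a < s ->
  mu.-integrable `[0, +oo[ (EFin \o (fun t => expR (- s * t) * f t)).
Proof.
move=> mf f0 fC as0; apply/integrableP; split.
  by apply: measurable_funTS; exact: measurable_laplace.
rewrite [X in (X < _)%E](_ : _ = laplace f s); first exact: laplace_lty fC as0.
apply: eq_integral => t; rewrite inE/= in_itv/= andbT => t0.
by rewrite ger0_norm// mulr_ge0 ?expR_ge0 ?f0.
Qed.

Lemma fin_num_laplace f C a s : measurable_fun [set: R] f ->
  (forall t, 0 <= t -> 0 <= f t) ->
  (forall t, 0 <= t -> f t <= C * expR (a * t)) -> a < s ->
  laplace f s \is a fin_num.
Proof.
move=> mf f0 fC as0; rewrite ge0_fin_numE ?laplace_ge0//.
exact: laplace_lty fC as0.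
Qed.

Lemma laplace_lt f C a s s' b c : measurable_fun [set: R] f ->
  (forall t, 0 <= t -> 0 <= f t) ->
  (forall t, 0 <= t -> f t <= C * expR (a * t)) -> a < s -> 0 <= s -> s < s' ->
  0 < b -> 0 < c -> (forall t, 0 < t -> t <= b -> c <= f t) ->
  (laplace f s' < laplace f s)%E.
Proof.
move=> mf f0 fC as_ s0 ss' b0 c0 cf.
have f's := @fin_num_laplace f C a s' mf f0 fC (lt_trans as_ ss').
(* A lower bound on [b/2, b] for the difference e^(-s t) (1 - e^(-(s' - s) t)) f(t) of the
   integrands: the first factor is smallest at b, the second at b/2. Integrated over [b/2, b] it
   yields the strict gap. *)
pose e := expR (- s * b) * (1 - expR (- (s' - s) * (b / 2))) * c.
have e0 : 0 < e.
  rewrite !mulr_gt0 ?expR_gt0// subr_gt0 -[ltRHS]expR0 ltr_expR mulNr oppr_lt0.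
  by rewrite !mulr_gt0 ?subr_gt0// invr_gt0.
pose h t := e * \1_(`[b / 2, b]%classic : set R) t.
have mh : measurable_fun [set: R] h by exact: measurable_funM.
have h0 t : 0 <= h t by rewrite mulr_ge0// ltW.
apply: (@lt_le_trans _ _ (laplace f s' + \int[mu]_(t in `[0%R, +oo[) (h t)%:E)%E).
  rewrite lteDl//.
  apply: (@lt_le_trans _ _ (\int[mu]_(t in `[(b / 2)%R, b]) (h t)%:E)%E); last first.
    apply: ge0_subset_integral => //.
    - by apply: measurable_funTS; apply/measurable_EFinP.
    - by move=> t _; rewrite lee_fin.
    - by apply: subset_itv => //; rewrite bnd_simp divr_ge0// ltW.
  rewrite (eq_integral (fun=> e%:E)); last first.
    by move=> t tb; rewrite /h indicE tb mulr1.
  rewrite integral_cst//= lebesgue_measure_itv/= lte_fin ifT; last by lra.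
  by rewrite -EFinB -EFinM lte_fin mulr_gt0//; lra.
rewrite /laplace -ge0_integralD//; last 4 first.
- move=> t /=; rewrite in_itv/= andbT => t0.
  by rewrite lee_fin mulr_ge0 ?expR_ge0 ?f0.
- by apply: measurable_funTS; exact: measurable_laplace.
- by move=> t _; rewrite lee_fin.
- by apply: measurable_funTS; apply/measurable_EFinP.
apply: ge0_le_integral => //.
- move=> t /=; rewrite in_itv/= andbT => t0.
  by rewrite adde_ge0 ?lee_fin// mulr_ge0 ?expR_ge0 ?f0.
- apply: measurable_funTS; apply: emeasurable_funD; first exact: measurable_laplace.
  exact/measurable_EFinP.
- by apply: measurable_funTS; exact: measurable_laplace.
move=> t /=; rewrite in_itv/= andbT => t0; rewrite -EFinD lee_fin /h indicE.
case: (boolP (t \in _)); last first.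
  by rewrite mulr0 addr0 ler_wpM2r ?f0// ler_expR ler_wpM2r// lerN2 ltW.
rewrite inE/= in_itv/= mulr1 => /andP[bt tb].
rewrite -lerBrDl -mulrBl /e.
have t1 : 0 < t by apply: lt_le_trans bt; rewrite divr_gt0.
have -> : expR (- s * t) - expR (- s' * t) = expR (- s * t) * (1 - expR (- (s' - s) * t)).
  by rewrite mulrBr mulr1 -expRD; congr (_ - expR _); ring.
have ss0 : 0 <= s' - s by rewrite subr_ge0 ltW.
have sub1 x : 0 <= x -> 0 <= 1 - expR (- (s' - s) * x).
  by move=> x0; rewrite subr_ge0 -expR0 ler_expR mulNr oppr_le0 mulr_ge0.
apply: ler_pM; rewrite ?(ltW c0)//.
- by rewrite mulr_ge0 ?expR_ge0// sub1// divr_ge0// ltW.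
- apply: ler_pM; rewrite ?expR_ge0//.
  + by rewrite sub1// divr_ge0// ltW.
  + by rewrite ler_expR !mulNr lerN2 ler_wpM2l.
  + by rewrite lerB// ler_expR !mulNr lerN2 ler_wpM2l.
- exact: cf.
Qed.

Section derivative.
Variable f : R -> R.
Hypotheses (mf : measurable_fun [set: R] f) (f0 : forall t, 0 <= t -> 0 <= f t).
Hypothesis f1 : forall t, 0 <= t -> f t <= 1.

Lemma le_expR_scaled s t : 0 < s -> 0 <= t -> t <= s^-1 * expR (s * t).
Proof.
move=> s0 t0; rewrite -ler_pdivrMl ?invr_gt0// invrK.
by apply: le_trans (expR_ge1Dx _); rewrite lerDr.
Qed.

Lemma laplace_fin_num s : 0 < s -> laplace f s \is a fin_num.
Proof.
move=> s0; apply: (@fin_num_laplace _ 1 0) => // t t0.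
by rewrite mul0r expR0 mulr1 f1.
Qed.

Lemma laplaceM_fin_num s : 0 < s -> laplace (fun t => t * f t) s \is a fin_num.
Proof.
move=> s0; apply: (@fin_num_laplace _ (s / 2)^-1 (s / 2)); last by lra.
- exact: measurable_funM.
- by move=> t t0; rewrite mulr_ge0 ?f0.
- move=> t t0; apply: (@le_trans _ _ (t * 1)); first by rewrite ler_wpM2l ?f1.
  by rewrite mulr1 le_expR_scaled// divr_gt0.
Qed.

Lemma is_derive_laplace s : 0 < s ->
  is_derive s 1 (fun x => fine (laplace f x))
    (- fine (laplace (fun t => t * f t) s)).
Proof.
move=> s0.
pose g x t := expR (- x * t) * f t.
(* Dominates the derivative in the parameter, uniformly over ]s/2, 2s[. The absolute value makes it
   nonnegative at negative t as well, as the differentiation theorem asks. *)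
pose G (t : R) : R := `|t * expR (- (s / 2) * t)|.
have Is : `]s / 2, 2 * s[%classic s by rewrite /= in_itv/=; lra.
have intg x : `]s / 2, 2 * s[%classic x -> mu.-integrable `[0, +oo[ (EFin \o g x).
  rewrite /= in_itv/= => /andP[sx _].
  apply: (@laplace_integrable _ 1 0) => //; last by lra.
  by move=> t t0; rewrite mul0r expR0 mulr1 f1.
have derg (x t : R) : is_derive x (1 : R) (g ^~ t) (- t * expR (- x * t) * f t).
  rewrite /g; apply: is_derive_eq.
  by rewrite !scaler0 !(addr0, add0r) /GRing.scale/=; ring.
have dergx x t : `]s / 2, 2 * s[%classic x -> `[0, +oo[%classic t ->
    derivable (g ^~ t) x 1.
  by move=> _ _; apply: ex_derive.
have dE x t : partial1of2 g x t = - t * expR (- x * t) * f t.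
  by rewrite partial1of2E; apply: derive_val.
have intG : mu.-integrable `[0, +oo[ (EFin \o G).
  have := @laplace_integrable (fun t => `|t|) (s / 4)^-1 (s / 4) (s / 2).
  rewrite (_ : (fun t => expR (- (s / 2) * t) * `|t|) = G); last first.
    by apply/funext => t; rewrite /G normrM (ger0_norm (expR_ge0 _)) mulrC.
  apply; [by apply: measurableT_comp|by []| |by lra].
  by move=> t t0; rewrite ger0_norm// le_expR_scaled// divr_gt0.
have Gub x t : `]s / 2, 2 * s[%classic x -> `[0, +oo[%classic t ->
    `|partial1of2 g x t| <= G t.
  rewrite /= !in_itv/= andbT => /andP[sx _] t0; rewrite dE /G.
  rewrite normrM -[leRHS]mulr1 ler_pM//; last by rewrite ger0_norm ?f0 ?f1.
  rewrite !normrM normrN ler_wpM2l//.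
  rewrite (ger0_norm (expR_ge0 (- x * t))) (ger0_norm (expR_ge0 (- (s / 2) * t))).
  by rewrite ler_expR ler_wpM2r// lerN2 ltW.
have G0 t : 0 <= G t by exact: normr_ge0.
have Fder := @derivable_under_integral R _ (measurableTypeR R) mu g
  `[0, +oo[%classic (measurable_itv _) s _ _ Is intg dergx G G0 intG Gub.
have Fd := @differentiation_under_integral R _ (measurableTypeR R) mu g
  `[0, +oo[%classic (measurable_itv _) s _ _ Is intg dergx G G0 intG Gub.
apply: DeriveDef.
  exact: Fder.
rewrite -derive1E Fd /Rintegral -fineN /laplace -integral_ge0N//; last first.
  by move=> t /=; rewrite in_itv/= andbT => t0; rewrite lee_fin !mulr_ge0 ?expR_ge0 ?f0.
by congr fine; apply: eq_integral => t _; rewrite dE -EFinN; congr EFin; ring.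
Qed.

End derivative.

End laplace_transform.

(** * Existence of the exponential growth rate *)

Section growth_rate.
Context {R : realType}.
Implicit Types (m : R -> R) (s t C : R).

Lemma log_growth_lt m s C e : (forall t, 0 <= t -> 1 <= m t) -> 0 < C -> 0 < e ->
  (forall t, 0 <= t -> m t <= C * expR (s * t)) ->
  \forall t \near +oo, t^-1 * ln (m t) < s + e.
Proof.
move=> m1 C0 e0 mC; near=> t.
have t0 : 0 < t by near: t; exact: nbhs_pinfty_gt.
have mt0 : 0 < m t by rewrite (lt_le_trans ltr01)// m1// ltW.
rewrite mulrC ltr_pdivrMr//.
apply: (@le_lt_trans _ _ (ln C + s * t)).
  rewrite -[X in _ <= _ + X]expRK -lnM ?posrE ?expR_gt0// ler_ln ?posrE//.
    by rewrite mC// ltW.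
  by rewrite mulr_gt0// expR_gt0.
rewrite mulrDl addrC ltrD2l -ltr_pdivrMl//.
by near: t; apply: nbhs_pinfty_gt; exact: num_real.
Unshelve. all: by end_near. Qed.

Lemma log_growth_gt m s C e : (forall t, 0 <= t -> 1 <= m t) -> 0 < C -> 0 < e ->
  (forall t, 1 <= t -> C * expR (s * t) <= m t) ->
  \forall t \near +oo, s - e < t^-1 * ln (m t).
Proof.
move=> m1 C0 e0 mC; near=> t.
have t0 : 0 < t by near: t; exact: nbhs_pinfty_gt.
have mt0 : 0 < m t by rewrite (lt_le_trans ltr01)// m1// ltW.
rewrite mulrC ltr_pdivlMr//.
apply: (@lt_le_trans _ _ (ln C + s * t)); last first.
  rewrite -[X in _ + X <= _]expRK -lnM ?posrE ?expR_gt0// ler_ln ?posrE//.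
    by rewrite mC//; near: t; exact: nbhs_pinfty_ge.
  by rewrite mulr_gt0// expR_gt0.
rewrite mulrBl addrC ltrD2r ltrNl -ltr_pdivrMl//.
by near: t; apply: nbhs_pinfty_gt; exact: num_real.
Unshelve. all: by end_near. Qed.

Variables (p m : R -> R) (k b c : R).
Hypotheses (mp : measurable_fun [set: R] p) (p0 : forall t, 0 <= t -> 0 <= p t).
Hypotheses (p1 : forall t, 0 <= t -> p t <= 1).
Hypotheses (b0 : 0 < b) (c0 : 0 < c) (pc : forall t, 0 < t -> t <= b -> c <= p t).
Hypotheses (k0 : 0 < k).
Hypothesis (m1 : forall t, 0 <= t -> 1 <= m t).
Hypothesis upper : forall s, 0 <= s -> (k%:E * laplace p s < 1)%E ->
  exists2 C, 0 < C & forall t, 0 <= t -> m t <= C * expR (s * t).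
Hypothesis lower : forall s, 0 <= s -> (1 < k%:E * laplace p s)%E ->
  exists2 C, 0 < C & forall t, 1 <= t -> C * expR (s * t) <= m t.

(** The limit is the supremum of the s > 0 with k P(s) > 1. The point 0 is added to make the set
    nonempty, and k bounds it because p <= 1 gives P(s) <= 1/s. *)
Lemma growth_rate_exists : exists l,
  [/\ t^-1 * ln (m t) @[t --> +oo] --> l, 0 <= l <= k,
      forall s, 0 < s -> (k%:E * laplace p s < 1)%E -> l <= s &
      forall s, 0 < s -> (1 < k%:E * laplace p s)%E -> s <= l].
Proof.
have pexp t : 0 <= t -> p t <= 1 * expR (0 * t).
  by move=> t0; rewrite mul0r expR0 mulr1 p1.
have lapfin s : 0 < s -> laplace p s \is a fin_num.
  by move=> s0; exact: (@fin_num_laplace _ p 1 0).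
have lapk s : k <= s -> (k%:E * laplace p s <= 1)%E.
  move=> ks; have s0 : 0 < s by exact: lt_le_trans ks.
  have H : (laplace p s <= (1 / s)%:E)%E.
    by rewrite -laplace_cst//; apply: le_laplace.
  apply: (@le_trans _ _ (k%:E * (1 / s)%:E)%E).
    by apply: lee_wpmul2l => //; rewrite lee_fin ltW.
  by rewrite -EFinM lee_fin mul1r ler_pdivrMr// mul1r.
pose E := [set s | s = 0 \/ (0 < s /\ (1 < k%:E * laplace p s)%E)].
have Eub : ubound E k.
  move=> s [->|[s0 ks]]; first exact: ltW.
  by rewrite leNgt; apply/negP => /ltW/lapk; rewrite leNgt ks.
have hE : has_sup E by split; [exists 0; left|exists k].
have E0 : E 0 by left.
have Esup := sup_upper_bound hE.
have l0 : 0 <= sup E by exact: Esup.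
have lk : sup E <= k by apply: ge_sup => //; exists 0.
exists (sup E); split; last 2 first.
- move=> s s0 ks; apply: ge_sup; first by exists 0.
  move=> u [->|[u0 ku]]; first exact: ltW.
  rewrite leNgt; apply/negP => su; move: ks; apply/negP; rewrite -leNgt.
  apply: (le_trans (ltW ku)); apply: lee_wpmul2l; first by rewrite lee_fin ltW.
  exact/le_laplace2/ltW.
- by move=> s s0 ks; apply: Esup; right.
- apply/cvgrPdist_lt => e e0.
  (* At [sup E + e / 4] one has k P <= 1; strict monotonicity makes this k P < 1 at [sup E + e / 2],
     where the upper bound applies. The other half of e absorbs its constant C. *)
  have : \forall t \near +oo, t^-1 * ln (m t) < (sup E + e / 2) + e / 2.
    have e4 : 0 < e / 4 by rewrite divr_gt0.
    have e2 : 0 < e / 2 by rewrite divr_gt0.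
    have : ~ E (sup E + e / 4).
      by move=> /Esup; rewrite gerDl leNgt e4.
    move=> /not_orP[_ /not_andP[|/negP]]; first by rewrite ltr_wpDl.
    rewrite -leNgt => kE.
    have [||C C0 mC] := upper (s := sup E + e / 2).
    + by rewrite addr_ge0// ltW.
    + apply: lt_le_trans kE; rewrite lte_pmul2l ?lte_fin//.
      apply: (@laplace_lt _ _ 1 0 _ _ b c) => //.
      * by rewrite ltr_wpDl.
      * by rewrite addr_ge0// ltW.
      * by rewrite ltrD2l ltr_pM2l// ltf_pV2 ?posrE// ltr_nat.
    exact: log_growth_lt mC.
  have : \forall t \near +oo, sup E - e < t^-1 * ln (m t).
    (* A negative bound holds because m >= 1. Otherwise an element of [E] within e / 2 of the
       supremum cannot be the added point 0, so the lower bound applies to it. *)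
    have [le0|le0] := ltP (sup E - e) 0.
      near=> t; apply: (lt_le_trans le0); rewrite mulr_ge0//.
        by rewrite invr_ge0; near: t; exact: nbhs_pinfty_ge.
      by rewrite ln_ge0// m1//; near: t; exact: nbhs_pinfty_ge.
    have e2 : 0 < e / 2 by rewrite divr_gt0.
    have [u [->|[u0 ku]] uE] := sup_adherent e2 hE; first by lra.
    have [|C C0 mC] := lower (s := u) _ ku; first exact: ltW.
    apply: filterS (log_growth_gt m1 C0 e2 mC) => t.
    by apply: le_lt_trans; lra.
  apply: filterS2 => t h1 h2.
  by rewrite distrC ltr_distl h1/= (lt_le_trans h2)// -addrA -splitr.
- by rewrite l0 lk.
Unshelve. all: by end_near. Qed.

End growth_rate.

(** * Abelian theorems *)

Section abelian.
Context {R : realType}.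
Local Notation mu := (@lebesgue_measure R).
Implicit Types (f g : R -> R) (s t T : R).

Lemma integral_le_laplace f T : measurable_fun [set: R] f ->
  (forall t, 0 <= t -> 0 <= f t) ->
  (\int[mu]_(t in `[0%R, T]) (f t)%:E <= (expR T)%:E * laplace f 1)%E.
Proof.
move=> mf f0; rewrite /laplace -ge0_integralZl//; last 2 first.
- by apply: measurable_funTS; exact: measurable_laplace.
- move=> t /=; rewrite in_itv/= andbT => t0.
  by rewrite lee_fin mulr_ge0 ?expR_ge0 ?f0.
apply: (@le_trans _ _ (\int[mu]_(t in `[0%R, T])
    ((expR T)%:E * (expR (- 1 * t) * f t)%:E))%E).
  apply: ge0_le_integral => //.
  - by move=> t /=; rewrite in_itv/= => /andP[t0 _]; rewrite lee_fin f0.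
  - by apply: measurable_funTS; apply/measurable_EFinP.
  - by apply: measurable_funTS; apply: measurable_funeM; exact: measurable_laplace.
  move=> t /=; rewrite in_itv/= => /andP[t0 tT].
  rewrite -EFinM lee_fin mulrA -expRD -[leLHS]mul1r ler_wpM2r ?f0//.
  by apply: le_trans (expR_ge1Dx _); lra.
apply: ge0_subset_integral => //.
- by apply: measurable_funTS; apply: measurable_funeM; exact: measurable_laplace.
- move=> t /=; rewrite in_itv/= andbT => t0.
  by rewrite -EFinM lee_fin !mulr_ge0 ?expR_ge0 ?f0.
- exact: subset_itvl.
Qed.

Lemma laplace_le_tail f g K T : measurable_fun [set: R] f -> measurable_fun [set: R] g ->
  (forall t, 0 <= t -> 0 <= f t) -> (forall t, 0 <= t -> 0 <= g t) ->
  0 <= K -> (forall t, T <= t -> f t <= K * g t) ->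
  forall s, 0 <= s ->
  (laplace f s <= \int[mu]_(t in `[0%R, T]) (f t)%:E + K%:E * laplace g s)%E.
Proof.
move=> mf mg f0 g0 K0 fKg s s0.
pose h t := \1_(`[0, T]%classic : set R) t * f t.
have mh : measurable_fun [set: R] h by exact: measurable_funM.
have -> : (\int[mu]_(t in `[0%R, T]) (f t)%:E = \int[mu]_(t in `[0%R, +oo[) (h t)%:E)%E.
  rewrite [LHS]integral_mkcond [RHS]integral_mkcond; apply: eq_integral => t _.
  rewrite !patchE /h indicE; case: ifPn => [|_]; last by rewrite mul0r; case: ifP.
  rewrite inE/= in_itv/= => /andP[t0 _].
  by rewrite mem_set/= ?in_itv/= ?t0// mul1r.
rewrite /laplace -ge0_integralZl//; last 2 first.
- by apply: measurable_funTS; exact: measurable_laplace.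
- move=> t /=; rewrite in_itv/= andbT => t0.
  by rewrite lee_fin mulr_ge0 ?expR_ge0 ?g0.
rewrite -ge0_integralD//; last 4 first.
- by move=> t /=; rewrite in_itv/= andbT => t0; rewrite lee_fin mulr_ge0 ?f0.
- by apply: measurable_funTS; apply/measurable_EFinP.
- move=> t /=; rewrite in_itv/= andbT => t0.
  by rewrite -EFinM lee_fin !mulr_ge0 ?expR_ge0 ?g0.
- by apply: measurable_funTS; apply: measurable_funeM; exact: measurable_laplace.
apply: ge0_le_integral => //.
- move=> t /=; rewrite in_itv/= andbT => t0.
  by rewrite lee_fin mulr_ge0 ?expR_ge0 ?f0.
- by apply: measurable_funTS; exact: measurable_laplace.
- apply: measurable_funTS; apply: emeasurable_funD.
    exact/measurable_EFinP.
  by apply: measurable_funeM; exact: measurable_laplace.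
move=> t /=; rewrite in_itv/= andbT => t0.
rewrite -EFinM -EFinD lee_fin /h indicE.
have e1 : expR (- s * t) <= 1.
  by rewrite -expR0 ler_expR mulNr oppr_le0 mulr_ge0.
have [tT|Tt] := leP t T.
  rewrite mem_set/= ?in_itv/= ?t0// mul1r.
  rewrite -[leLHS]addr0 lerD// ?mulr_ge0 ?expR_ge0 ?g0//.
  by rewrite -[leRHS]mul1r ler_wpM2r ?f0.
rewrite memNset/=; last by rewrite in_itv/= t0/= leNgt Tt.
rewrite mul0r add0r mulrCA.
by rewrite ler_wpM2l ?expR_ge0// fKg// ltW.
Qed.

(** Beyond some T the functions agree up to a factor 1 + d or 1 - d. The parts over [0, T] stay
    bounded as s tends to 0, hence are negligible against the transform of g, which diverges. *)
Lemma abelian_comparison f g : measurable_fun [set: R] f -> measurable_fun [set: R] g ->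
  (forall t, 0 <= t -> 0 <= f t) -> (forall t, 0 <= t -> 0 <= g t) ->
  (forall s, 0 < s -> laplace f s \is a fin_num) ->
  (forall s, 0 < s -> laplace g s \is a fin_num) ->
  fine (laplace g s) @[s --> 0^'+] --> +oo ->
  f t / g t @[t --> +oo] --> (1 : R) ->
  fine (laplace f s) / fine (laplace g s) @[s --> 0^'+] --> (1 : R).
Proof.
move=> mf mg f0 g0 ff fg gy fg1.
have intfin (h : R -> R) : measurable_fun [set: R] h -> (forall t, 0 <= t -> 0 <= h t) ->
    (forall s, 0 < s -> laplace h s \is a fin_num) -> forall T,
    exists2 A, 0 <= A & (\int[mu]_(t in `[0%R, T]) (h t)%:E = A%:E)%E.
  move=> mh h0 fh T.
  have I0 : (0 <= \int[mu]_(t in `[0%R, T]) (h t)%:E)%E.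
    by apply: integral_ge0 => t /=; rewrite in_itv/= => /andP[t0 _]; rewrite lee_fin h0.
  have If : (\int[mu]_(t in `[0%R, T]) (h t)%:E)%E \is a fin_num.
    rewrite ge0_fin_numE//; apply: (le_lt_trans (integral_le_laplace _ mh h0)).
    by rewrite -(fineK (fh 1 _))// -EFinM ltry.
  exists (fine (\int[mu]_(t in `[0%R, T]) (h t)%:E)%E); first exact: fine_ge0.
  by rewrite fineK.
apply/cvgrPdist_le => e e0.
(* One d pays for the tail and one for the integrals over [0, T], so 2 d <= e is needed; d < 1
   allows division by 1 - d. *)
pose d := Num.min (e / 2) 2^-1.
have d0 : 0 < d by rewrite lt_min !divr_gt0/= ?invr_gt0.
have d1 : d < 1 by rewrite gt_min; apply/orP; right; lra.
have de : d <= e / 2 by rewrite ge_min lexx.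
move/cvgrPdist_lt : fg1 => /(_ _ d0)[T0 [_ HT0]].
pose T := Num.max (T0 + 1) 0.
have TT t : T <= t -> [/\ (1 - d) * g t <= f t & f t <= (1 + d) * g t].
  rewrite ge_max => /andP[T0t t0].
  have /HT0 : T0 < t by rewrite (lt_le_trans _ T0t)// ltrDl.
  rewrite ltr_distlC => /andP[h1 h2].
  (* If g t were 0, the quotient would be 0 by convention, at distance 1 > d from its limit. *)
  have gt0 : 0 < g t.
    rewrite lt_neqAle g0// andbT eq_sym; apply/eqP => gt0; move: h1.
    by rewrite gt0 invr0 mulr0 subr_lt0 ltNge (ltW d1).
  by move: h1 h2; rewrite ltr_pdivlMr// ltr_pdivrMr// => /ltW ? /ltW ?.
have [A A0 AE] := intfin f mf f0 ff T.
have [B B0 BE] := intfin g mg g0 fg T.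
near=> s.
have s0 : 0 < s by near: s; exact: nbhs_right_gt.
have G0 : 0 < fine (laplace g s).
  by near: s; move/cvgryPgt : gy; apply.
have GA : A + B <= d * fine (laplace g s).
  rewrite -ler_pdivrMl//.
  by near: s; move/cvgryPge : gy; apply.
have := laplace_le_tail mf mg f0 g0 (addr_ge0 ler01 (ltW d0)) (fun t h => (TT t h).2) (ltW s0).
have hd (t : R) : T <= t -> g t <= (1 - d)^-1 * f t.
  by move=> /TT[h _]; rewrite ler_pdivlMl ?subr_gt0.
have d10 : 0 <= (1 - d)^-1 by rewrite invr_ge0 subr_ge0 ltW.
have := laplace_le_tail mg mf g0 f0 d10 hd (ltW s0).
rewrite AE BE -(fineK (ff s s0)) -(fineK (fg s s0)) -!EFinM -!EFinD !lee_fin.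
set F := fine (laplace f s) in GA *; set G := fine (laplace g s) in GA G0 *.
move=> h1 h2.
have h3 : (1 - d) * G <= B + F.
  have : (1 - d) * G <= (1 - d) * (B + (1 - d)^-1 * F).
    by rewrite ler_wpM2l// subr_ge0 ltW.
  rewrite mulrDr mulrA divff ?gt_eqF ?subr_gt0// mul1r => h.
  apply: (le_trans h); rewrite lerD2r -[leRHS]mul1r ler_wpM2r//.
  by rewrite lerBlDr lerDl ltW.
have G1 : 0 <= G by exact: ltW.
have deG : d * G <= e / 2 * G by rewrite ler_wpM2r.
have FG : F = F / G * G by rewrite mulfVK ?gt_eqF.
have FG2 : F / G - 1 <= e by rewrite -(ler_pM2r G0) mulrBl -FG mul1r; lra.
have FG1 : - e <= F / G - 1 by rewrite -(ler_pM2r G0) mulrBl -FG mul1r; lra.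
by rewrite distrC ler_norml FG1 FG2.
Unshelve. all: by end_near. Qed.

End abelian.

(** * Power functions: integrals and Laplace transforms *)

Section power_kernel.
Context {R : realType}.
Local Notation mu := (@lebesgue_measure R).
Implicit Types (a b s t y : R).

Lemma integral_itvcc_derive (f F : R -> R) a b : a < b ->
  (forall t, a <= t <= b -> is_derive t 1 F (f t)) ->
  (forall t, a <= t <= b -> {for t, continuous f}) ->
  (\int[mu]_(t in `[a, b]) (f t)%:E = (F b - F a)%:E)%E.
Proof.
move=> ab dF cf; have cF t : a <= t <= b -> {for t, continuous F}.
  move=> /dF dFt; apply: differentiable_continuous.
  by apply/derivable1_diffP; apply: ex_derive.
rewrite (@continuous_FTC2 _ f F)//.
- apply: continuous_in_subspaceT => t; rewrite inE/= in_itv/=.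
  exact: cf.
- split.
  + move=> t; rewrite in_itv/= => /andP[at_ tb].
    by have := dF t; rewrite !ltW// => /(_ isT) ?; apply: ex_derive.
  + by apply: cvg_at_right_filter; apply: cF; rewrite lexx ltW.
  + by apply: cvg_at_left_filter; apply: cF; rewrite lexx ltW.
- move=> t; rewrite in_itv/= => /andP[at_ tb].
  have := dF t; rewrite !ltW// => /(_ isT) ?.
  by rewrite derive1E; apply: derive_val.
Qed.

Lemma continuous_powRr y t : 0 < t -> {for t, continuous (fun u : R => u `^ y)}.
Proof.
move=> t0; apply: differentiable_continuous.
apply/derivable1_diffP; apply: derivable_powR.
by rewrite in_itv/= t0.
Qed.

Lemma is_derive_powR y t : 0 < t ->
  is_derive t (1 : R) (fun u : R => u `^ y) (y * t `^ (y - 1)).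
Proof.
move=> t0; have t0' : t \in `]0, +oo[ by rewrite in_itv/= t0.
apply: DeriveDef; first exact: derivable_powR.
by rewrite -derive1E powR_derive1.
Qed.

Lemma integral_powR y a b : y != 0 -> 0 < a -> a < b ->
  (\int[mu]_(t in `[a, b]) (t `^ (y - 1))%:E = ((b `^ y - a `^ y) / y)%:E)%E.
Proof.
move=> y0 a0 ab.
have dF t : a <= t <= b ->
    is_derive t (1 : R) (fun t => y^-1 * t `^ y) (t `^ (y - 1)).
  move=> /andP[at_ _]; have t0 : 0 < t by exact: lt_le_trans at_.
  have dy := is_derive_powR y t0.
  apply: is_derive_eq.
  by rewrite /GRing.scale/= mulrA mulVf// mul1r.
have cf t : a <= t <= b -> {for t, continuous (fun u : R => u `^ (y - 1))}.
  by move=> /andP[at_ _]; apply: continuous_powRr; exact: lt_le_trans at_.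
by rewrite (integral_itvcc_derive ab dF cf) mulrBl ![_ / y]mulrC.
Qed.

Lemma integral_inv a b : 0 < a -> a < b ->
  (\int[mu]_(t in `[a, b]) (t^-1)%:E = (ln b - ln a)%:E)%E.
Proof.
move=> a0 ab; apply: integral_itvcc_derive => // t /andP[at_ _].
  have t0 : 0 < t by exact: lt_le_trans at_.
  exact: is_derive1_ln.
have t0 : 0 < t by exact: lt_le_trans at_.
by apply: cvgV => //; rewrite gt_eqF.
Qed.

Lemma ge0_integral_le_compact (f : R -> R) (M : R) : measurable_fun [set: R] f ->
  (forall t, 0 <= f t) ->
  (forall a b, 0 < a -> a <= b -> (\int[mu]_(t in `[a, b]) (f t)%:E <= M%:E)%E) ->
  (\int[mu]_(t in `[0%R, +oo[) (f t)%:E <= M%:E)%E.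
Proof.
move=> mf f0 H; rewrite leNgt; apply/negP => /ge0_lt_integral_compact[].
- exact/measurable_EFinP.
- by move=> t; rewrite lee_fin.
by move=> a [b [a0 ab]]; apply/negP; rewrite -leNgt H.
Qed.

Lemma integral_powR_near0 y : 0 < y ->
  (\int[mu]_(t in `[0%R, +oo[) (\1_(`]0%R, 1%R]%classic : set R) t * t `^ (y - 1))%:E
     <= (y^-1)%:E)%E.
Proof.
move=> y0; apply: ge0_integral_le_compact.
- by apply: measurable_funM => //; exact: measurable_powR.
- by move=> t; rewrite mulr_ge0// powR_ge0.
(* The minimum keeps [a', 1] nondegenerate, as [integral_powR] requires, also when a >= 1. *)
move=> a b a0 ab; pose a' := Num.min a 2^-1.
have a'0 : 0 < a' by rewrite lt_min a0 invr_gt0 ltr0n.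
have a'1 : a' < 1 by rewrite gt_min; apply/orP; right; lra.
apply: (@le_trans _ _ (\int[mu]_(t in `[a', 1%R]) (t `^ (y - 1))%:E)%E); last first.
  rewrite integral_powR// ?gt_eqF// powR1 lee_fin -[leRHS]mul1r ler_wpM2r//.
    by rewrite invr_ge0 ltW.
  by rewrite lerBlDr lerDl powR_ge0.
rewrite integral_mkcond [leRHS]integral_mkcond; apply: ge0_le_integral => //.
- by move=> t _; rewrite patchE; case: ifP => // _; rewrite lee_fin mulr_ge0// powR_ge0.
- apply/(measurable_restrictT _ _).1 => //; apply: measurable_funTS.
  by apply/measurable_EFinP/measurable_funM => //; exact: measurable_powR.
- apply/(measurable_restrictT _ _).1 => //; apply: measurable_funTS.
  by apply/measurable_EFinP; exact: measurable_powR.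
move=> t _; rewrite !patchE indicE.
case: ifPn => [|_]; last by case: ifP => // _; rewrite lee_fin powR_ge0.
rewrite inE/= in_itv/= => /andP[at_ tb].
have [t1|t1] := leP t 1; last first.
  rewrite memNset/= ?in_itv/=; last by rewrite leNgt t1 andbF.
  by rewrite mul0r; case: ifP => // _; rewrite lee_fin powR_ge0.
rewrite mem_set/= ?in_itv/= ?t1 ?(lt_le_trans a0)// mul1r.
by rewrite mem_set//= in_itv/= t1 andbT ge_min at_.
Qed.

Lemma integral_powR_tail y : y < 0 ->
  (\int[mu]_(t in `[0%R, +oo[) (\1_(`[1%R, +oo[%classic : set R) t * t `^ (y - 1))%:E
     <= ((- y)^-1)%:E)%E.
Proof.
move=> y0; apply: ge0_integral_le_compact.
- by apply: measurable_funM => //; exact: measurable_powR.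
- by move=> t; rewrite mulr_ge0// powR_ge0.
move=> a b a0 ab; pose b' := Num.max b 2.
have b'1 : 1 < b' by rewrite lt_max; apply/orP; right; lra.
apply: (@le_trans _ _ (\int[mu]_(t in `[1%R, b']) (t `^ (y - 1))%:E)%E); last first.
  rewrite integral_powR// ?lt_eqF// powR1 lee_fin invrN -subr_ge0.
  have -> : - y^-1 - (b' `^ y - 1) / y = b' `^ y * (- y^-1) by ring.
  by rewrite mulr_ge0 ?powR_ge0// oppr_ge0 invr_le0 ltW.
rewrite integral_mkcond [leRHS]integral_mkcond; apply: ge0_le_integral => //.
- by move=> t _; rewrite patchE; case: ifP => // _; rewrite lee_fin mulr_ge0// powR_ge0.
- apply/(measurable_restrictT _ _).1 => //; apply: measurable_funTS.
  by apply/measurable_EFinP/measurable_funM => //; exact: measurable_powR.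
- apply/(measurable_restrictT _ _).1 => //; apply: measurable_funTS.
  by apply/measurable_EFinP; exact: measurable_powR.
move=> t _; rewrite !patchE indicE.
case: ifPn => [|_]; last by case: ifP => // _; rewrite lee_fin powR_ge0.
rewrite inE/= in_itv/= => /andP[at_ tb].
have [t1|t1] := leP 1 t; last first.
  rewrite memNset/= ?in_itv/=; last by rewrite leNgt t1.
  by rewrite mul0r; case: ifP => // _; rewrite lee_fin powR_ge0.
rewrite mem_set/= ?in_itv/= ?t1// mul1r.
by rewrite mem_set//= in_itv/= t1 le_max tb.
Qed.

End power_kernel.

Section abelian_theorems.
Context {R : realType}.
Local Notation mu := (@lebesgue_measure R).
Implicit Types (s t y : R).

Lemma laplace_powR1_fin_num y : 0 < y < 1 ->
  laplace (fun t => t `^ (y - 1)) 1 \is a fin_num.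
Proof.
move=> /andP[y0 y1]; rewrite ge0_fin_numE; last first.
  by apply: laplace_ge0 => t _; exact: powR_ge0.
apply: (@le_lt_trans _ _ ((\int[mu]_(t in `[0%R, +oo[)
    (\1_(`]0%R, 1%R]%classic : set R) t * t `^ (y - 1))%:E)
    + laplace (fun=> 1%R) 1%R)%E); last first.
  rewrite lte_add_pinfty//; last by rewrite laplace_cst// ltry.
  exact: le_lt_trans (integral_powR_near0 y0) (ltry _).
have m1 : measurable_fun [set: R] (fun t : R =>
    (\1_(`]0, 1]%classic : set R) t * t `^ (y - 1))%:E).
  by apply/measurable_EFinP/measurable_funM => //; exact: measurable_powR.
rewrite /laplace -ge0_integralD//; last 3 first.
- by move=> t _; rewrite lee_fin mulr_ge0// powR_ge0.
- by apply: measurable_funTS; exact: m1.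
- by apply: measurable_funTS; exact: measurable_laplace.
apply: ge0_le_integral => //.
- by move=> t _; rewrite lee_fin mulr_ge0 ?expR_ge0 ?powR_ge0.
- by apply: measurable_funTS; apply: measurable_laplace; exact: measurable_powR.
- apply: measurable_funTS; apply: emeasurable_funD; first exact: m1.
  exact: measurable_laplace.
move=> t /=; rewrite in_itv/= andbT => t0; rewrite -EFinD lee_fin indicE mulr1.
have e1 : expR (- 1 * t) <= 1 by rewrite mulN1r -[leRHS]expR0 ler_expR oppr_le0.
have [t1|t1] := leP t 1.
  move: t0; rewrite le_eqVlt => /predU1P[<-|t0].
    (* At t = 0 the power with nonzero exponent is 0 by convention. *)
    by rewrite powR0 ?subr_eq0 ?lt_eqF// !mulr0 add0r expR_ge0.
  rewrite mem_set/= ?in_itv/= ?t0// mul1r.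
  rewrite -[leLHS]addr0 lerD ?expR_ge0//.
  by rewrite -[leRHS]mul1r ler_wpM2r ?powR_ge0.
rewrite memNset/=; last by rewrite in_itv/= leNgt t1 andbF.
rewrite mul0r add0r -[leRHS]mulr1 ler_wpM2l ?expR_ge0//.
by rewrite -[leRHS](powRr0 t) ler_powR ?(ltW t1)// subr_le0 ltW.
Qed.

Lemma GammaE y : 0 < y < 1 -> (Gamma y)%:E = laplace (fun t => t `^ (y - 1)) 1.
Proof.
move=> y01; rewrite /Gamma /Rintegral.
have -> : (\int[mu]_(t in `]0%R, +oo[) (t `^ (y - 1) * expR (- t))%:E =
    laplace (fun t => t `^ (y - 1))%R 1%R)%E.
  rewrite integral_itv_obnd_cbnd; last first.
    apply: measurable_funTS; apply/measurable_EFinP/measurable_funM.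
      exact: measurable_powR.
    by apply: measurableT_comp => //; exact: measurable_funN.
  by apply: eq_integral => t _; rewrite mulrC mulN1r.
by rewrite fineK// laplace_powR1_fin_num.
Qed.

Lemma Gamma_gt0 y : 0 < y < 1 -> 0 < Gamma y.
Proof.
move=> y01; have /andP[y0 y1] := y01; rewrite -lte_fin GammaE//.
apply: (@lt_le_trans _ _ (\int[mu]_(t in `[1%R, 2%R]) (expR (- 2) * 2 `^ (y - 1))%:E)%E).
  rewrite integral_cst//= lebesgue_measure_itv/= lte_fin ltr1n -EFinB -EFinM lte_fin.
  by rewrite !mulr_gt0 ?expR_gt0 ?powR_gt0// subr_gt0 ltr1n.
apply: (@le_trans _ _ (\int[mu]_(t in `[1%R, 2%R]) (expR (- 1 * t) * t `^ (y - 1))%:E)%E).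
  apply: ge0_le_integral => //.
    by apply: measurable_funTS; apply: measurable_laplace; exact: measurable_powR.
  move=> t /=; rewrite in_itv/= => /andP[t1 t2]; rewrite lee_fin.
  rewrite ler_pM ?expR_ge0 ?powR_ge0//; first by rewrite mulN1r ler_expR lerN2.
  have t0 : 0 < t by exact: lt_le_trans t1.
  rewrite -opprB !powRN lef_pV2 ?posrE ?powR_gt0//.
  apply: ge0_ler_powR; rewrite ?nnegrE//; first by rewrite subr_ge0 ltW.
  exact: ltW.
apply: ge0_subset_integral => //.
- by apply: measurable_funTS; apply: measurable_laplace; exact: measurable_powR.
- by move=> t _; rewrite lee_fin mulr_ge0 ?expR_ge0 ?powR_ge0.
- by apply: subset_itv; rewrite bnd_simp.
Qed.

(** Substitution u = s t in the integral of [Gamma]; the indicator in [g] turns it into an integral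
    over the whole line, where the affine change of variable is available. *)
Lemma laplace_powR y s : 0 < y < 1 -> 0 < s ->
  laplace (fun t => t `^ (y - 1)) s = (Gamma y * s `^ (- y))%:E.
Proof.
move=> y01 s0; have /andP[y0 y1] := y01.
pose g u := (\1_(`[0, +oo[%classic : set R) u * (expR (- 1 * u) * u `^ (y - 1)))%:E.
have mg : measurable_fun [set: R] g.
  apply/measurable_EFinP/measurable_funM => //; apply: measurable_funM.
    exact: measurable_expRM.
  exact: measurable_powR.
have g0 u : (0 <= g u)%E by rewrite lee_fin !mulr_ge0 ?expR_ge0 ?powR_ge0.
have := @ge0_integral_affine R g s 0 s0 mg g0.
have -> : (\int[mu]_u g u = (Gamma y)%:E)%E.
  rewrite GammaE// [RHS]integral_mkcond; apply: eq_integral => u _.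
  by rewrite patchE /g indicE; case: ifPn => _; rewrite ?mul1r ?mul0r.
have -> : (\int[mu]_t g (s * t + 0)%R =
    (s `^ (y - 1))%:E * laplace (fun t => t `^ (y - 1))%R s)%E.
  rewrite /laplace -[RHS]ge0_integralZl; last 4 first.
  - exact: measurable_itv.
  - by apply: measurable_funTS; apply: measurable_laplace; exact: measurable_powR.
  - by move=> t _; rewrite lee_fin mulr_ge0 ?expR_ge0 ?powR_ge0.
  - by rewrite lee_fin powR_ge0.
  rewrite [RHS]integral_mkcond; apply: eq_integral => t _.
  rewrite patchE /g indicE addr0 !mem_setE !in_itv/= !andbT pmulr_rge0//.
  case: ifPn => t0; last by rewrite mul0r.
  rewrite mul1r -EFinM (powRM _ (ltW s0) t0); congr EFin.
  by rewrite mulN1r -mulNr mulrCA.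
move=> E; have sy : (s `^ (1 - y))%:E = ((s `^ (y - 1))^-1)%:E by rewrite -powRN opprB.
have -> : laplace (fun t => t `^ (y - 1)) s = ((s `^ (1 - y))%:E *
    ((s `^ (y - 1))%:E * laplace (fun t => t `^ (y - 1))%R s))%E.
  by rewrite muleA sy -EFinM mulVf ?mul1e// gt_eqF// powR_gt0.
rewrite E -!EFinM; congr EFin.
have -> : s `^ (- y) = s `^ (1 - y) * s^-1.
  rewrite -[X in _ * X]powR_inv1 ?ltW// -powRD; first by congr (_ `^ _); ring.
  by apply/implyP => _; rewrite gt_eqF.
ring.
Qed.

Lemma powRN_cvgy y : 0 < y -> s `^ (- y) @[s --> (0 : R)^'+] --> +oo.
Proof.
move=> y0; apply/cvgryPge => A.
have := @powR_cvg0 R y y0 => /cvgrPdist_lt /(_ ((`|A| + 1)^-1)).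
rewrite invr_gt0 ltr_wpDl// => /(_ isT) H.
near=> s; have s0 : 0 < s by near: s; exact: nbhs_right_gt.
have : `|0 - s `^ y| < (`|A| + 1)^-1 by near: s.
rewrite sub0r normrN ger0_norm ?powR_ge0// powRN => h.
apply: (@le_trans _ _ (`|A| + 1)).
  by apply: (le_trans (ler_norm _)); rewrite lerDl.
rewrite -[leLHS]invrK lef_pV2 ?posrE ?invr_gt0 ?powR_gt0 ?ltr_wpDl//.
exact: ltW.
Unshelve. all: by end_near. Qed.

Variables (f : R -> R) (c : R).
Hypotheses (mf : measurable_fun [set: R] f) (f0 : forall t, 0 <= t -> 0 <= f t).
Hypothesis ff : forall s, 0 < s -> laplace f s \is a fin_num.
Hypothesis c0 : 0 < c.

Lemma laplace_scale (k : R) (g : R -> R) s : measurable_fun [set: R] g -> 0 <= k ->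
  (forall t, 0 <= t -> 0 <= g t) ->
  laplace (fun t => k * g t) s = (k%:E * laplace g s)%E.
Proof.
move=> mg k0 g0; rewrite /laplace -ge0_integralZl//.
- by apply: eq_integral => t _; rewrite -EFinM mulrCA.
- by apply: measurable_funTS; exact: measurable_laplace.
- move=> t /=; rewrite in_itv/= andbT => t0.
  by rewrite lee_fin mulr_ge0 ?expR_ge0 ?g0.
Qed.

Lemma abelian_powR y : 0 < y < 1 ->
  f t / (c * t `^ (y - 1)) @[t --> +oo] --> (1 : R) ->
  fine (laplace f s) / (c * Gamma y * s `^ (- y)) @[s --> 0^'+] --> (1 : R).
Proof.
move=> y01 fc; have /andP[y0 y1] := y01.
have LE s : 0 < s -> laplace (fun t => c * t `^ (y - 1)) s = (c * Gamma y * s `^ (- y))%:E.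
  move=> s0; rewrite (@laplace_scale c (fun t => t `^ (y - 1)) s _ (ltW c0)) => [|| t _].
  - by rewrite laplace_powR// -EFinM mulrA.
  - exact: measurable_powR.
  - exact: powR_ge0.
have cG : 0 < c * Gamma y by rewrite mulr_gt0// Gamma_gt0.
have main : fine (laplace f s) / fine (laplace (fun t => c * t `^ (y - 1)) s)
    @[s --> 0^'+] --> (1 : R).
  apply: abelian_comparison => //.
  - by apply: measurable_funM => //; exact: measurable_powR.
  - by move=> t _; rewrite mulr_ge0 ?powR_ge0// ltW.
  - by move=> s s0; rewrite LE.
  - apply: (@cvg_trans _ (c * Gamma y * s `^ (- y) @[s --> 0^'+])).
      apply: near_eq_cvg; near=> s.
      by rewrite LE//; near: s; exact: nbhs_right_gt.
    exact: gt0_cvgMry cG (powRN_cvgy y0).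
apply: cvg_trans main; apply: near_eq_cvg; near=> s.
by rewrite LE//; near: s; exact: nbhs_right_gt.
Unshelve. all: by end_near. Qed.

End abelian_theorems.

(** * The borderline exponent: logarithmic divergence *)

Section abelian_logarithm.
Context {R : realType}.
Local Notation mu := (@lebesgue_measure R).
Implicit Types (s t y : R).

(** The comparison function is cut below 1, since 1/t is not integrable at 0 and has no finite
    Laplace transform. *)
Let phi t : R := \1_(`[1, +oo[%classic : set R) t * t `^ (-1).

Let mphi : measurable_fun [set: R] phi.
Proof. by apply: measurable_funM => //; exact: measurable_powR. Qed.

Let phi0 t : 0 <= phi t.
Proof. by rewrite mulr_ge0// powR_ge0. Qed.

(** The cut at 1/s is the scale at which e^(-s t) leaves 1; the integral is ln(1/s). It differs from
    the transform of [phi] by at most 1 each way: beyond the cut 1/t <= s, and before it (1 - e^(-s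
    t)) / t <= s. *)
Let J s t : R := \1_(`[1, s^-1]%classic : set R) t * t `^ (-1).

Let mJ s : measurable_fun [set: R] (J s).
Proof. by apply: measurable_funM => //; exact: measurable_powR. Qed.

Let J0 s t : 0 <= J s t.
Proof. by rewrite mulr_ge0// powR_ge0. Qed.

Let integral_J s : 0 < s -> s < 1 ->
  (\int[mu]_(t in `[0%R, +oo[) (J s t)%:E = (ln s^-1)%:E)%E.
Proof.
move=> s0 s1; rewrite -[ln s^-1]subr0 -[X in _ - X](@ln1 R).
rewrite -integral_inv// ?invf_gt1//.
rewrite integral_mkcond [RHS]integral_mkcond; apply: eq_integral => t _.
rewrite !patchE /J indicE; case: (boolP (t \in `[1, s^-1]%classic)) => [|_].
  rewrite inE/= in_itv/= => /andP[t1 _].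
  have t0 : 0 <= t by exact: le_trans t1.
  by rewrite mem_set/= ?in_itv/= ?t0// mul1r powR_inv1.
by rewrite mul0r; case: ifP.
Qed.

Let phi_le s : 0 < s -> s < 1 -> (laplace phi s <= (ln s^-1 + 1)%:E)%E.
Proof.
move=> s0 s1; rewrite EFinD -integral_J//.
have -> : (1%:E = laplace (fun=> s) s)%E by rewrite laplace_cst ?divff ?gt_eqF ?ltW.
have mJE : measurable_fun [set: R] (fun t => (J s t)%:E) by exact/measurable_EFinP.
have mc : measurable_fun [set: R] (fun t => (expR (- s * t) * s)%:E).
  exact: measurable_laplace.
rewrite /laplace -ge0_integralD; last 5 first.
- exact: measurable_itv.
- by move=> t _; rewrite lee_fin J0.
- by apply: measurable_funTS; exact: mJE.
- by move=> t _; rewrite lee_fin mulr_ge0 ?expR_ge0// ltW.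
- by apply: measurable_funTS; exact: mc.
apply: ge0_le_integral => //.
- by move=> t _; rewrite lee_fin mulr_ge0 ?expR_ge0 ?phi0.
- by apply: measurable_funTS; exact: measurable_laplace.
- by apply: measurable_funTS; exact: emeasurable_funD.
move=> t /=; rewrite in_itv/= andbT => t0; rewrite -EFinD lee_fin /phi indicE.
case: (boolP (t \in _)) => [|_]; last first.
  by rewrite mul0r mulr0 addr_ge0 ?J0// mulr_ge0 ?expR_ge0// ltW.
rewrite inE/= in_itv/= andbT => t1; rewrite mul1r /J indicE.
have e1 : expR (- s * t) <= 1 by rewrite -[leRHS]expR0 ler_expR mulNr oppr_le0 mulr_ge0// ltW.
have [ts|ts] := leP t s^-1.
  rewrite mem_set/= ?in_itv/= ?t1// mul1r -[leLHS]addr0 lerD//.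
    by rewrite -[leRHS]mul1r ler_wpM2r ?powR_ge0.
  by rewrite mulr_ge0 ?expR_ge0// ltW.
rewrite memNset/=; last by rewrite in_itv/= t1/= leNgt ts.
rewrite mul0r add0r ler_wpM2l ?expR_ge0// powR_inv1//.
have t00 : 0 < t by exact: lt_le_trans t1.
by rewrite -[leRHS]invrK lef_pV2 ?posrE ?invr_gt0// ltW.
Qed.

Let phi_ge s : 0 < s -> s < 1 -> ((ln s^-1)%:E <= laplace phi s + 1%:E)%E.
Proof.
move=> s0 s1; rewrite -integral_J//.
pose K t : R := s * \1_(`[1, s^-1]%classic : set R) t.
have mK : measurable_fun [set: R] (fun t => (K t)%:E).
  by apply/measurable_EFinP/measurable_funM.
have K0 t : 0 <= K t by rewrite mulr_ge0// ltW.
apply: (@le_trans _ _ (laplace phi s + \int[mu]_(t in `[0%R, +oo[) (K t)%:E)%E); last first.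
  apply: leeD => //.
  have -> : (\int[mu]_(t in `[0%R, +oo[) (K t)%:E = \int[mu]_(t in `[1%R, (s^-1)%R]) s%:E)%E.
    rewrite integral_mkcond [RHS]integral_mkcond; apply: eq_integral => t _.
    rewrite !patchE /K indicE; case: (boolP (t \in `[1, s^-1]%classic)) => [|_].
      rewrite inE/= in_itv/= => /andP[t1 _].
      have t0 : 0 <= t by exact: le_trans t1.
      by rewrite mem_set/= ?in_itv/= ?t0// mulr1.
    by rewrite mulr0; case: ifP.
  rewrite integral_cst//= lebesgue_measure_itv/= lte_fin invf_gt1// s1.
  by rewrite -EFinB -EFinM lee_fin mulrBr divff ?gt_eqF// mulr1 lerBlDr lerDl ltW.
rewrite /laplace -ge0_integralD; last 5 first.
- exact: measurable_itv.
- by move=> t _; rewrite lee_fin mulr_ge0 ?expR_ge0 ?phi0.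
- by apply: measurable_funTS; exact: measurable_laplace.
- by move=> t _; rewrite lee_fin K0.
- by apply: measurable_funTS; exact: mK.
have mJE : measurable_fun [set: R] (fun t => (J s t)%:E) by exact/measurable_EFinP.
apply: ge0_le_integral => //.
- by move=> t _; rewrite lee_fin J0.
- by apply: measurable_funTS; exact: mJE.
- apply: measurable_funTS; apply: emeasurable_funD; last exact: mK.
  exact: measurable_laplace.
move=> t /=; rewrite in_itv/= andbT => t0; rewrite -EFinD lee_fin /J /K indicE.
case: (boolP (t \in `[1, s^-1]%classic)) => [|_]; last first.
  by rewrite mul0r mulr0 addr0 mulr_ge0 ?expR_ge0 ?phi0.
rewrite inE/= in_itv/= => /andP[t1 ts].
have t00 : 0 < t by exact: lt_le_trans t1.
rewrite /phi indicE mem_set/= ?in_itv/= ?t1// !mul1r mulr1 powR_inv1//.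
rewrite -(ler_pM2r t00) mulVf ?gt_eqF// mulrDl -mulrA mulVf ?gt_eqF// mulr1.
by have := expR_ge1Dx (- s * t); lra.
Qed.

Let phi_fin s : 0 < s -> laplace phi s \is a fin_num.
Proof.
move=> s0; apply: (@fin_num_laplace _ _ 1 0) => // t _.
rewrite mul0r expR0 mulr1 /phi indicE; case: (boolP (t \in _)) => [|_]; last by rewrite mul0r.
rewrite inE/= in_itv/= andbT mul1r => t1.
have t0 : 0 < t by exact: lt_le_trans t1.
by rewrite powR_inv1 ?(ltW t0)// invf_le1.
Qed.

Lemma lnV_cvgy : ln s^-1 @[s --> (0 : R)^'+] --> +oo.
Proof.
apply/cvgryPge => A; near=> s.
have s0 : 0 < s by near: s; exact: nbhs_right_gt.
rewrite lnV ?posrE// lerNr -[leRHS]expRK ler_ln ?posrE ?expR_gt0//.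
by apply: ltW; near: s; apply: nbhs_right_lt; exact: expR_gt0.
Unshelve. all: by end_near. Qed.

Let phi_asymp : fine (laplace phi s) / ln s^-1 @[s --> 0^'+] --> (1 : R).
Proof.
apply/cvgrPdist_le => e e0; near=> s.
have s0 : 0 < s by near: s; exact: nbhs_right_gt.
have s1 : s < 1 by near: s; exact: nbhs_right_lt.
have L0 : 0 < ln s^-1 by near: s; move/cvgryPgt : lnV_cvgy; apply.
have Le : e^-1 <= ln s^-1 by near: s; move/cvgryPge : lnV_cvgy; apply.
have := phi_le s0 s1; have := phi_ge s0 s1.
rewrite -(fineK (phi_fin s0)) -EFinD !lee_fin.
move: (fine _) => F; move: (ln s^-1) L0 Le => L L0 Le h1 h2.
have eL : 1 <= e * L by rewrite -ler_pdivrMl// mulr1.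
have FL : F = F / L * L by rewrite mulfVK ?gt_eqF.
have FG2 : F / L - 1 <= e by rewrite -(ler_pM2r L0) mulrBl -FL mul1r; lra.
have FG1 : - e <= F / L - 1 by rewrite -(ler_pM2r L0) mulrBl -FL mul1r; lra.
by rewrite distrC ler_norml FG1 FG2.
Unshelve. all: by end_near. Qed.

Let phi_cvgy : fine (laplace phi s) @[s --> 0^'+] --> +oo.
Proof.
apply/cvgryPge => A; near=> s.
have s0 : 0 < s by near: s; exact: nbhs_right_gt.
have s1 : s < 1 by near: s; exact: nbhs_right_lt.
have LA : A + 1 <= ln s^-1 by near: s; move/cvgryPge : lnV_cvgy; apply.
have := phi_ge s0 s1.
rewrite -(fineK (phi_fin s0)) -EFinD !lee_fin; lra.
Unshelve. all: by end_near. Qed.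

Lemma abelian_ln (f : R -> R) (c : R) : measurable_fun [set: R] f ->
  (forall t, 0 <= t -> 0 <= f t) ->
  (forall s, 0 < s -> laplace f s \is a fin_num) -> 0 < c ->
  f t / (c * t `^ (-1)) @[t --> +oo] --> (1 : R) ->
  fine (laplace f s) / (c * ln s^-1) @[s --> 0^'+] --> (1 : R).
Proof.
move=> mf f0 ff c0 fc.
have LE s : laplace (fun t => c * phi t) s = (c%:E * laplace phi s)%E.
  by rewrite laplace_scale// ltW.
have mcphi : measurable_fun [set: R] (fun t => c * phi t) by exact: measurable_funM.
have main : fine (laplace f s) / fine (laplace (fun t => c * phi t) s)
    @[s --> 0^'+] --> (1 : R).
  apply: abelian_comparison => //.
  - by move=> t _; rewrite mulr_ge0 ?phi0// ltW.
  - by move=> s s0; rewrite LE fin_numM// phi_fin.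
  - apply: (@cvg_trans _ (c * fine (laplace phi s) @[s --> 0^'+])).
      apply: near_eq_cvg; near=> s.
      have s0 : 0 < s by near: s; exact: nbhs_right_gt.
      by rewrite LE fineM// phi_fin.
    exact: gt0_cvgMry c0 phi_cvgy.
  - apply: cvg_trans fc; apply: near_eq_cvg; near=> t.
    rewrite /phi indicE mem_set/= ?mul1r// in_itv/= andbT.
    by near: t; exact: nbhs_pinfty_ge.
rewrite -[X in _ --> X]mulr1; apply: cvg_trans (cvgM main phi_asymp).
apply: near_eq_cvg; near=> s.
have s0 : 0 < s by near: s; exact: nbhs_right_gt.
have s1 : s < 1 by near: s; exact: nbhs_right_lt.
have L0 : 0 < ln s^-1 by near: s; move/cvgryPgt : lnV_cvgy; apply.
have F0 : 0 < fine (laplace phi s) by near: s; move/cvgryPgt : phi_cvgy; apply.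
rewrite /= LE fineM ?phi_fin//=.
by field; rewrite !gt_eqF.
Unshelve. all: by end_near. Qed.

End abelian_logarithm.

Section integrable_tail.
Context {R : realType}.
Local Notation mu := (@lebesgue_measure R).

Lemma laplace0_lty (f : R -> R) (c y : R) : measurable_fun [set: R] f ->
  (forall t, 0 <= t -> 0 <= f t) -> laplace f 1 \is a fin_num -> 0 < c -> y < 0 ->
  f t / (c * t `^ (y - 1)) @[t --> +oo] --> (1 : R) ->
  (laplace f 0 < +oo)%E.
Proof.
move=> mf f0 ff c0 y0 /cvgrPdist_lt /(_ _ ltr01)[T0 [_ HT0]].
pose g t : R := \1_(`[1, +oo[%classic : set R) t * t `^ (y - 1).
have mg : measurable_fun [set: R] g.
  by apply: measurable_funM => //; exact: measurable_powR.
have g0 t : 0 <= g t by rewrite mulr_ge0// powR_ge0.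
pose T := Num.max (T0 + 1) 1.
have fg t : T <= t -> f t <= 2 * c * g t.
  rewrite ge_max => /andP[T0t t1]; have t0 : 0 < t by exact: lt_le_trans t1.
  have /HT0 : T0 < t by rewrite (lt_le_trans _ T0t)// ltrDl.
  rewrite ltr_distlC => /andP[_]; rewrite ltr_pdivrMr ?mulr_gt0 ?powR_gt0//.
  rewrite /g indicE mem_set/= ?in_itv/= ?t1// mul1r => /ltW /le_trans; apply.
  by rewrite mulrA ler_wpM2r ?powR_ge0// ler_wpM2r ?(ltW c0)//.
have c20 : 0 <= 2 * c by rewrite mulr_ge0// ltW.
have := laplace_le_tail mf mg f0 (fun t _ => g0 t) c20 fg (lexx 0).
move=> /le_lt_trans; apply; rewrite lte_add_pinfty//.
  apply: (le_lt_trans (integral_le_laplace _ mf f0)).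
  by rewrite -(fineK ff) -EFinM ltry.
rewrite lte_mul_pinfty ?lee_fin//.
apply: le_lt_trans (ltry (- y)^-1); apply: le_trans (integral_powR_tail y0).
by rewrite /laplace; under eq_integral do rewrite oppr0 mul0r expR0 mul1r.
Qed.

End integrable_tail.

(** * The equation k P(r) = 1 *)

Section laplace_at_zero.
Context {R : realType}.
Local Notation mu := (@lebesgue_measure R).
Variable f : R -> R.
Hypotheses (mf : measurable_fun [set: R] f) (f0 : forall t, 0 <= t -> 0 <= f t).
Hypothesis ff1 : laplace f 1 \is a fin_num.

(** Lower semicontinuity at 0, also when the value there is infinite: some compact [a, b] already
    carries an integral J > c, and e^(-s t) >= 1 - s b on it. *)
Lemma laplace0_gt (c : R) : (c%:E < laplace f 0)%E ->
  exists2 s0, 0 < s0 & forall s, 0 <= s -> s <= s0 -> (c%:E < laplace f s)%E.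
Proof.
have [c0|c0] := ltP c 0.
  move=> _; exists 1 => // s _ _; apply: (@lt_le_trans _ _ 0%E); first by rewrite lte_fin.
  exact: laplace_ge0.
pose f' t := \1_(`[0, +oo[%classic : set R) t * f t.
have mf' : measurable_fun [set: R] f' by exact: measurable_funM.
have f'0 t : 0 <= f' t.
  rewrite /f' indicE; case: (boolP (t \in _)) => [|_]; last by rewrite mul0r.
  by rewrite inE/= in_itv/= andbT mul1r; exact: f0.
have f'E t : 0 <= t -> f' t = f t.
  by move=> t0; rewrite /f' indicE mem_set/= ?mul1r// in_itv/= t0.
have -> : (laplace f 0 = \int[mu]_(t in `[0%R, +oo[) (f' t)%:E)%E.
  apply: eq_integral => t; rewrite inE/= in_itv/= andbT => t0.
  by rewrite oppr0 mul0r expR0 mul1r f'E.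
move=> /ge0_lt_integral_compact[||a [b [a0 ab]]].
- exact/measurable_EFinP.
- by move=> t; rewrite lee_fin.
set J := (\int[mu]_(t in `[a, b]) _)%E => cJ.
have b0 : 0 < b by exact: lt_le_trans ab.
have J0 : (0 <= J)%E by apply: integral_ge0 => t _; rewrite lee_fin.
have Jfin : J \is a fin_num.
  rewrite ge0_fin_numE//; apply: (@le_lt_trans _ _ (\int[mu]_(t in `[0%R, b]) (f' t)%:E)%E).
    apply: ge0_subset_integral => //.
    - by apply: measurable_funTS; apply/measurable_EFinP.
    - by move=> t _; rewrite lee_fin.
    - by apply: subset_itvr; rewrite bnd_simp ltW.
  have -> : (\int[mu]_(t in `[0%R, b]) (f' t)%:E = \int[mu]_(t in `[0%R, b]) (f t)%:E)%E.
    by apply: eq_integral => t; rewrite inE/= in_itv/= => /andP[t0 _]; rewrite f'E.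
  apply: (le_lt_trans (integral_le_laplace _ mf f0)).
  by rewrite -(fineK ff1) -EFinM ltry.
rewrite -(fineK Jfin) lte_fin in cJ; rewrite -(fineK Jfin) lee_fin in J0.
have bJ : 0 < b * fine J + 1 by rewrite ltr_wpDl// mulr_ge0// ltW.
(* For s up to this value (1 - s b) J >= c + s, which exceeds c if s > 0; at s = 0 the claim is J >
   c. The added 1 also keeps the denominator positive. *)
exists ((fine J - c) / (b * fine J + 1)); first by rewrite divr_gt0// subr_gt0.
move=> s s0; rewrite ler_pdivlMr// => sJ.
apply: (@lt_le_trans _ _ ((expR (- s * b))%:E * J)%E).
  rewrite -(fineK Jfin) -EFinM lte_fin.
  apply: (@lt_le_trans _ _ ((1 + - s * b) * fine J)); last first.
    by rewrite ler_wpM2r// expR_ge1Dx.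
  have [->|s1] := eqVneq s 0; first by lra.
  have : 0 < s by rewrite lt_neqAle eq_sym s1.
  lra.
rewrite /J -[leLHS]ge0_integralZl; last 4 first.
- exact: measurable_itv.
- by apply: measurable_funTS; apply/measurable_EFinP.
- by move=> t _; rewrite lee_fin.
- by rewrite lee_fin expR_ge0.
apply: (@le_trans _ _ (\int[mu]_(t in `[a, b]) (expR (- s * t) * f t)%:E)%E).
  apply: ge0_le_integral => //.
  - by move=> t _; rewrite -EFinM lee_fin mulr_ge0 ?expR_ge0.
  - by apply: measurable_funTS; apply: measurable_funeM; apply/measurable_EFinP.
  - by apply: measurable_funTS; exact: measurable_laplace.
  move=> t /=; rewrite in_itv/= => /andP[at_ tb]; have t0 := le_trans (ltW a0) at_.
  rewrite -EFinM lee_fin f'E// ler_wpM2r ?f0// ler_expR !mulNr lerN2 ler_wpM2l//.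
apply: ge0_subset_integral => //.
- by apply: measurable_funTS; exact: measurable_laplace.
- move=> t /=; rewrite in_itv/= andbT => t0.
  by rewrite lee_fin mulr_ge0 ?expR_ge0 ?f0.
- by apply: subset_itv; rewrite bnd_simp// ltW.
Qed.

Lemma laplace_cvg0 : laplace f 0 \is a fin_num ->
  fine (laplace f s) @[s --> 0^'+] --> fine (laplace f 0).
Proof.
move=> f0fin; apply/cvgrPdist_lt => e e0.
have [|s0 s00 H] := @laplace0_gt (fine (laplace f 0) - e).
  by rewrite -[ltRHS]fineK// lte_fin ltrBlDr ltrDl.
near=> s; have s1 : 0 <= s by near: s; exact: nbhs_right_ge.
have le0 : (laplace f s <= laplace f 0)%E by exact: le_laplace2.
have fs : laplace f s \is a fin_num.
  rewrite ge0_fin_numE ?laplace_ge0//; apply: (le_lt_trans le0).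
  by rewrite -(fineK f0fin) ltry.
have : ((fine (laplace f 0) - e)%:E < laplace f s)%E.
  by apply: H => //; near: s; exact: nbhs_right_le.
rewrite -(fineK fs) lte_fin => h1.
have h2 := fine_le fs f0fin le0.
move: (fine (laplace f s)) (fine (laplace f 0)) h1 h2 => x y h1 h2.
by rewrite ger0_norm ?subr_ge0// ltrBlDl -ltrBlDr.
Unshelve. all: by end_near. Qed.

End laplace_at_zero.

Section root.
Context {R : realType}.
Variables (p r : R -> R) (b c1 : R).
Hypotheses (mp : measurable_fun [set: R] p) (p0 : forall t, 0 <= t -> 0 <= p t).
Hypotheses (p1 : forall t, 0 <= t -> p t <= 1).
Hypotheses (b0 : 0 < b) (c10 : 0 < c1) (pc : forall t, 0 < t -> t <= b -> c1 <= p t).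
Hypothesis r1 : forall k, 0 < k -> 0 <= r k <= k.
Hypothesis rU : forall k s, 0 < k -> 0 < s -> (k%:E * laplace p s < 1)%E -> r k <= s.
Hypothesis rL : forall k s, 0 < k -> 0 < s -> (1 < k%:E * laplace p s)%E -> s <= r k.

Local Notation P := (fun s => fine (laplace p s)).
Local Notation K := (fine (laplace p 0)^-1).

Let pfin s : 0 < s -> laplace p s \is a fin_num.
Proof. exact: laplace_fin_num. Qed.

Lemma fine_laplace_lt s s' : 0 < s -> s < s' -> P s' < P s.
Proof.
move=> s0 ss'; rewrite -lte_fin (fineK (pfin s0)) (fineK (pfin (lt_trans s0 ss'))).
apply: (@laplace_lt _ _ 1 0 _ _ b c1) => //; last exact: ltW.
by move=> t t0; rewrite mul0r expR0 mulr1 p1.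
Qed.

Lemma fine_laplace_gt0 s : 0 < s -> 0 < P s.
Proof.
move=> s0; apply: (@le_lt_trans _ _ (P (s + 1))).
  by apply: fine_ge0; exact: laplace_ge0.
by apply: fine_laplace_lt => //; rewrite ltrDl.
Qed.

Lemma fine_laplace_lt0 s g : laplace p 0 = g%:E -> 0 < s -> P s < g.
Proof.
move=> G s0; have s20 : 0 < s / 2 by rewrite divr_gt0.
apply: (@lt_le_trans _ _ (P (s / 2))).
  by apply: fine_laplace_lt => //; lra.
by rewrite -lee_fin fineK ?pfin// -G; apply: le_laplace2 => //; exact: ltW.
Qed.

Lemma laplace0_gt0 : (0 < laplace p 0)%E.
Proof.
apply: (@lt_le_trans _ _ (laplace p 1)); last exact: le_laplace2.
by rewrite -(fineK (pfin ltr01)) lte_fin fine_laplace_gt0.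
Qed.

Let rUr k s : 0 < k -> 0 < s -> k * P s < 1 -> r k <= s.
Proof. by move=> k0 s0 ks; apply: rU => //; rewrite -(fineK (pfin s0)) -EFinM lte_fin. Qed.

Let rLr k s : 0 < k -> 0 < s -> 1 < k * P s -> s <= r k.
Proof. by move=> k0 s0 ks; apply: rL => //; rewrite -(fineK (pfin s0)) -EFinM lte_fin. Qed.

Lemma kcr_ge0 : 0 <= K.
Proof. by apply: fine_ge0; rewrite inve_ge0 ltW// laplace0_gt0. Qed.

Lemma kcr_fin g : laplace p 0 = g%:E -> K = g^-1 /\ 0 < g.
Proof.
move=> G; have := laplace0_gt0; rewrite G lte_fin => g0; split => //.
by rewrite inver gt_eqF.
Qed.

Lemma kcr_infty : laplace p 0 = +oo%E -> K = 0.
Proof. by move=> ->; rewrite invey. Qed.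

Lemma laplace0_cases : (exists g, laplace p 0 = g%:E) \/ laplace p 0 = +oo%E.
Proof.
have := laplace0_gt0; case: (laplace p 0) => [g| |] //; [left|right] => //.
by exists g.
Qed.

Lemma kcr_lt k : 0 < k -> K < k -> ((k^-1)%:E < laplace p 0)%E.
Proof.
move=> k0; have [[g E]|E] := laplace0_cases; last by rewrite E ltry.
have [-> g0] := kcr_fin E; rewrite E lte_fin => gk.
by rewrite -[ltRHS]invrK ltf_pV2 ?posrE ?invr_gt0.
Qed.

Lemma root_gt0 k : 0 < k -> K < k -> 0 < r k.
Proof.
move=> k0 /(kcr_lt k0)/(laplace0_gt mp p0 (pfin ltr01))[s0 s00 /(_ s0 (ltW s00) (lexx _))].
rewrite -(fineK (pfin s00)) lte_fin => kP; apply: (lt_le_trans s00).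
by apply: rLr => //; rewrite -ltr_pdivrMl// mulr1.
Qed.

Lemma root_eq0 k : 0 < k -> k <= K -> r k = 0.
Proof.
move=> k0 kK; apply/eqP; rewrite eq_le (andP (r1 k0)).1 andbT.
apply/ler_addgt0Pr => s s0; rewrite add0r; apply: rUr => //.
have [[g E]|E] := laplace0_cases.
  have [KE g0] := kcr_fin E; rewrite KE in kK.
  apply: (@lt_le_trans _ _ (k * g)); last by rewrite -ler_pdivlMr// mul1r.
  by rewrite ltr_pM2l//; exact: fine_laplace_lt0 E s0.
by move: kK; rewrite (kcr_infty E) leNgt k0.
Qed.

Lemma fine_laplace_continuous s : 0 < s -> {for s, continuous P}.
Proof.
move=> s0; apply: differentiable_continuous; apply/derivable1_diffP.
have d := is_derive_laplace mp p0 p1 s0.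
by apply: ex_derive.
Qed.

(** If k P(r k) > 1, continuity gives k P(s) > 1 for some s above r k, against [rL]; if k P(r k) <
    1, some positive s below r k contradicts [rU]. *)
Lemma rootP k : K < k -> k * P (r k) = 1.
Proof.
move=> Kk; have k0 : 0 < k by exact: le_lt_trans kcr_ge0 Kk.
have rk0 := root_gt0 k0 Kk.
have ck : (k * P s) @[s --> r k] --> k * P (r k).
  by apply: cvgM; [exact: cvg_cst|exact: fine_laplace_continuous].
apply/eqP; rewrite eq_le; apply/andP; split; rewrite leNgt; apply/negP => h.
  have : \forall s \near (r k)^'+, 1 < k * P s.
    by apply: cvg_within; exact: (cvgr_gt _ ck).
  move=> H; near (r k)^'+ => s.
  have rs : r k < s by near: s; exact: nbhs_right_gt.
  have ks : 1 < k * P s by near: s; exact: H.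
  by have := rLr k0 (lt_trans rk0 rs) ks; rewrite leNgt rs.
have : \forall s \near (r k)^'-, k * P s < 1.
  by apply: cvg_within; exact: (cvgr_lt _ ck).
move=> H; near (r k)^'- => s.
have sr : s < r k by near: s; exact: nbhs_left_lt.
have s0 : 0 < s by near: s; exact: nbhs_left_gt.
have ks : k * P s < 1 by near: s; exact: H.
by have := rUr k0 s0 ks; rewrite leNgt sr.
Unshelve. all: by end_near. Qed.

(** For a fixed s > 0, r k <= s as soon as k < 1/P(s), and 1/P(s) > K. The target is the filter of
    right neighbourhoods of 0, so that limits of P(s) as s decreases to 0 can be composed with r. *)
Lemma root_cvg0 : r k @[k --> K^'+] --> 0^'+.
Proof.
move=> A [e /= e0 eA]; have e20 : 0 < e / 2 by rewrite divr_gt0.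
suff : \forall k \near K^'+, A (r k) by [].
near=> k.
have Kk : K < k by near: k; exact: nbhs_right_gt.
have k0 : 0 < k by exact: le_lt_trans kcr_ge0 Kk.
have rk0 := root_gt0 k0 Kk.
apply: eA => //=; rewrite sub0r normrN gtr0_norm//.
apply: (@le_lt_trans _ _ (e / 2)); last by lra.
apply: rUr => //; rewrite -ltr_pdivlMr ?fine_laplace_gt0// mul1r.
near: k; apply: nbhs_right_lt.
have [[g E]|E] := laplace0_cases.
  have [KE g0] := kcr_fin E; rewrite KE ltf_pV2 ?posrE ?fine_laplace_gt0//.
  exact: fine_laplace_lt0 E e20.
by rewrite (kcr_infty E) invr_gt0 fine_laplace_gt0.
Unshelve. all: by end_near. Qed.

End root.

(** * From asymptotics of P to asymptotics of r *)

Lemma asymp_powR_root (R : realType) (F : set_system R) {FF : ProperFilter F}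
    (u v : R -> R) (y : R) : 0 < y ->
  (\forall k \near F, 0 <= u k /\ 0 < v k) ->
  v k / u k `^ y @[k --> F] --> (1 : R) ->
  u k / v k `^ y^-1 @[k --> F] --> (1 : R).
Proof.
move=> y0 uv H.
have H1 : (v k / u k `^ y)^-1 @[k --> F] --> (1 : R).
  by rewrite -[X in _ --> X]invr1; apply: cvgV => //; exact: oner_neq0.
have H2 : ((v k / u k `^ y)^-1) `^ y^-1 @[k --> F] --> (1 : R).
  rewrite (_ : 1 = 1 `^ y^-1 :> R); last by rewrite powR1.
  apply: (@cvg_comp _ _ _ (fun k => (v k / u k `^ y)^-1) (fun x => x `^ y^-1) _ _ _ H1).
  by apply: continuous_powRr; exact: ltr01.
apply: cvg_trans H2; apply: near_eq_cvg; apply: filterS uv => k [u0 v0].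
rewrite invf_div powRM ?powR_ge0// ?invr_ge0 ?(ltW v0)//.
rewrite -powRrM divff ?gt_eqF// powRr1//; congr (_ * _).
by rewrite -(powR_inv1 (ltW v0)) -powRrM mulN1r powRN.
Qed.

Lemma cvgy_asymp (R : realType) (F : set_system R) {FF : ProperFilter F}
    (u v : R -> R) :
  v k @[k --> F] --> +oo -> u k / v k @[k --> F] --> (1 : R) ->
  u k @[k --> F] --> +oo.
Proof.
move=> vy uv; apply/cvgryPge => A.
have vA : \forall k \near F, 2 * `|A| + 1 <= v k by move/cvgryPge : vy; apply.
move/cvgrPdist_lt : uv => /(_ 2^-1); rewrite invr_gt0 ltr0n => /(_ isT).
apply: filterS2 vA => k vA; have A0 := normr_ge0 A.
have v0 : 0 < v k by apply: lt_le_trans vA; rewrite ltr_wpDl// mulr_ge0.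
rewrite ltr_distlC => /andP[+ _]; rewrite ltr_pdivlMr//.
by move: (u k) (v k) vA v0 => x z h1 g0 h2; have := ler_norm A; lra.
Qed.

Lemma ln_le_sqrt (R : realType) (x : R) : 0 < x -> ln x <= 2 * x `^ 2^-1.
Proof.
move=> x0; have := ln_sublinear (powR_gt0 2^-1 x0); rewrite ln_powR.
by move: (ln x) (x `^ _) => u v; lra.
Qed.

Lemma ln_div_cvg0 (R : realType) : ln x / x @[x --> +oo] --> (0 : R).
Proof.
apply/cvgrPdist_le => e e0; near=> x.
have x1 : 1 <= x by near: x; apply: nbhs_pinfty_ge; exact: num_real.
have x0 : 0 < x by exact: lt_le_trans x1.
pose q := x `^ 2^-1; have q0 : 0 < q by exact: powR_gt0.
have sq : x = q * q.
  rewrite /q -powRD; last by apply/implyP => _; rewrite gt_eqF.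
  by rewrite -[2^-1]mul1r -splitr powRr1// ltW.
have qe : 2 / e <= q.
  rewrite -(@ler_pXn2r _ 2) ?nnegrE ?(ltW q0) ?divr_ge0 ?(ltW e0)//.
  by rewrite [leRHS]expr2 -sq; near: x; apply: nbhs_pinfty_ge; exact: num_real.
rewrite sub0r normrN ger0_norm; last by rewrite divr_ge0 ?ln_ge0 ?(ltW x0).
rewrite ler_pdivrMr//; apply: (le_trans (ln_le_sqrt x0)).
by rewrite -/q sq mulrA ler_wpM2r ?(ltW q0)// mulrC -ler_pdivrMr.
Unshelve. all: by end_near. Qed.

Lemma ln_cvg0 (R : realType) (F : set_system R) {FF : ProperFilter F} (u : R -> R) :
  u k @[k --> F] --> (1 : R) -> ln (u k) @[k --> F] --> (0 : R).
Proof.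
by move=> u1; rewrite -(@ln1 R); exact: (cvg_comp _ _ u1 (continuous_ln ltr01)).
Qed.

Section growth_rate_asymptotics.
Context {R : realType}.
Local Notation mu := (@lebesgue_measure R).
Variables (p r : R -> R) (b c1 : R).
Hypotheses (mp : measurable_fun [set: R] p) (p0 : forall t, 0 <= t -> 0 <= p t).
Hypotheses (p1 : forall t, 0 <= t -> p t <= 1).
Hypotheses (b0 : 0 < b) (c10 : 0 < c1) (pc : forall t, 0 < t -> t <= b -> c1 <= p t).
Hypothesis pcvg1 : p t @[t --> 0^'+] --> (1 : R).
Hypothesis r1 : forall k, 0 < k -> 0 <= r k <= k.
Hypothesis rU : forall k s, 0 < k -> 0 < s -> (k%:E * laplace p s < 1)%E -> r k <= s.
Hypothesis rL : forall k s, 0 < k -> 0 < s -> (1 < k%:E * laplace p s)%E -> s <= r k.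

Local Notation P := (fun s => fine (laplace p s)).
Local Notation K := (fine (laplace p 0)^-1).

Let pfin s : 0 < s -> laplace p s \is a fin_num.
Proof. exact: laplace_fin_num. Qed.

Let Kroot k : K < k -> [/\ 0 < k, 0 < r k & P (r k) = k^-1].
Proof.
move=> Kk; have k0 : 0 < k by exact: le_lt_trans (kcr_ge0 mp p0 p1 b0 c10 pc) Kk.
split => //; first exact: (root_gt0 mp p0 p1 b0 c10 pc rL k0 Kk).
have /(congr1 (fun x => k^-1 * x)) := rootP mp p0 p1 b0 c10 pc rU rL Kk.
by rewrite mulr1 mulrA mulVf ?gt_eqF// mul1r.
Qed.

(** Right-continuity gives p >= 1 - d/2 on ]0, h], hence P(s) >= (1 - d/2) (1 - e^(-s h)) / s. At s
    = (1 - d) k with k large this exceeds 1/k, so r k >= (1 - d) k; the other half is r k <= k. *)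
Lemma growth_rate_div_cvg1 : r k / k @[k --> +oo] --> (1 : R).
Proof.
apply/cvgrPdist_le => e e0.
pose d := Num.min e 2^-1.
have d0 : 0 < d by rewrite lt_min e0 invr_gt0 ltr0n.
have d1 : d < 1 by rewrite gt_min; apply/orP; right; lra.
have de : d <= e by rewrite ge_min lexx.
have d20 : 0 < d / 2 by rewrite divr_gt0.
have [z /= z0 hz] : \forall t \near 0^'+, 1 - d / 2 <= p t.
  move/cvgrPdist_le : pcvg1 => /(_ _ d20); apply: filterS => t.
  by rewrite ler_distl => /andP[_ ?]; rewrite lerBlDr.
have pz t : 0 < t -> t < z -> 1 - d / 2 <= p t.
  by move=> t0 tz; apply: hz => //=; rewrite sub0r normrN gtr0_norm.
pose h := z / 2; have h0 : 0 < h by rewrite divr_gt0.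
have hz2 : h < z by rewrite ltr_pdivrMr// mulr2n mulrDr !mulr1 ltrDl.
have PB s : 0 < s -> (1 - d / 2) * (1 - expR (- s * h)) / s <= P s.
  move=> s0; rewrite -lee_fin fineK ?pfin//.
  apply: (@le_trans _ _ (\int[mu]_(t in `[0%R, h]) ((1 - d / 2) * expR (- s * t))%:E)%E).
    have dF (t : R) : 0 <= t <= h -> is_derive t (1 : R)
        (fun t => - ((1 - d / 2) / s) * expR (- s * t)) ((1 - d / 2) * expR (- s * t)).
      move=> _; apply: is_derive_eq.
      rewrite /GRing.scale/= !(mulr0, mulr1, addr0, add0r).
      by field; rewrite gt_eqF.
    have cf (t : R) : 0 <= t <= h ->
        {for t, continuous (fun t => (1 - d / 2) * expR (- s * t))}.
      move=> _; apply: differentiable_continuous; apply/derivable1_diffP.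
      exact: ex_derive.
    rewrite (integral_itvcc_derive h0 dF cf) lee_fin mulr0 expR0.
    rewrite le_eqVlt; apply/orP; left; apply/eqP; ring.
  apply: (@le_trans _ _ (\int[mu]_(t in `[0%R, h]) (expR (- s * t) * p t)%:E)%E).
    have mE : measurable_fun [set: R] (fun t => ((1 - d / 2) * expR (- s * t))%:E).
      by apply/measurable_EFinP/measurable_funM => //; exact: measurable_expRM.
    (* The lower bound on [p] is known at positive times only, so the endpoint 0 is dropped. *)
    rewrite -integral_itv_obnd_cbnd; last by apply: measurable_funTS; exact: mE.
    rewrite -[leRHS]integral_itv_obnd_cbnd; last first.
      by apply: measurable_funTS; exact: measurable_laplace.
    apply: ge0_le_integral => //.
    - by move=> t _; rewrite lee_fin mulr_ge0 ?expR_ge0//; lra.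
    - by apply: measurable_funTS; exact: mE.
    - by apply: measurable_funTS; exact: measurable_laplace.
    move=> t /=; rewrite in_itv/= => /andP[t0 th]; rewrite lee_fin mulrC.
    by rewrite ler_wpM2l ?expR_ge0// pz// (le_lt_trans th).
  apply: ge0_subset_integral => //.
  - by apply: measurable_funTS; exact: measurable_laplace.
  - move=> t /=; rewrite in_itv/= andbT => t0.
    by rewrite lee_fin mulr_ge0 ?expR_ge0 ?p0.
  - exact: subset_itvl.
near=> k.
have k0 : 0 < k by near: k; exact: nbhs_pinfty_gt.
have d1k : 0 < (1 - d) * k by rewrite mulr_gt0// subr_gt0.
have Ek : expR (- ((1 - d) * k) * h) < d / 2.
  rewrite -[ltRHS]lnK ?posrE// ltr_expR mulNr ltrNl -ltr_pdivrMr// -ltr_pdivrMl ?subr_gt0//.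
  by near: k; apply: nbhs_pinfty_gt; exact: num_real.
have /andP[r0 rk] := r1 k0.
have kr : (1 - d) * k <= r k.
  apply: rL => //; rewrite -(fineK (pfin d1k)) -EFinM lte_fin.
  have := PB _ d1k; rewrite ler_pdivrMr// => PBk.
  move: (P _) (expR _) Ek PBk => x y Ek PBk.
  (* Since y < d/2, the right side is at least (1 - d/2)^2 = 1 - d + d^2/4. *)
  have h1 : 1 - d < (1 - d / 2) * (1 - y).
    have : (1 - d / 2) * (1 - d / 2) <= (1 - d / 2) * (1 - y).
      by rewrite ler_wpM2l; lra.
    have : 0 < (d / 2) * (d / 2) by rewrite mulr_gt0.
    lra.
  have d10 : 0 < 1 - d by rewrite subr_gt0.
  rewrite -(ltr_pM2l d10) mulr1; apply: (lt_le_trans h1); apply: (le_trans PBk).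
  by rewrite le_eqVlt; apply/orP; left; apply/eqP; ring.
rewrite ger0_norm; last by rewrite subr_ge0 ler_pdivrMr// mul1r.
rewrite lerBlDr -lerBlDl ler_pdivlMr//; apply: le_trans kr.
by rewrite ler_wpM2r ?(ltW k0)// lerB.
Unshelve. all: by end_near. Qed.

Lemma kcr_eq0 : P s @[s --> 0^'+] --> +oo -> K = 0.
Proof.
move=> Py; have [[g E]|] := laplace0_cases mp p0 p1 b0 c10 pc; last exact: kcr_infty.
have : \forall s \near 0^'+, g <= P s by move/cvgryPge : Py; apply.
move=> H; near (0 : R)^'+ => s.
have s0 : 0 < s by near: s; exact: nbhs_right_gt.
have gP : g <= P s by near: s; exact: H.
by have := fine_laplace_lt0 mp p0 p1 b0 c10 pc E s0; rewrite ltNge gP.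
Unshelve. all: by end_near. Qed.

Variables (c alpha : R).
Hypotheses (c0 : 0 < c).
Hypothesis p_asymp : p t / (c * t `^ (- alpha)) @[t --> +oo] --> (1 : R).

Let rcvg := root_cvg0 mp p0 p1 b0 c10 pc rU rL.

(** Putting s = r k in the Abelian equivalent of P and using P(r k) = 1/k gives k c Gamma(y) ~ (r
    k)^y with y = 1 - alpha; then take the root. *)
Lemma growth_rate_alpha_lt1 : 0 < alpha < 1 -> K = 0 /\
  (r k / (k `^ (1 - alpha)^-1 * (c * Gamma (1 - alpha)) `^ (1 - alpha)^-1))
    @[k --> 0^'+] --> (1 : R).
Proof.
move=> /andP[a0 a1]; pose y := 1 - alpha.
have y01 : 0 < y < 1 by rewrite /y; apply/andP; split; lra.
have y0 : 0 < y by case/andP: y01.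
have cG : 0 < c * Gamma y by rewrite mulr_gt0// Gamma_gt0.
have Pa : P s / (c * Gamma y * s `^ (- y)) @[s --> 0^'+] --> (1 : R).
  apply: abelian_powR => //.
  by rewrite (_ : y - 1 = - alpha)//; rewrite /y; ring.
have K0 : K = 0.
  by apply: kcr_eq0; apply: cvgy_asymp Pa; exact: gt0_cvgMry cG (powRN_cvgy y0).
split => //; have := rcvg; rewrite K0 => rcvg0.
have H : (k * (c * Gamma y)) / r k `^ y @[k --> 0^'+] --> (1 : R).
  have := cvg_comp _ _ rcvg0 Pa => H.
  have : (P (r k) / (c * Gamma y * r k `^ (- y)))^-1 @[k --> 0^'+] --> (1 : R).
    by rewrite -[X in _ --> X]invr1; apply: cvgV => //; exact: oner_neq0.
  apply: cvg_trans; apply: near_eq_cvg; near=> k.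
  have [|k0 r0 ->] := @Kroot k; first by rewrite K0; near: k; exact: nbhs_right_gt.
  rewrite powRN invf_div invrK; ring.
have uv : \forall k \near 0^'+, 0 <= r k /\ 0 < k * (c * Gamma y).
  near=> k; have [|k0 r0 _] := @Kroot k; first by rewrite K0; near: k; exact: nbhs_right_gt.
  by split; [exact: ltW|rewrite mulr_gt0].
apply: cvg_trans (asymp_powR_root y0 uv H); apply: near_eq_cvg.
near=> k; have k0 : 0 < k by near: k; exact: nbhs_right_gt.
by rewrite powRM// ltW.
Unshelve. all: by end_near. Qed.

Lemma growth_rate_alpha_eq1 : alpha = 1 -> K = 0 /\
  exists e : R -> R, e =o_ (0^'+) (fun k : R => k^-1) /\
    \forall k \near 0^'+, r k = expR (- (c * k)^-1 + e k).
Proof.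
move=> a1.
have Pa : P s / (c * ln s^-1) @[s --> 0^'+] --> (1 : R).
  by apply: abelian_ln => //; have := p_asymp; rewrite a1.
have K0 : K = 0.
  by apply: kcr_eq0; apply: cvgy_asymp Pa; exact: gt0_cvgMry c0 (@lnV_cvgy R).
split => //; have := rcvg; rewrite K0 => rcvg0.
(* Whatever separates ln(r k) from -1/(c k) is taken as the error. Then c k e(k) = 1 - c k ln(1/r
   k), which tends to 0 because 1/k = P(r k) ~ c ln(1/r k). *)
exists (fun k => ln (r k) + (c * k)^-1); split; last first.
  near=> k; have [|k0 r0 _] := @Kroot k; first by rewrite K0; near: k; exact: nbhs_right_gt.
  by rewrite addrC addrK lnK.
apply/eqoP => e e0.
have H := cvg_comp _ _ rcvg0 Pa.
have H1 : (P (r k) / (c * ln (r k)^-1))^-1 @[k --> 0^'+] --> (1 : R).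
  by rewrite -[X in _ --> X]invr1; apply: cvgV => //; exact: oner_neq0.
move/cvgrPdist_le : H1 => /(_ (e * c)); rewrite mulr_gt0// => /(_ isT) H1.
near=> k.
have [|k0 r0 Pk] := @Kroot k; first by rewrite K0; near: k; exact: nbhs_right_gt.
have : `|1 - (P (r k) / (c * ln (r k)^-1))^-1| <= e * c by near: k; exact: H1.
rewrite Pk invf_div invrK lnV ?posrE// => h.
rewrite [`|k^-1|]gtr0_norm ?invr_gt0// ler_pdivlMr// -[X in _ * X](gtr0_norm k0).
rewrite -normrM -(ler_pM2r c0) -[X in _ * X <= _](gtr0_norm c0) -normrM.
apply: le_trans h; rewrite le_eqVlt; apply/orP; left; apply/eqP; congr `|_|.
by field; rewrite !gt_eqF.
Unshelve. all: by end_near. Qed.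

Section alpha_gt1.
Hypothesis a1 : 1 < alpha.

Lemma laplace0_fin_num : laplace p 0 \is a fin_num.
Proof.
rewrite ge0_fin_numE ?laplace_ge0//.
apply: (@laplace0_lty _ p c (1 - alpha)) => //; first exact: pfin.
  by rewrite subr_lt0.
by rewrite (_ : 1 - alpha - 1 = - alpha)//; ring.
Qed.

Local Notation g := (fine (laplace p 0)).

Let gE : laplace p 0 = g%:E. Proof. by rewrite fineK// laplace0_fin_num. Qed.

Let g0 : 0 < g.
Proof. by have [] := kcr_fin mp p0 p1 b0 c10 pc gE. Qed.

Let KE : K = g^-1.
Proof. by have [] := kcr_fin mp p0 p1 b0 c10 pc gE. Qed.

Lemma kcr_gt0 : 0 < K.
Proof. by rewrite KE invr_gt0. Qed.

(** Since K = 1/g and k = 1/P(r k), one has (k - K) g^2 = (g - P(r k)) g / P(r k), and the last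
    quotient tends to 1. As -P' is the transform of t p(t), l'Hopital gives g - P ~ Phi as soon as
    Phi' is equivalent to that transform. [Phi] is left free because each regime of alpha > 1 has
    its own. *)
Lemma excess_asymp (Phi dPhi : R -> R) (d : R) : 0 < d ->
  (forall s, 0 < s -> s < d -> is_derive s 1 Phi (dPhi s)) ->
  (forall s, 0 < s -> s < d -> dPhi s != 0) ->
  Phi s @[s --> 0^'+] --> (0 : R) ->
  fine (laplace (fun t => t * p t) s) / dPhi s @[s --> 0^'+] --> (1 : R) ->
  (k - K) * g ^+ 2 / Phi (r k) @[k --> K^'+] --> (1 : R).
Proof.
move=> d0 dP dP0 P0 H.
have Pg := laplace_cvg0 mp p0 (pfin ltr01) laplace0_fin_num.
have D : (g - P s) / Phi s @[s --> 0^'+] --> (1 : R).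
  apply: (@lhopital_at_right _ _ (fun s => fine (laplace (fun t => t * p t) s))
     _ dPhi _ d) => //.
  - move=> s; rewrite in_itv/= => /andP[s0 sd].
    have ds := is_derive_laplace mp p0 p1 s0.
    apply: is_derive_eq.
    by rewrite add0r mul1r opprK.
  - by move=> s; rewrite in_itv/= => /andP[s0 sd]; exact: dP.
  - rewrite -[X in _ --> X](subrr g); exact: (cvgB (cvg_cst _) Pg).
  - by move=> s; rewrite in_itv/= => /andP[s0 sd]; exact: dP0.
have gP : g / P s @[s --> 0^'+] --> (1 : R).
  rewrite -(@divff _ g) ?gt_eqF//; apply: cvgM; first exact: cvg_cst.
  by apply: cvgV => //; rewrite gt_eqF.
rewrite -[X in _ --> X]mulr1; apply: cvg_trans (cvg_comp _ _ rcvg (cvgM D gP)).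
apply: near_eq_cvg; near=> k.
have [|k0 r0 Pk] := @Kroot k; first by near: k; exact: nbhs_right_gt.
rewrite /= Pk KE.
rewrite invrK; have gn0 : g != 0 by rewrite gt_eqF.
have kn0 : k != 0 by rewrite gt_eqF.
move: (Phi _)^-1 gn0 => X; move: g => G gn0.
by field; rewrite gn0 kn0.
Unshelve. all: by end_near. Qed.

Let f t := t * p t.

Let mf : measurable_fun [set: R] f. Proof. exact: measurable_funM. Qed.

Let f0 t : 0 <= t -> 0 <= f t.
Proof. by move=> t0; rewrite mulr_ge0 ?p0. Qed.

Let ffin s : 0 < s -> laplace f s \is a fin_num.
Proof. exact: laplaceM_fin_num. Qed.

Let f_asymp : f t / (c * t `^ (1 - alpha)) @[t --> +oo] --> (1 : R).
Proof.
apply: cvg_trans p_asymp; apply: near_eq_cvg; near=> t.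
have t0 : 0 < t by near: t; exact: nbhs_pinfty_gt.
rewrite /f powRD; last by apply/implyP => _; rewrite gt_eqF.
rewrite powRr1 ?(ltW t0)//.
have : t `^ (- alpha) != 0 by rewrite gt_eqF// powR_gt0.
have : t != 0 by rewrite gt_eqF.
have : c != 0 by rewrite gt_eqF.
move: (t `^ _) (p t) => x z cn tn xn.
by field; rewrite cn tn xn.
Unshelve. all: by end_near. Qed.

Lemma growth_rate_alpha_lt2 : alpha < 2 ->
  r k / ((k - K) `^ (alpha - 1)^-1
    * (g ^+ 2 * (alpha - 1) / (c * Gamma (2 - alpha))) `^ (alpha - 1)^-1)
  @[k --> K^'+] --> (1 : R).
Proof.
move=> a2; pose y := alpha - 1.
have y0 : 0 < y by rewrite subr_gt0.
have y1 : y < 1 by rewrite /y ltrBlDr.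
have y01 : 0 < 1 - y < 1 by rewrite subr_gt0 y1/= ltrBlDr ltrDl.
have -> : 2 - alpha = 1 - y by rewrite /y; ring.
have [Gm GmE] : exists Gm, Gm = Gamma (1 - y) by exists (Gamma (1 - y)).
have Gm0 : 0 < Gm by rewrite GmE Gamma_gt0.
rewrite -GmE.
have cG : 0 < c * Gm by rewrite mulr_gt0.
have Pa : fine (laplace f s) / (c * Gm * s `^ (y - 1)) @[s --> 0^'+] --> (1 : R).
  rewrite GmE -[y - 1]opprB; apply: (abelian_powR mf f0 ffin c0 y01).
  by rewrite (_ : 1 - y - 1 = 1 - alpha)//; rewrite /y; ring.
(* [Phi] is the primitive, vanishing at 0, of the equivalent just found for the transform of t
   p(t). *)
have H := @excess_asymp (fun s => c * Gm / y * s `^ y)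
  (fun s => c * Gm * s `^ (y - 1)) 1 ltr01 _ _ _ Pa.
have {}H : (k - K) * g ^+ 2 / (c * Gm / y * r k `^ y) @[k --> K^'+] --> (1 : R).
  apply: H.
  - move=> s s0 _; have d := is_derive_powR y s0; apply: is_derive_eq.
    rewrite /GRing.scale/=; field; by rewrite gt_eqF.
  - by move=> s s0 _; rewrite mulf_neq0// gt_eqF// powR_gt0.
  - rewrite -[X in _ --> X](mulr0 (c * Gm / y)).
    exact: (cvgM (cvg_cst _) (powR_cvg0 y0)).
have {}H : (k - K) * (g ^+ 2 * y / (c * Gm)) / r k `^ y @[k --> K^'+] --> (1 : R).
  apply: cvg_trans H; apply: near_eq_cvg; near=> k.
  have [|k0 r0 Pk] := @Kroot k; first by near: k; exact: nbhs_right_gt.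
  have : r k `^ y != 0 by rewrite gt_eqF// powR_gt0.
  have : y != 0 by rewrite gt_eqF.
  have : Gm != 0 by rewrite gt_eqF.
  have : c != 0 by rewrite gt_eqF.
  move: (r k `^ y) (k - K) => x z cn Gn yn xn; move: g => G.
  by field; rewrite cn Gn yn xn.
have M0 : 0 < g ^+ 2 * y / (c * Gm) by rewrite divr_gt0// mulr_gt0// exprn_gt0.
have uv : \forall k \near K^'+, 0 <= r k /\ 0 < (k - K) * (g ^+ 2 * y / (c * Gm)).
  near=> k; have Kk : K < k by near: k; exact: nbhs_right_gt.
  have [k0 r0 _] := Kroot Kk.
  by split; [exact: ltW|apply: mulr_gt0 => //; rewrite subr_gt0].
apply: cvg_trans (asymp_powR_root y0 uv H); apply: near_eq_cvg.
near=> k; have Kk : K < k by near: k; exact: nbhs_right_gt.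
by rewrite powRM// ?(ltW M0)// subr_ge0 ltW.
Unshelve. all: by end_near. Qed.

(** Here t p(t) is integrable, so its transform has a finite positive limit at 0 and [Phi] is linear
    with that slope. *)
Lemma growth_rate_alpha_gt2 : 2 < alpha ->
  r k / ((k - K) * (g ^+ 2 / fine (laplace f 0))) @[k --> K^'+] --> (1 : R).
Proof.
move=> a2.
have ff0 : laplace f 0 \is a fin_num.
  rewrite ge0_fin_numE ?laplace_ge0//.
  apply: (@laplace0_lty _ f c (2 - alpha)) => //; first exact: ffin.
    by rewrite subr_lt0.
  by rewrite (_ : 2 - alpha - 1 = 1 - alpha)//; ring.
have Hcvg := laplace_cvg0 mf f0 (ffin ltr01) ff0.
have H0 : 0 < fine (laplace f 0).
  rewrite -lte_fin fineK//.
  have b20 : 0 < b / 2 by rewrite divr_gt0.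
  have b2b : b / 2 < b by rewrite [ltRHS]splitr ltrDl.
  apply: (@lt_le_trans _ _ (\int[mu]_(t in `[(b / 2)%R, b]) (b / 2 * c1)%:E)%E).
    rewrite integral_cst//= lebesgue_measure_itv/= lte_fin b2b -EFinB -EFinM lte_fin.
    by apply: mulr_gt0; [exact: mulr_gt0|rewrite subr_gt0].
  apply: (@le_trans _ _ (\int[mu]_(t in `[(b / 2)%R, b]) (expR (- 0 * t) * f t)%:E)%E).
    apply: ge0_le_integral => //.
    - by move=> t _; rewrite lee_fin mulr_ge0// ltW.
    - by apply: measurable_funTS; exact: measurable_laplace.
    move=> t /=; rewrite in_itv/= => /andP[bt tb].
    rewrite lee_fin oppr0 mul0r expR0 mul1r /f; apply: ler_pM => //.
    - exact: ltW.
    - exact: ltW.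
    - by apply: pc => //; exact: lt_le_trans bt.
  apply: ge0_subset_integral => //.
  - by apply: measurable_funTS; exact: measurable_laplace.
  - move=> t /=; rewrite in_itv/= andbT => t0.
    by rewrite lee_fin mulr_ge0 ?expR_ge0 ?f0.
  - by apply: subset_itv; rewrite bnd_simp// ltW.
have [h hE] : exists h, h = fine (laplace f 0) by exists (fine (laplace f 0)).
rewrite -hE in H0 Hcvg *.
have Pa : fine (laplace f s) / h @[s --> 0^'+] --> (1 : R).
  rewrite -[X in _ --> X](@divff _ h) ?gt_eqF//.
  by apply: cvgM => //; exact: cvg_cst.
have H := @excess_asymp (fun s => h * s) (fun=> h) 1 ltr01 _ _ _ Pa.
have {}H : (k - K) * g ^+ 2 / (h * r k) @[k --> K^'+] --> (1 : R).
  apply: H.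
  - move=> s s0 _; apply: is_derive_eq.
    by rewrite /GRing.scale/= mulr1.
  - by move=> s s0 _; rewrite gt_eqF.
  - rewrite -[X in _ --> X](mulr0 h); apply: cvgM; first exact: cvg_cst.
    by apply: cvg_at_right_filter; exact: cvg_id.
have H1 : ((k - K) * g ^+ 2 / (h * r k))^-1 @[k --> K^'+] --> (1 : R).
  by rewrite -[X in _ --> X]invr1; apply: cvgV => //; exact: oner_neq0.
apply: cvg_trans H1; apply: near_eq_cvg; near=> k.
have Kk : K < k by near: k; exact: nbhs_right_gt.
have [k0 r0 Pk] := Kroot Kk.
have : k - K != 0 by rewrite gt_eqF// subr_gt0.
have : g != 0 by rewrite gt_eqF.
have : h != 0 by rewrite gt_eqF.
have : r k != 0 by rewrite gt_eqF.
move: (r k) (k - K) => x z rn hn gn kn; move: g gn => G gn.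
by field; rewrite rn hn gn kn.
Unshelve. all: by end_near. Qed.

(** The excess gives (k - K) g^2 ~ c r ln(1/r), which still has to be solved for r. Taking
    logarithms, ln(1/(k - K)) ~ ln(1/r), because ln ln(1/r) is negligible against ln(1/r). *)
Lemma growth_rate_alpha_eq2 : alpha = 2 ->
  r k / ((k - K) / ln (k - K)^-1 * (g ^+ 2 / c)) @[k --> K^'+] --> (1 : R).
Proof.
move=> a2.
have Pa : fine (laplace f s) / (c * ln s^-1) @[s --> 0^'+] --> (1 : R).
  apply: (abelian_ln mf f0 ffin c0).
  by have := f_asymp; rewrite a2 (_ : 1 - 2 = -1 :> R)//; ring.
(* Below e^(-1) the derivative ln(1/s) - 1 of s ln(1/s) is positive, as l'Hopital needs a
   nonvanishing denominator. *)
have d0 : 0 < expR (-1) :> R by exact: expR_gt0.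
have lnVgt (s : R) : 0 < s -> s < expR (-1) -> 1 < ln s^-1.
  move=> s0 sd; rewrite lnV ?posrE// ltrNr -[ltRHS]expRK.
  by rewrite ltr_ln ?posrE.
have Ly := @lnV_cvgy R.
have L1 : (ln s^-1)^-1 @[s --> (0 : R)^'+] --> (0 : R).
  apply/cvgrPdist_le => e e0; near=> s.
  have : e^-1 <= ln s^-1 by near: s; move/cvgryPge : Ly; apply.
  move=> h; have h0 : 0 < ln s^-1 by apply: lt_le_trans h; rewrite invr_gt0.
  rewrite sub0r normrN gtr0_norm ?invr_gt0//.
  by rewrite -[leRHS]invrK lef_pV2 ?posrE ?invr_gt0.
have Pa' : fine (laplace f s) / (c * (ln s^-1 - 1)) @[s --> 0^'+] --> (1 : R).
  have L2 : (1 - (ln s^-1)^-1)^-1 @[s --> (0 : R)^'+] --> (1 : R).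
    rewrite -[X in _ --> X]invr1; apply: cvgV; first exact: oner_neq0.
    rewrite -[X in _ --> X]subr0; apply: cvgB => //; exact: cvg_cst.
  rewrite -[X in _ --> X]mulr1; apply: cvg_trans (cvgM Pa L2).
  apply: near_eq_cvg; near=> s => /=.
  have s0 : 0 < s by near: s; exact: nbhs_right_gt.
  have sd : s < expR (-1) by near: s; exact: nbhs_right_lt.
  have := lnVgt s s0 sd; move: (fine _) (ln s^-1) => x L L1'.
  have : L != 0 by rewrite gt_eqF//; lra.
  have : L - 1 != 0 by rewrite gt_eqF//; lra.
  have : c != 0 by rewrite gt_eqF.
  by move=> cn Ln Ln'; field; rewrite cn Ln Ln'.
have slns : s * ln s^-1 @[s --> (0 : R)^'+] --> (0 : R).
  apply/cvgrPdist_le => e e0.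
  (* By [ln_le_sqrt] at 1/s, s ln(1/s) is at most twice the square root of s, whence the threshold
     (e/2)^2. *)
  have e20 : 0 < (e / 2) ^+ 2 by rewrite exprn_gt0// divr_gt0.
  near=> s.
  have s0 : 0 < s by near: s; exact: nbhs_right_gt.
  have sd : s < expR (-1) by near: s; exact: nbhs_right_lt.
  have L0 : 0 < ln s^-1 by apply: lt_trans (lnVgt s s0 sd).
  have se : s <= (e / 2) ^+ 2 by near: s; exact: nbhs_right_le.
  rewrite sub0r normrN gtr0_norm ?mulr_gt0//.
  pose q := s `^ 2^-1; have q0 : 0 < q by exact: powR_gt0.
  have sq : s = q * q.
    rewrite /q -powRD; last by apply/implyP => _; rewrite gt_eqF.
    by rewrite -[2^-1]mul1r -splitr powRr1// ltW.
  have qe : q <= e / 2.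
    rewrite -(@ler_pXn2r _ 2) ?nnegrE ?(ltW q0) ?divr_ge0 ?(ltW e0)//.
    by rewrite expr2 -sq.
  have sV : s^-1 `^ 2^-1 = q^-1.
    by rewrite -(powR_inv1 (ltW s0)) powRAC powR_inv1// powR_ge0.
  have := @ln_le_sqrt R s^-1; rewrite invr_gt0 sV => /(_ s0) h.
  apply: (@le_trans _ _ (s * (2 * q^-1))); first by rewrite ler_wpM2l// ltW.
  rewrite [X in X * _]sq -mulrA [q * (2 * _)]mulrCA divff ?gt_eqF// mulr1.
  by rewrite -ler_pdivlMr.
have H : (k - K) * g ^+ 2 / (c * (r k * ln (r k)^-1)) @[k --> K^'+] --> (1 : R).
  apply: (@excess_asymp (fun s => c * (s * ln s^-1)) (fun s => c * (ln s^-1 - 1)) _ d0) => //.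
  - move=> s s0 sd.
    have -> : c * (ln s^-1 - 1) = - c * (ln s + 1) by rewrite lnV ?posrE//; ring.
    have dl := is_derive1_ln s0.
    have D : is_derive s (1 : R) (fun s => - c * (s * ln s)) (- c * (ln s + 1)).
      apply: is_derive_eq; rewrite /GRing.scale/= mulr1.
      by field; rewrite gt_eqF.
    apply: near_eq_is_derive D.
    near=> u; have u0 : 0 < u by near: u; exact: lt_nbhsr.
    by rewrite lnV ?posrE//; ring.
  - move=> s s0 sd; rewrite mulf_neq0 ?gt_eqF// subr_gt0.
    exact: lnVgt.
  - rewrite -[X in _ --> X](mulr0 c); apply: cvgM => //; exact: cvg_cst.
have Lr : ln (r k)^-1 @[k --> K^'+] --> +oo by exact: (cvg_comp _ _ rcvg Ly).
have L1r : (ln (r k)^-1)^-1 @[k --> K^'+] --> (0 : R) by exact: (cvg_comp _ _ rcvg L1).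
pose X k := (k - K) * g ^+ 2 / (c * (r k * ln (r k)^-1)).
have lnX : ln (X k) @[k --> K^'+] --> (0 : R) by exact: ln_cvg0 H.
have lnL : ln (ln (r k)^-1) / ln (r k)^-1 @[k --> K^'+] --> (0 : R).
  exact: (cvg_comp _ _ Lr (@ln_div_cvg0 R)).
have Lr0 : \forall k \near K^'+, 0 < ln (r k)^-1 by move/cvgryPgt : Lr; apply.
have ratio : ln (k - K)^-1 / ln (r k)^-1 @[k --> K^'+] --> (1 : R).
  (* With L = ln(1/r), the logarithm of X = (k - K) g^2 / (c r L) gives ln X + ln(c/g^2) = ln(k - K)
     + L - ln L; divide by L. *)
  have E : 1 - ((ln (X k) + ln (c / g ^+ 2)) * (ln (r k)^-1)^-1
       + ln (ln (r k)^-1) / ln (r k)^-1) @[k --> K^'+] --> (1 : R).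
    rewrite -[X in _ --> X]subr0; apply: cvgB; first exact: cvg_cst.
    rewrite -[X in _ --> X]addr0; apply: cvgD => //.
    rewrite -[X in _ --> X](mulr0 (0 + ln (c / g ^+ 2))); apply: cvgM => //.
    by apply: cvgD => //; exact: cvg_cst.
  apply: cvg_trans E; apply: near_eq_cvg; near=> k.
  have Kk : K < k by near: k; exact: nbhs_right_gt.
  have [k0 r0 Pk] := Kroot Kk.
  have L0 : 0 < ln (r k)^-1 by near: k; exact: Lr0.
  have x0 : 0 < k - K by rewrite subr_gt0.
  have g20 : 0 < g ^+ 2 by rewrite exprn_gt0.
  have uL : 0 < r k * ln (r k)^-1 by exact: mulr_gt0.
  have -> : ln (X k) + ln (c / g ^+ 2) = ln (k - K) + ln (r k)^-1 - ln (ln (r k)^-1).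
    rewrite -lnM ?posrE ?divr_gt0 ?mulr_gt0//.
    have -> : X k * (c / g ^+ 2) = (k - K) / (r k * ln (r k)^-1).
      rewrite /X; have : r k * ln (r k)^-1 != 0 by rewrite gt_eqF.
      have : g ^+ 2 != 0 by rewrite gt_eqF.
      have : c != 0 by rewrite gt_eqF.
      move: (r k * _) (k - K) => w x cn gn wn; move: (g ^+ 2) gn => G gn.
      by field; rewrite cn gn wn.
    rewrite ln_div ?posrE// lnM ?posrE// lnV ?posrE//; ring.
  have -> : ln (k - K)^-1 = - ln (k - K) by rewrite lnV ?posrE.
  move: (ln (ln (r k)^-1)) (ln (r k)^-1) (ln (k - K)) L0 => w L x L0.
  by field; rewrite gt_eqF.
have HV : (X k)^-1 @[k --> K^'+] --> (1 : R).
  by rewrite -[X in _ --> X]invr1; apply: cvgV => //; exact: oner_neq0.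
rewrite -[X in _ --> X]mulr1; apply: cvg_trans (cvgM HV ratio).
apply: near_eq_cvg; near=> k => /=.
have Kk : K < k by near: k; exact: nbhs_right_gt.
have [k0 r0 Pk] := Kroot Kk.
have L0 : 0 < ln (r k)^-1 by near: k; exact: Lr0.
rewrite /X; have : ln (r k)^-1 != 0 by rewrite gt_eqF.
have : r k != 0 by rewrite gt_eqF.
have : k - K != 0 by rewrite gt_eqF// subr_gt0.
have : c != 0 by rewrite gt_eqF.
have : g != 0 by rewrite gt_eqF.
rewrite !invf_div [in RHS]invfM !invf_div.
move: (ln (r k)^-1) (ln (k - K)^-1) (r k) (k - K) => L M u x; move: g => G.
by move=> Gn cn xn un Ln; field; rewrite ?Gn ?cn ?xn ?un ?Ln.
Unshelve. all: by end_near. Qed.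

End alpha_gt1.

End growth_rate_asymptotics.

(** * Strict convexity *)

Section nonnegative_power_series.
Context {R : realType}.
Implicit Types (a : nat -> R) (h : R).

(** Extended-real values spare convergence hypotheses, since the terms are nonnegative wherever it
    is used. *)
Definition power_series a h : \bar R := (\sum_(0 <= n <oo) (a n * h ^+ n)%:E)%E.

Lemma power_series_ge0 a h : (forall n, 0 <= a n) -> 0 <= h -> (0 <= power_series a h)%E.
Proof. by move=> a0 h0; apply: nneseries_ge0 => n _ _; rewrite lee_fin mulr_ge0 ?exprn_ge0. Qed.

Lemma power_series_rec a h : (forall n, 0 <= a n) -> 0 <= h ->
  (power_series a h = (a 0%N)%:E + h%:E * power_series (fun n => a n.+1) h)%E.
Proof.
move=> a0 h0; rewrite /power_series nneseries_recl//; last first.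
  by move=> n _; rewrite lee_fin mulr_ge0 ?exprn_ge0.
rewrite expr0 mulr1 -(nneseries_addn 1)//; last first.
  by move=> n; rewrite lee_fin mulr_ge0 ?exprn_ge0.
rewrite -nneseriesZl//; last by move=> n _; rewrite lee_fin mulr_ge0 ?exprn_ge0.
congr (_ + _)%E; apply: eq_eseriesr => n _.
by rewrite -EFinM addn1 exprS; congr EFin; ring.
Qed.

Lemma le_power_series a h h' : (forall n, 0 <= a n) -> 0 <= h -> h <= h' ->
  (power_series a h <= power_series a h')%E.
Proof.
move=> a0 h0 hh'; apply: lee_nneseries => [n _ _|n _].
  by rewrite lee_fin mulr_ge0 ?exprn_ge0.
by rewrite lee_fin ler_wpM2l// lerXn2r// nnegrE (le_trans h0).
Qed.

Lemma power_series_tail_lty a h : (forall n, 0 <= a n) -> 0 < h ->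
  (power_series a h < +oo)%E -> (power_series (fun n => a n.+1) h < +oo)%E.
Proof.
move=> a0 h0; rewrite power_series_rec ?(ltW h0)//.
have : (0 <= power_series (fun n => a n.+1) h)%E by apply: power_series_ge0 => //; exact: ltW.
by case: (power_series _ _) => [x _ _| |] //; rewrite ?ltry// gt0_muley ?lte_fin// addey.
Qed.

Lemma power_series_fin a h h1 : (forall n, 0 <= a n) -> 0 < h -> h <= h1 ->
  (power_series a h1 < +oo)%E ->
  exists x, [/\ power_series a h = x%:E, 0 <= x & x <= fine (power_series a h1)].
Proof.
move=> a0 h0 hh1 afin.
have := power_series_ge0 a0 (ltW h0).
have := le_power_series a0 (ltW h0) hh1.
have := power_series_ge0 a0 (ltW (lt_le_trans h0 hh1)).
move: afin; case: (power_series _ h1) => [M| |] // _ _.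
by case: (power_series _ h) => [x| |] //; rewrite !lee_fin => ? ?; exists x.
Qed.

(** The constant terms differ by h times a difference of tail series bounded by [M] on ]0, h1]; let
    h tend to 0. *)
Lemma power_series_unique0 a b h1 : (forall n, 0 <= a n) -> (forall n, 0 <= b n) ->
  0 < h1 -> (power_series a h1 < +oo)%E ->
  (forall h, 0 < h -> h <= h1 -> power_series a h = power_series b h) ->
  a 0%N = b 0%N.
Proof.
move=> a0 b0 h10 afin ab.
have bfin : (power_series b h1 < +oo)%E by rewrite -ab.
have fa := power_series_tail_lty a0 h10 afin.
have fb := power_series_tail_lty b0 h10 bfin.
have a0' n : 0 <= a n.+1 by [].
have b0' n : 0 <= b n.+1 by [].
pose M := fine (power_series (fun n => a n.+1) h1) + fine (power_series (fun n => b n.+1) h1).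
have Ma0 : 0 <= fine (power_series (fun n => a n.+1) h1).
  by apply: fine_ge0; apply: power_series_ge0 => //; exact: ltW.
have Mb0 : 0 <= fine (power_series (fun n => b n.+1) h1).
  by apply: fine_ge0; apply: power_series_ge0 => //; exact: ltW.
have key h : 0 < h -> h <= h1 -> `|a 0%N - b 0%N| <= h * M.
  move=> h0 hh1; have := ab _ h0 hh1.
  rewrite (power_series_rec a0) ?(power_series_rec b0) ?(ltW h0)//.
  have [x [-> x0 xM]] := power_series_fin a0' h0 hh1 fa.
  have [y [-> y0 yM]] := power_series_fin b0' h0 hh1 fb.
  rewrite -!EFinM -!EFinD => -[E].
  have -> : a 0%N - b 0%N = h * (y - x) by rewrite mulrBr; lra.
  rewrite normrM (gtr0_norm h0) ler_wpM2l ?(ltW h0)// ler_norml /M.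
  by apply/andP; split; lra.
apply/eqP; rewrite -subr_eq0 -normr_le0; apply/ler_addgt0Pr => e e0; rewrite add0r.
have M0 : 0 < M + 1 by rewrite ltr_wpDl// addr_ge0.
pose h := Num.min h1 (e / (M + 1)).
have h0 : 0 < h by rewrite lt_min h10 divr_gt0.
apply: (le_trans (key h h0 _)); first by rewrite ge_min lexx.
have hM : h * (M + 1) <= e by rewrite -ler_pdivlMr// ge_min lexx orbT.
by apply: le_trans hM; rewrite ler_wpM2l ?(ltW h0)// lerDl.
Qed.

Lemma power_series_unique a b h1 : (forall n, 0 <= a n) -> (forall n, 0 <= b n) ->
  0 < h1 -> (power_series a h1 < +oo)%E ->
  (forall h, 0 < h -> h <= h1 -> power_series a h = power_series b h) ->
  forall n, a n = b n.
Proof.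
move=> + + h10 + + n; elim: n a b => [|n IH] a b a0 b0 afin ab.
  exact: power_series_unique0 afin ab.
have a00 := power_series_unique0 a0 b0 h10 afin ab.
have bfin : (power_series b h1 < +oo)%E by rewrite -ab.
have fa := power_series_tail_lty a0 h10 afin.
have fb := power_series_tail_lty b0 h10 bfin.
have a0' m : 0 <= a m.+1 by [].
have b0' m : 0 <= b m.+1 by [].
apply: (IH (fun n => a n.+1) (fun n => b n.+1)) => // h h0 hh1.
have := ab _ h0 hh1; rewrite (power_series_rec a0) ?(power_series_rec b0) ?(ltW h0)// a00.
have [x [-> _ _]] := power_series_fin a0' h0 hh1 fa.
have [y [-> _ _]] := power_series_fin b0' h0 hh1 fb.
rewrite -!EFinM -!EFinD => -[/addrI/mulfI] ->//.
by rewrite gt_eqF.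
Qed.

Lemma power_series_geometric (B D h : R) : 0 <= B -> 0 < D -> 0 <= h -> h < D ->
  power_series (fun n => B / D ^+ n.+1) h = (B / (D - h))%:E.
Proof.
move=> B0 D0 h0 hD.
have z1 : `|h / D| < 1 by rewrite ger0_norm ?divr_ge0 ?(ltW D0)// ltr_pdivrMr// mul1r.
have H := @cvg_geometric_series R (B / D) (h / D) z1.
have E : B / D * (1 - h / D)^-1 = B / (D - h).
  by field; rewrite gt_eqF ?subr_gt0// gt_eqF.
rewrite E in H; apply/cvg_lim => //.
apply: cvg_EFin; first by apply: nearW => n; rewrite sumEFin.
apply: cvg_trans H; apply: near_eq_cvg; apply: nearW => n.
rewrite /= sumEFin /= /series/=; apply: eq_bigr => m _.
by rewrite /geometric/= exprS invfM exprMn exprVn; ring.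
Qed.

Lemma power_series_expR (a h : R) : 0 <= a -> 0 <= h ->
  power_series (fun n => a ^+ n / n`!%:R) h = (expR (a * h))%:E.
Proof.
move=> a0 h0; apply/cvg_lim => //.
have H := @is_cvg_series_exp_coeff R (a * h).
apply: cvg_EFin; first by apply: nearW => n; rewrite sumEFin.
apply: cvg_trans H; apply: near_eq_cvg; apply: nearW => n.
rewrite /= sumEFin /= /series/=; apply: eq_bigr => m _.
by rewrite /exp_coeff/= exprMn mulrAC.
Qed.

End nonnegative_power_series.

Section laplace_power_series.
Context {R : realType}.
Local Notation mu := (@lebesgue_measure R).
Variables (p : R -> R) (rho : R).
Hypotheses (mp : measurable_fun [set: R] p) (p0 : forall t, 0 <= t -> 0 <= p t).
Hypotheses (p1 : forall t, 0 <= t -> p t <= 1) (rho0 : 0 < rho).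

(** The Taylor coefficient (-1)^n P^(n)(rho) / n! of h -> P(rho - h), written as an integral that is
    visibly nonnegative. *)
Definition laplace_coef n := laplace (fun t => t ^+ n / n`!%:R * p t) rho.

Let mterm n : measurable_fun [set: R] (fun t => t ^+ n / n`!%:R * p t).
Proof. by apply: measurable_funM => //; apply: measurable_funM => //; exact: exprn_measurable. Qed.

Let term0 n t : 0 <= t -> 0 <= t ^+ n / n`!%:R * p t.
Proof. by move=> t0; rewrite mulr_ge0 ?p0// divr_ge0 ?exprn_ge0. Qed.

Lemma laplace_coef_fin n : laplace_coef n \is a fin_num.
Proof.
apply: (@fin_num_laplace _ _ ((rho / 2) ^- n) (rho / 2)) => //.
- by move=> t; exact: term0.
- move=> t t0; apply: (@le_trans _ _ (t ^+ n / n`!%:R)).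
    by rewrite -[leRHS]mulr1 ler_wpM2l ?p1// divr_ge0 ?exprn_ge0.
  have r20 : 0 < rho / 2 by rewrite divr_gt0.
  rewrite -ler_pdivrMl ?invr_gt0 ?exprn_gt0// invrK.
  have rt0 : 0 <= rho / 2 * t by rewrite mulr_ge0// ltW.
  (* A single term of the exponential series is at most its sum: (rho t/2)^n / n! <= e^(rho t/2). *)
  have : (((rho / 2 * t) ^+ n / n`!%:R * 1 ^+ n)%:E
      <= (expR (rho / 2 * t * 1))%:E :> \bar R)%E.
    rewrite -power_series_expR//.
    have u0 m : (0%R <= ((rho / 2 * t) ^+ m / m`!%:R * 1 ^+ m)%:E)%E.
      by rewrite lee_fin !mulr_ge0 ?exprn_ge0// invr_ge0.
    apply: le_trans (nneseries_lim_ge n.+1 (fun m _ _ => u0 m)).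
    by rewrite big_nat_recr//= leeDr// sume_ge0.
  by rewrite lee_fin expr1n !mulr1 exprMn mulrA.
- by rewrite ltr_pdivrMr// mulr_natr mulr2n ltrDl.
Qed.

(** Expanding e^(t h) leaves only nonnegative terms, so Tonelli applies for every h >= 0, even when
    both sides are infinite and when h exceeds rho. This is what continues an identity from a short
    interval of h. *)
Lemma laplace_power_series h : 0 <= h ->
  laplace p (rho - h) = power_series (fun n => fine (laplace_coef n)) h.
Proof.
move=> h0; rewrite /power_series.
transitivity (\sum_(0 <= n <oo) \int[mu]_(t in `[0%R, +oo[)
   (expR (- rho * t) * (t ^+ n / n`!%:R * p t) * h ^+ n)%:E)%E; last first.
  apply: eq_eseriesr => n _.
  rewrite EFinM fineK ?laplace_coef_fin// muleC.
  rewrite /laplace_coef /laplace -ge0_integralZl//.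
  - by apply: eq_integral => t _; rewrite -EFinM mulrC.
  - by apply: measurable_funTS; exact: measurable_laplace.
  - move=> t /=; rewrite in_itv/= andbT => t0.
    by rewrite lee_fin mulr_ge0 ?expR_ge0 ?term0.
  - by rewrite lee_fin exprn_ge0.
rewrite -integral_nneseries//.
- apply: eq_integral => t; rewrite inE/= in_itv/= andbT => t0.
  rewrite (_ : - (rho - h) * t = - rho * t + t * h); last by ring.
  rewrite expRD mulrAC EFinM -power_series_expR// /power_series -nneseriesZl; last first.
    by move=> n _; rewrite lee_fin mulr_ge0 ?exprn_ge0// divr_ge0 ?exprn_ge0.
  by apply: eq_eseriesr => n _; rewrite -EFinM; congr EFin; ring.
- move=> n; apply: measurable_funTS; apply/measurable_EFinP/measurable_funM; last by [].
  by apply/measurable_EFinP; exact: measurable_laplace (mterm n).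
- move=> n t /=; rewrite in_itv/= andbT => t0.
  by rewrite lee_fin !mulr_ge0 ?expR_ge0 ?exprn_ge0 ?p0// invr_ge0.
Qed.

End laplace_power_series.

Section strict_convexity.
Context {R : realType}.
Local Notation mu := (@lebesgue_measure R).
Variables (p r : R -> R) (b c1 : R).
Hypotheses (mp : measurable_fun [set: R] p) (p0 : forall t, 0 <= t -> 0 <= p t).
Hypotheses (p1 : forall t, 0 <= t -> p t <= 1).
Hypotheses (b0 : 0 < b) (c10 : 0 < c1) (pc : forall t, 0 < t -> t <= b -> c1 <= p t).
Hypothesis rU : forall k s, 0 < k -> 0 < s -> (k%:E * laplace p s < 1)%E -> r k <= s.
Hypothesis rL : forall k s, 0 < k -> 0 < s -> (1 < k%:E * laplace p s)%E -> s <= r k.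
Hypothesis p_cvg0 : p t @[t --> +oo] --> (0 : R).
Hypothesis laplace_neg : forall s, s < 0 -> laplace p s = +oo%E.

Local Notation P := (fun s => fine (laplace p s)).
Local Notation K := (fine (laplace p 0)^-1).

(** The coefficients at rho are those of a geometric series, so P(s) = B / (s - A) on all of ]A,
    rho]. If A < 0, P would be finite at A/2 < 0. If A > 0, the blow-up at A contradicts P(s) <=
    1/s. If A = 0, then s P(s) = B near 0, whereas p tending to 0 makes s P(s) tend to 0. *)
Lemma laplace_not_simple_pole (A B rho s1 : R) : 0 < B -> A < rho -> 0 < s1 ->
  s1 < rho - A -> 0 < rho ->
  ~ (forall h, 0 < h -> h <= s1 -> laplace p (rho - h) = (B / (rho - h - A))%:E).
Proof.
move=> B0 Arho s10 s1A rho0 H.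
have D0 : 0 < rho - A by rewrite subr_gt0.
have E : forall s, A < s -> s <= rho -> laplace p s = (B / (s - A))%:E.
  have coef n : fine (laplace_coef p rho n) = B / (rho - A) ^+ n.+1.
    apply: (@power_series_unique _ (fun n => fine (laplace_coef p rho n))
      (fun n => B / (rho - A) ^+ n.+1) s1) => //.
    - by move=> m; apply: fine_ge0; apply: laplace_ge0 => t t0;
        rewrite mulr_ge0 ?p0// divr_ge0 ?exprn_ge0.
    - by move=> m; rewrite divr_ge0 ?exprn_ge0// ltW.
    - by rewrite -laplace_power_series ?(ltW s10)// H// ltry.
    - move=> h h0 hs1; rewrite -laplace_power_series ?(ltW h0)// H//.
      rewrite power_series_geometric ?(ltW B0) ?(ltW h0)//; last exact: le_lt_trans s1A.
      by congr (_ / _)%:E; ring.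
  move=> s As srho; rewrite (_ : s = rho - (rho - s)); last by ring.
  rewrite laplace_power_series ?subr_ge0//.
  rewrite (_ : (fun n => _) = (fun n => B / (rho - A) ^+ n.+1)); last exact/funext.
  rewrite power_series_geometric ?(ltW B0) ?subr_ge0//; last by lra.
  by congr (_ / _)%:E; ring.
have lt1 s : 0 < s -> (laplace p s <= (s^-1)%:E)%E.
  move=> s0; apply: (@le_trans _ _ (laplace (fun=> 1) s)); first exact: le_laplace.
  by rewrite laplace_cst// mul1r.
have [A0|A0|A0] := ltgtP A 0.
- have := laplace_neg (_ : A / 2 < 0).
  rewrite E; [|lra|lra].
  by move=> H2; have := H2 ltac:(lra).
(* e < A B gives B/e > 1/A > 1/(A + e), against P(A + e) <= 1/(A + e); e < rho - A keeps A + e in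
   the range of the formula. *)
- pose e := Num.min (rho - A) (A * B) / 2.
  have e0 : 0 < e by rewrite divr_gt0// lt_min D0 mulr_gt0.
  have eD : e < rho - A.
    apply: (@lt_le_trans _ _ (Num.min (rho - A) (A * B))); last by rewrite ge_min lexx.
    by rewrite ltr_pdivrMr// mulr_natr mulr2n ltrDl lt_min D0 mulr_gt0.
  have eAB : e < A * B.
    apply: (@lt_le_trans _ _ (Num.min (rho - A) (A * B))); last by rewrite ge_min lexx orbT.
    by rewrite ltr_pdivrMr// mulr_natr mulr2n ltrDl lt_min D0 mulr_gt0.
  have Ae0 : 0 < A + e by rewrite addr_gt0.
  have := lt1 _ Ae0; rewrite E; [|by rewrite ltrDl|by rewrite -lerBrDl ltW].
  rewrite addrAC subrr add0r lee_fin leNgt => /negP; apply.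
  apply: (@lt_trans _ _ A^-1); first by rewrite ltf_pV2 ?posrE// ltrDl.
  by rewrite ltr_pdivlMr// mulrC ltr_pdivrMr// mulrC.
- have /cvgrPdist_le/(_ (B / 2)) := p_cvg0; rewrite divr_gt0// => /(_ isT) [T [_ pT]].
  have pe t : T + 1 <= t -> p t <= B / 2 * 1.
    move=> Tt; have := pT t; rewrite /= sub0r normrN mulr1.
    by move=> /(_ _)/(le_trans (ler_norm _)); apply; lra.
  have B20 : 0 <= B / 2 by lra.
  have m1 : measurable_fun [set: R] (fun=> 1 : R) by [].
  have tl := laplace_le_tail mp m1 p0 (fun _ _ => ler01) B20 pe.
  have /fineK Mfin : (\int[mu]_(t in `[0%R, (T + 1)%R]) (p t)%:E)%E \is a fin_num.
    rewrite ge0_fin_numE; last first.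
      by apply: integral_ge0 => t /=; rewrite in_itv/= => /andP[t0 _]; rewrite lee_fin p0.
    apply: (le_lt_trans (integral_le_laplace _ mp p0)).
    by rewrite -(fineK (laplace_fin_num mp p0 p1 ltr01)) -EFinM ltry.
  move: tl; rewrite -Mfin; move: (fine _) => M tl.
  have key s : 0 < s -> s <= rho -> B / 2 <= M * s.
    move=> s0 srho; have := tl s (ltW s0).
    rewrite E ?A0// laplace_cst// subr0 mul1r -EFinM -EFinD lee_fin.
    rewrite ler_pdivrMr// mulrDl -mulrA mulVf ?gt_eqF// mulr1; lra.
  have M0 : 0 < M.
    by have := key rho rho0 (lexx _); rewrite -(pmulr_lgt0 _ rho0); apply: lt_le_trans; lra.
  pose s := Num.min rho (B / 4 / M).
  have s0 : 0 < s by rewrite lt_min rho0 !divr_gt0.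
  have := key s s0; rewrite ge_min lexx => /(_ isT); rewrite leNgt => /negP; apply.
  apply: (@le_lt_trans _ _ (B / 4)); last by lra.
  by rewrite mulrC -ler_pdivlMr// ge_min lexx orbT.
Qed.

Hypothesis rconv : forall x y t, K < x -> K < y -> 0 < t < 1 ->
  r (t * x + (1 - t) * y) <= t * r x + (1 - t) * r y.

Let r_lt x y : K < x -> x < y -> r x < r y.
Proof.
move=> Kx xy; have Ky := lt_trans Kx xy.
have K0 := kcr_ge0 mp p0 p1 b0 c10 pc.
have x0 := le_lt_trans K0 Kx; have y0 := le_lt_trans K0 Ky.
rewrite ltNge; apply/negP => ryx.
have ry0 := root_gt0 mp p0 p1 b0 c10 pc rL y0 Ky.
have Px := rootP mp p0 p1 b0 c10 pc rU rL Kx.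
have Py := rootP mp p0 p1 b0 c10 pc rU rL Ky.
have : P (r x) <= P (r y).
  move: ryx; rewrite le_eqVlt => /predU1P[->//|ryx]; apply: ltW.
  exact: fine_laplace_lt mp p0 p1 b0 c10 pc _ _ ry0 ryx.
rewrite leNgt => /negP; apply.
rewrite -(ltr_pM2l x0) Px -Py ltr_pM2r//.
exact: fine_laplace_gt0 mp p0 p1 b0 c10 pc _ ry0.
Qed.

Let rconv3 x u y : K < x -> x < u -> u < y ->
  (y - x) * r u <= (y - u) * r x + (u - x) * r y.
Proof.
move=> Kx xu uy; have xy := lt_trans xu uy; have yx0 : 0 < y - x by rewrite subr_gt0.
have := rconv Kx (lt_trans Kx xy) (_ : 0 < (y - u) / (y - x) < 1).
have -> : (y - u) / (y - x) * x + (1 - (y - u) / (y - x)) * y = u.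
  by field; rewrite gt_eqF.
have -> : (y - u) / (y - x) * r x + (1 - (y - u) / (y - x)) * r y =
    ((y - u) * r x + (u - x) * r y) / (y - x).
  by field; rewrite gt_eqF.
rewrite ler_pdivlMr// [r u * _]mulrC; apply.
by rewrite divr_gt0 ?subr_gt0//= ltr_pdivrMr// mul1r ltrD2l ltrN2.
Qed.

Lemma growth_rate_strictly_convex : strictly_convex_on [set k | K < k] r.
Proof.
suff main x y t : K < x -> x < y -> 0 < t < 1 ->
    r (t * x + (1 - t) * y) < t * r x + (1 - t) * r y.
  move=> x y t /= Kx Ky xy t01; move: xy; rewrite neq_lt => /orP[xy|yx]; first exact: main.
  have := @main y x (1 - t) Ky yx; rewrite subKr => H.
  rewrite [ltRHS]addrC [X in r X]addrC; apply: H; lra.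
move=> Kx xy /[dup] t01 /andP[t0 t1]; have Ky := lt_trans Kx xy.
rewrite lt_neqAle rconv// andbT; apply/eqP.
set z := t * x + (1 - t) * y => rz.
have xz : x < z by rewrite /z -subr_gt0 (_ : _ - x = (1 - t) * (y - x));
  [rewrite mulr_gt0// subr_gt0|ring].
have zy : z < y by rewrite /z -subr_gt0 (_ : y - _ = t * (y - x));
  [rewrite mulr_gt0// subr_gt0|ring].
have K0 := kcr_ge0 mp p0 p1 b0 c10 pc.
have y0 := le_lt_trans K0 Ky; have z0 := le_lt_trans K0 (lt_trans Kx xz).
have ry0 := root_gt0 mp p0 p1 b0 c10 pc rL y0 Ky.
have yx0 : 0 < y - x by rewrite subr_gt0.
pose B := (r y - r x) / (y - x).
have B0 : 0 < B by rewrite divr_gt0 ?subr_gt0 ?r_lt.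
have BE : B * (y - x) = r y - r x by rewrite /B divfK// gt_eqF.
(* Convexity puts r u below the chord from x to y. If it were strictly below, z, which lies between
   x and u, would be strictly below that chord too, against [rz]. *)
have affine u : z < u -> u < y -> r u = r y - B * (y - u).
  move=> zu uy; have xu := lt_trans xz zu.
  have h1 := rconv3 Kx xu uy.
  have h2 := rconv3 Kx xz zu.
  have h3 : (y - x) * r z = (y - z) * r x + (z - x) * r y by rewrite rz /z; ring.
  apply: (mulfI (lt0r_neq0 yx0)); apply/eqP; rewrite eq_le; apply/andP; split.
    apply: (le_trans h1); rewrite mulrBr mulrCA [(y - x) * (y - u)]mulrC mulrCA BE.
    by rewrite le_eqVlt; apply/orP; left; apply/eqP; ring.
  rewrite -(ler_pM2l (_ : 0 < z - x)) ?subr_gt0//.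
  have h4 : (u - x) * ((y - x) * r z) <=
      (y - x) * ((u - z) * r x + (z - x) * r u).
    by rewrite mulrCA ler_pM2l.
  rewrite h3 in h4.
  rewrite mulrBr [(y - x) * (B * _)]mulrA [(y - x) * B]mulrC BE.
  rewrite -subr_ge0 in h4; rewrite -subr_ge0; apply: le_trans h4 _.
  by rewrite le_eqVlt; apply/orP; left; apply/eqP; ring.
(* On the affine piece the value r y - h is taken at u = y - h/B, and P(r u) = 1/u = B / (r u - (r y
   - B y)). The bound h <= B (y - z) / 2 keeps u in ]z, y[. *)
apply: (@laplace_not_simple_pole (r y - B * y) B (r y) (B * (y - z) / 2)) => //.
- by rewrite ltrBlDr ltrDl mulr_gt0.
- by rewrite divr_gt0// mulr_gt0// subr_gt0.
- rewrite opprB addrCA subrr addr0 -mulrA ltr_pM2l//; lra.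
move=> h h0 hs.
have hB0 : 0 < h / B by rewrite divr_gt0.
pose u := y - h / B.
have uy : u < y by rewrite /u; lra.
have zu : z < u.
  rewrite ltrBrDl -ltrBrDr ltr_pdivrMr//; apply: (le_lt_trans hs).
  by rewrite [ltRHS]mulrC -mulrA ltr_pM2l//; lra.
have ru : r u = r y - h.
  by rewrite affine// /u opprB addrCA subrr addr0 mulrC divfK// gt_eqF.
have u0 : 0 < u by exact: lt_trans zu.
have Ku : K < u by exact: lt_trans (lt_trans Kx xz) zu.
have uq : u * fine (laplace p (r u)) = 1 := rootP mp p0 p1 b0 c10 pc rU rL Ku.
have ru0 := root_gt0 mp p0 p1 b0 c10 pc rL u0 Ku.
rewrite -ru -(fineK (laplace_fin_num mp p0 p1 ru0)).
move: (fine _) uq => q uq; congr EFin; apply: (mulfI (lt0r_neq0 u0)); rewrite uq ru.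
rewrite (_ : r y - h - (r y - B * y) = B * u); last by rewrite /u; field; rewrite gt_eqF.
by field; rewrite !gt_eqF.
Qed.

End strict_convexity.

(** * Log-convexity of exponential moments *)

Lemma expR_convex (R : realType) (a b t : R) : 0 <= t -> t <= 1 ->
  expR (t * a + (1 - t) * b) <= t * expR a + (1 - t) * expR b.
Proof.
move=> t0 t1; set m := t * a + (1 - t) * b.
have tangent x : expR m * (1 + (x - m)) <= expR x.
  have -> : expR x = expR m * expR (x - m) by rewrite -expRD subrKC.
  by rewrite ler_wpM2l ?expR_ge0 ?expR_ge1Dx.
have -> : expR m = t * (expR m * (1 + (a - m))) + (1 - t) * (expR m * (1 + (b - m))).
  by rewrite /m; ring.
by apply: lerD; rewrite ler_wpM2l ?subr_ge0.
Qed.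

Section exponential_moment.
Context {R : realType} {d : measure_display} {T : measurableType d}.
Variables (P : probability T R) (L : T -> R) (B : R).
Hypotheses (mL : measurable_fun [set: T] L) (L0 : forall w, 0 <= L w).
Hypothesis LB : forall w, L w <= B.

Local Notation phi k := (fine 'E_P[fun w => expR (k * L w)]).

Let mE k : measurable_fun [set: T] (fun w => expR (k * L w)).
Proof. by apply: measurableT_comp => //; exact: measurable_funM. Qed.

Lemma exp_moment_le k : 0 <= k -> ('E_P[fun w => expR (k * L w)] <= (expR (k * B))%:E)%E.
Proof.
move=> k0; rewrite unlock.
apply: (@le_trans _ _ (\int[P]_w (expR (k * B))%:E)%E).
  apply: ge0_le_integral => //.
  - exact/measurable_EFinP.
  - by move=> w _; rewrite lee_fin ler_expR ler_wpM2l.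
by rewrite integral_cst//= probability_setT mule1.
Qed.

Lemma exp_moment_ge1 k : 0 <= k -> (1 <= 'E_P[fun w => expR (k * L w)])%E.
Proof.
move=> k0; rewrite unlock.
apply: (@le_trans _ _ (\int[P]_w (1%:E : \bar R))%E).
  by rewrite integral_cst//= probability_setT mule1.
apply: ge0_le_integral => //.
- exact/measurable_EFinP.
- by move=> w _; rewrite lee_fin -expR0 ler_expR mulr_ge0.
Qed.

Lemma exp_momentK k : 0 <= k ->
  (phi k)%:E = (\int[P]_w (expR (k * L w))%:E)%E.
Proof.
move=> k0; rewrite fineK; first by rewrite unlock.
rewrite ge0_fin_numE; first exact: le_lt_trans (exp_moment_le k0) (ltry _).
exact: le_trans (exp_moment_ge1 k0).
Qed.

Lemma fine_exp_moment_ge1 k : 0 <= k -> 1 <= phi k.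
Proof.
move=> k0; rewrite -lee_fin (exp_momentK k0).
by have := exp_moment_ge1 k0; rewrite unlock.
Qed.

(** This is Hoelder's inequality. After normalization by the moments [fx] and [fy], pointwise
    convexity of exp bounds e^(z L - c) by t e^(x L) / fx + (1 - t) e^(y L) / fy, whose expectation
    is 1. *)
Lemma ln_exp_moment_convex x y t : 0 <= x -> 0 <= y -> 0 <= t -> t <= 1 ->
  ln (phi (t * x + (1 - t) * y)) <= t * ln (phi x) + (1 - t) * ln (phi y).
Proof.
move=> x0 y0 t0 t1.
have z0 : 0 <= t * x + (1 - t) * y by rewrite addr_ge0 ?mulr_ge0// subr_ge0.
have := fine_exp_moment_ge1 x0; have := fine_exp_moment_ge1 y0.
have := fine_exp_moment_ge1 z0.
have := exp_momentK x0; have := exp_momentK y0; have := exp_momentK z0.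
move: (phi x) (phi y) (phi (t * x + (1 - t) * y)) => fx fy fz.
set z := t * x + _ in z0 * => Ez Ey Ex fz1 fy1 fx1.
have fx0 : 0 < fx by exact: lt_le_trans fx1.
have fy0 : 0 < fy by exact: lt_le_trans fy1.
have fz0 : 0 < fz by exact: lt_le_trans fz1.
set c := t * ln fx + (1 - t) * ln fy.
rewrite -ler_expR lnK ?posrE//.
have cx0 : 0 <= t / fx by rewrite divr_ge0// ltW.
have cy0 : 0 <= (1 - t) / fy by rewrite divr_ge0 ?subr_ge0// ltW.
have : ((expR (- c))%:E * fz%:E <= (t / fx)%:E * fx%:E + ((1 - t) / fy)%:E * fy%:E)%E.
  rewrite Ex Ey Ez -!ge0_integralZl//; last 3 first.
  - exact/measurable_EFinP.
  - exact/measurable_EFinP.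
  - exact/measurable_EFinP.
  rewrite -ge0_integralD//; last 4 first.
  - by move=> w _; rewrite -EFinM lee_fin mulr_ge0// expR_ge0.
  - by apply: measurable_funeM; exact/measurable_EFinP.
  - by move=> w _; rewrite -EFinM lee_fin mulr_ge0// expR_ge0.
  - by apply: measurable_funeM; exact/measurable_EFinP.
  apply: ge0_le_integral => //.
  - by apply: measurable_funeM; exact/measurable_EFinP.
  - by apply: emeasurable_funD; apply: measurable_funeM; exact/measurable_EFinP.
  move=> w _; rewrite -!EFinM -EFinD lee_fin -expRD.
  have -> : t / fx * expR (x * L w) = t * expR (x * L w - ln fx).
    by rewrite expRD expRN lnK ?posrE// mulrAC mulrA.
  have -> : (1 - t) / fy * expR (y * L w) = (1 - t) * expR (y * L w - ln fy).
    by rewrite expRD expRN lnK ?posrE// mulrAC mulrA.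
  apply: le_trans (expR_convex _ _ t0 t1); rewrite ler_expR /c /z.
  by rewrite le_eqVlt; apply/orP; left; apply/eqP; ring.
rewrite -!EFinM -EFinD lee_fin !mulfVK ?gt_eqF// subrKC.
by rewrite expRN ler_pdivrMl ?expR_gt0// mulr1.
Qed.

End exponential_moment.

(** * Consequences of the power tail *)

Section power_tail.
Context {R : realType}.
Local Notation mu := (@lebesgue_measure R).
Variables (p : R -> R) (c alpha : R).
Hypotheses (mp : measurable_fun [set: R] p) (p0 : forall t, 0 <= t -> 0 <= p t).
Hypotheses (c0 : 0 < c) (alpha0 : 0 < alpha).
Hypothesis p_asymp : p t / (c * t `^ (- alpha)) @[t --> +oo] --> (1 : R).

Lemma powRN_cvg0 : t `^ (- alpha) @[t --> +oo] --> (0 : R).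
Proof.
apply/cvgrPdist_le => e e0; near=> t.
have te : e `^ (- alpha^-1) <= t by near: t; apply: nbhs_pinfty_ge; exact: num_real.
have t0 : 0 < t by apply: lt_le_trans te; exact: powR_gt0.
rewrite sub0r normrN ger0_norm ?powR_ge0// powRN -[leRHS]invrK lef_pV2 ?posrE ?invr_gt0 ?powR_gt0//.
have -> : e^-1 = (e `^ (- alpha^-1)) `^ alpha.
  by rewrite -powRrM mulNr mulVf ?gt_eqF// powRN powRr1// ltW.
by apply: ge0_ler_powR; rewrite ?nnegrE ?powR_ge0 ?(ltW alpha0) ?(ltW t0).
Unshelve. all: by end_near. Qed.

Lemma power_tail_cvg0 : p t @[t --> +oo] --> (0 : R).
Proof.
have H : p t / (c * t `^ (- alpha)) * (c * t `^ (- alpha)) @[t --> +oo] --> 1 * (c * 0 : R).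
  by apply: cvgM => //; apply: cvgM; [exact: cvg_cst|exact: powRN_cvg0].
rewrite mulr0 mulr0 in H; apply: cvg_trans H; apply: near_eq_cvg; near=> t.
have t0 : 0 < t by near: t; apply: nbhs_pinfty_gt; exact: num_real.
by rewrite divfK// mulf_neq0 ?gt_eqF ?powR_gt0.
Unshelve. all: by end_near. Qed.

(** As ln t / t tends to 0, e^(-s t) t^(-alpha) is eventually at least 1, so the integrand stays
    above c/2. *)
Lemma laplace_lt0 s : s < 0 -> laplace p s = +oo%E.
Proof.
move=> s0.
have a20 : 0 < - s / alpha by rewrite divr_gt0// oppr_gt0.
have half1 : 1 / 2 < 1 :> R by lra.
have H1 : \forall t \near +oo, 1 / 2 <= p t / (c * t `^ (- alpha)) by exact: (cvgr_ge _ p_asymp).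
have H2 : \forall t \near +oo, ln t / t <= - s / alpha by exact: (cvgr_le _ (@ln_div_cvg0 R)).
have [T [T0 HT]] : exists T : R, 0 < T /\ forall t, T <= t -> c / 2 <= expR (- s * t) * p t.
  have : \forall t \near +oo, c / 2 <= expR (- s * t) * p t.
    near=> t.
    have t0 : 0 < t by near: t; apply: nbhs_pinfty_gt; exact: num_real.
    have h1 : 1 / 2 <= p t / (c * t `^ (- alpha)) by near: t; exact: H1.
    have h2 : ln t / t <= - s / alpha by near: t; exact: H2.
    rewrite ler_pdivlMr ?mulr_gt0 ?powR_gt0// in h1.
    apply: (@le_trans _ _ (expR (- s * t) * (1 / 2 * (c * t `^ (- alpha))))); last first.
      by rewrite ler_wpM2l// expR_ge0.
    have -> : expR (- s * t) * (1 / 2 * (c * t `^ (- alpha))) =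
        c / 2 * (expR (- s * t) * t `^ (- alpha)) by ring.
    rewrite -[leLHS]mulr1 ler_wpM2l ?divr_ge0 ?(ltW c0)//.
    rewrite /powR gt_eqF// -expRD -[leLHS]expR0 ler_expR [- alpha * _]mulNr subr_ge0.
    by rewrite mulrC -ler_pdivlMr// mulrAC -ler_pdivrMr.
  move=> [T [_ HT]]; exists (Num.max 1 (T + 1)); split.
    by rewrite lt_max ltr01.
  by move=> t; rewrite ge_max => /andP[_ Tt]; apply: HT; lra.
apply/eqP; rewrite -leye_eq.
apply: (@le_trans _ _ (\int[mu]_(t in `[T, +oo[) (c / 2)%:E)%E).
  rewrite integral_cst//= lebesgue_measure_itv/= ltry/= gt0_muley// lte_fin.
  by rewrite divr_gt0.
apply: (@le_trans _ _ (\int[mu]_(t in `[T, +oo[) (expR (- s * t) * p t)%:E)%E).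
  apply: ge0_le_integral => //.
  - by move=> t _; rewrite lee_fin divr_ge0// ltW.
  - by apply: measurable_funTS; exact: measurable_laplace.
  - by move=> t /=; rewrite in_itv/= andbT => Tt; rewrite lee_fin HT.
apply: ge0_subset_integral => //.
- by apply: measurable_funTS; exact: measurable_laplace.
- by move=> t /=; rewrite in_itv/= andbT => t0; rewrite lee_fin mulr_ge0 ?expR_ge0 ?p0.
- by apply: subset_itvr; rewrite bnd_simp ltW.
Unshelve. all: by end_near. Qed.

End power_tail.

(** * The growth rate of the chain *)

Section chain_growth_rate.
Context {R : realType} {d : measure_display} {Omega : measurableType d} {S : countType}.
Variables (Pr : S -> probability Omega R) (X : R -> Omega -> S).
Hypothesis chain : markov_chain Pr X.
Variable i : S.

Local Notation p := (return_prob Pr X i).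
Local Notation L := (local_time X i).
Local Notation r := (growth_rate Pr X i).

Lemma exp_moment_renewal k t : 0 <= k -> 0 <= t ->
  ((fine 'E_(Pr i)[fun w => expR (k * L t w)])%:E =
   1 + k%:E * \int[lebesgue_measure]_(s in `[0%R, t]) (weighted_return Pr X i k s)%:E)%E.
Proof.
move=> k0 t0; rewrite -(exp_momentE chain)//.
exact: (@exp_momentK _ _ _ (Pr i) _ t (measurable_local_time chain i t) (local_time_ge0 X i t)
  (fun w => local_time_le chain i w t0) k k0).
Qed.

Lemma return_prob_lower : exists2 c1, 0 < c1 & forall t, 0 < t -> t <= 1 -> c1 <= p t.
Proof.
have [c1 c10 H] := return_lower_bound (return_prob_cvg1 chain i)
  (return_prob0 chain i) (return_prob_supermul chain i) 1.
by exists c1 => // t t0; apply: H; exact: ltW.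
Qed.

(** The last three properties, together with convexity, are all that the study of r uses about the
    growth rate; the first gives the existence of the limit and its convexity. *)
Lemma growth_rate_spec k : 0 < k ->
  [/\ log_moment Pr X i k t @[t --> +oo] --> r k, 0 <= r k <= k,
    (forall s, 0 < s -> (k%:E * laplace p s < 1)%E -> r k <= s) &
    (forall s, 0 < s -> (1 < k%:E * laplace p s)%E -> s <= r k)].
Proof.
move=> k0; have k0' := ltW k0; have [c1 c10 pc] := return_prob_lower.
have mp := measurable_return_prob chain i.
have mw := measurable_weighted_return chain i k0'.
have w0 := weighted_return_ge0 Pr X i k.
have p0 := return_prob_ge0 Pr X i.
have ren t (t0 : 0 <= t) := weighted_return_renewal chain i k0' t0.
pose m t := fine 'E_(Pr i)[fun w => expR (k * L t w)].
have m1 t : 0 <= t -> 1 <= m t.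
  move=> t0; exact: (@fine_exp_moment_ge1 _ _ _ (Pr i) _ t (measurable_local_time chain i t)
    (local_time_ge0 X i t) (fun w => local_time_le chain i w t0) k k0').
have mU s : 0 <= s -> (k%:E * laplace p s < 1)%E ->
    exists2 C, 0 < C & forall t, 0 <= t -> m t <= C * expR (s * t).
  move=> s0 ks.
  have [C C0 H] := moment_upper_bound mp p0 (return_prob_lt0 Pr X i) mw w0
    (weighted_return_lt0 Pr X i k) (weighted_return_le chain i k0') k0 ren s0 ks.
  by exists C => // t t0; rewrite -lee_fin exp_moment_renewal//; exact: H.
have mL s : 0 <= s -> (1 < k%:E * laplace p s)%E ->
    exists2 C, 0 < C & forall t, 1 <= t -> C * expR (s * t) <= m t.
  move=> s0 ks.
  have [C C0 H] := moment_lower_bound mp p0 (return_prob_cvg1 chain i)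
    (return_prob0 chain i) (return_prob_supermul chain i) mw w0 k0 ren s0 ks.
  exists C => // t t1; rewrite -lee_fin exp_moment_renewal//; first exact: H.
  exact: le_trans t1.
have [l [lcvg lk lU lL]] := growth_rate_exists mp (fun t _ => p0 t)
  (fun t _ => return_prob_le1 chain i t) ltr01 c10 pc k0 m1 mU mL.
have -> : r k = l by exact/cvg_lim.
by [].
Qed.

Lemma growth_rate_convex x y t : 0 < x -> 0 < y -> 0 < t < 1 ->
  r (t * x + (1 - t) * y) <= t * r x + (1 - t) * r y.
Proof.
move=> x0 y0 /andP[t0 t1].
have z0 : 0 < t * x + (1 - t) * y by rewrite addr_gt0// mulr_gt0// subr_gt0.
have [cx _ _ _] := growth_rate_spec x0; have [cy _ _ _] := growth_rate_spec y0.
have [cz _ _ _] := growth_rate_spec z0.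
have cxy : t * log_moment Pr X i x u + (1 - t) * log_moment Pr X i y u @[u --> +oo] -->
    t * r x + (1 - t) * r y.
  move: cx cy; move: (log_moment _ _ _ x) (log_moment _ _ _ y) (r x) (r y) => f g a e cx cy.
  by apply: cvgD; apply: cvgM; by [|exact: cvg_cst].
apply: ler_cvg_to cz cxy _; near=> u.
have u0 : 0 < u by near: u; apply: nbhs_pinfty_gt; exact: num_real.
rewrite /log_moment [t * (u^-1 * _)]mulrCA [(1 - t) * (u^-1 * _)]mulrCA -mulrDr ler_wpM2l ?invr_ge0 ?(ltW u0)//.
exact: (@ln_exp_moment_convex _ _ _ (Pr i) _ u (measurable_local_time chain i u) (local_time_ge0 X i u)
  (fun w => local_time_le chain i w (ltW u0)) x y t (ltW x0) (ltW y0) (ltW t0) (ltW t1)).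
Unshelve. all: by end_near. Qed.

Lemma return_prob_asymp (h : R -> R) (l : R) :
  trans_prob Pr X t i i / h t @[t --> +oo] --> l -> p t / h t @[t --> +oo] --> l.
Proof.
apply: cvg_trans; apply: near_eq_cvg; near=> t.
have t0 : 0 <= t by near: t; apply: nbhs_pinfty_ge; exact: num_real.
by rewrite /return_prob t0.
Unshelve. all: by end_near. Qed.

Lemma Green_laplace : Green Pr X i = laplace p 0.
Proof.
apply: eq_integral => t; rewrite inE/= in_itv/= andbT => t0.
by rewrite oppr0 mul0r expR0 mul1r /return_prob t0.
Qed.

Lemma Hinfty_laplace : Hinfty Pr X i = laplace (fun t => t * p t) 0.
Proof.
apply: eq_integral => t; rewrite inE/= in_itv/= andbT => t0.
by rewrite oppr0 mul0r expR0 mul1r /return_prob t0.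
Qed.

End chain_growth_rate.

Theorem corollary3p10 (R : realType) (d : measure_display)
    (Omega : measurableType d) (S : countType)
    (Pr : S -> probability Omega R) (X : R -> Omega -> S)
    (chain : markov_chain Pr X) (i : S) (c alpha : R)
    (c_gt0 : 0 < c) (alpha_gt0 : 0 < alpha)
    (p_asymp : asymp +oo (fun t => trans_prob Pr X t i i)
                         (fun t => c * t `^ (- alpha))) :
  let r := growth_rate Pr X i in
  let kcr := kappa_cr Pr X i in
  let G := fine (Green Pr X i) in
  let H := fine (Hinfty Pr X i) in
  (* the limit defining r exists *)
  (forall k, 0 < k -> cvg (log_moment Pr X i k t @[t --> +oo])) /\
  (* i *)
  (forall k, 0 < k -> 0 <= r k /\ (0 < r k <-> kcr < k)) /\
  (* ii *)
  strictly_convex_on [set k | kcr < k] r /\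
  (* iii *)
  ((forall k, 0 < k -> r k <= k) /\ r k / k @[k --> +oo] --> (1 : R)) /\
  (* iv *)
  (alpha <= 1 ->
    kcr = 0 /\
    (alpha < 1 ->
      asymp 0^'+ r (fun k => k `^ (1 - alpha)^-1
                             * (c * Gamma (1 - alpha)) `^ (1 - alpha)^-1)) /\
    (alpha = 1 ->
      exists e : R -> R,
        e =o_ (0^'+) (fun k : R => k^-1) /\
        \forall k \near 0^'+, r k = expR (- (c * k)^-1 + e k))) /\
  (* v *)
  (1 < alpha ->
    0 < kcr /\
    (alpha < 2 ->
      asymp kcr^'+ r
        (fun k => (k - kcr) `^ (alpha - 1)^-1
                  * (G ^+ 2 * (alpha - 1) / (c * Gamma (2 - alpha)))
                      `^ (alpha - 1)^-1)) /\
    (alpha = 2 ->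
      asymp kcr^'+ r
        (fun k => (k - kcr) / ln (k - kcr)^-1 * (G ^+ 2 / c))) /\
    (2 < alpha ->
      asymp kcr^'+ r (fun k => (k - kcr) * (G ^+ 2 / H)))).
Proof.
move=> r kcr G H.
have pa := return_prob_asymp p_asymp.
have mp := measurable_return_prob chain i.
have p0 t (_ : 0 <= t) := return_prob_ge0 Pr X i t.
have p1 t (_ : 0 <= t) := return_prob_le1 chain i t.
have [c1 c10 pc] := return_prob_lower chain i.
have b0 : 0 < 1 :> R by [].
have r1 k (k0 : 0 < k) : 0 <= r k <= k by have [] := growth_rate_spec chain i k0.
have rU k s (k0 : 0 < k) : 0 < s ->
    (k%:E * laplace (return_prob Pr X i) s < 1)%E -> r k <= s.
  by have [_ _ h _] := growth_rate_spec chain i k0; exact: h.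
have rL k s (k0 : 0 < k) : 0 < s ->
    (1 < k%:E * laplace (return_prob Pr X i) s)%E -> s <= r k.
  by have [_ _ _ h] := growth_rate_spec chain i k0; exact: h.
have kcrE : kcr = fine (laplace (return_prob Pr X i) 0)^-1%E.
  by rewrite /kcr /kappa_cr Green_laplace.
have GE : G = fine (laplace (return_prob Pr X i) 0) by rewrite /G Green_laplace.
have HE : H = fine (laplace (fun t => t * return_prob Pr X i t) 0).
  by rewrite /H Hinfty_laplace.
clearbody G H kcr; subst G H kcr.
have kcr0 := kcr_ge0 mp p0 p1 b0 c10 pc.
split; first by move=> k k0; have [h _ _ _] := growth_rate_spec chain i k0; exact/cvg_ex/ex_intro/h.
split.
  move=> k k0; split; first by have /andP[] := r1 k k0.
  split; last exact: root_gt0 mp p0 p1 b0 c10 pc rL k k0.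
  rewrite ltNge => rk; rewrite ltNge; apply: contra rk => kk.
  by rewrite (root_eq0 mp p0 p1 b0 c10 pc r1 rU k0 kk).
split.
  apply: (growth_rate_strictly_convex mp p0 p1 b0 c10 pc rU rL).
  - exact: power_tail_cvg0 c_gt0 alpha_gt0 pa.
  - by move=> s; exact: laplace_lt0 mp p0 c_gt0 alpha_gt0 pa s.
  - move=> x y t Kx Ky; apply: growth_rate_convex => //.
    + exact: le_lt_trans Kx.
    + exact: le_lt_trans Ky.
split; first split.
- by move=> k k0; have /andP[] := r1 k k0.
- exact: growth_rate_div_cvg1 mp p0 p1 (return_prob_cvg1 chain i) r1 rL.
split=> [a1|a1].
  have [a1lt|a1eq] : alpha < 1 \/ alpha = 1.
    by move: a1; rewrite le_eqVlt => /predU1P[->|]; [right|left].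
  - have a01 : 0 < alpha < 1 by rewrite alpha_gt0.
    have [K0 A] := growth_rate_alpha_lt1 mp p0 p1 b0 c10 pc rU rL c_gt0 pa a01.
    by split => //; split => // a1'; move: a1lt; rewrite a1' ltxx.
  - have [K0 A] := growth_rate_alpha_eq1 mp p0 p1 b0 c10 pc rU rL c_gt0 pa a1eq.
    by split => //; split => // a1lt; move: a1lt; rewrite a1eq ltxx.
have K0 := kcr_gt0 mp p0 p1 b0 c10 pc c_gt0 pa a1.
have lt2 := growth_rate_alpha_lt2 mp p0 p1 b0 c10 pc rU rL c_gt0 pa a1.
have eq2 := growth_rate_alpha_eq2 mp p0 p1 b0 c10 pc rU rL c_gt0 pa a1.
have gt2 := growth_rate_alpha_gt2 mp p0 p1 b0 c10 pc rU rL c_gt0 pa a1.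
by [].
Qed.
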